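(* Let $\mathcal H$ be a separable Hilbert space, $\mathcal L$ the bounded linear operators on $\mathcal H$, and let $T\in\mathcal L$ be a compact Hermitian operator with expansion $T=\sum_{i=1}^\infty\lambda_iP_i$, where the $\lambda_i\in\mathbb R$ are eigenvalues of $T$ and the $P_i$ are orthogonal projections onto one-dimensional eigenspaces. Let $D\subset\mathbb C$ be open, $\phi:D\to\mathbb C$ analytic, and let $\Omega$ be a bounded open region with smooth boundary $\Gamma=\partial\Omega$, $\sigma(T)\subset\Omega$, $\overline\Omega\subset D$ and $\mathrm{dist}(\Gamma,\sigma(T))>0$. Then, for the first and second derivatives $D_T\phi$ and $D_T^2\phi$ of $\phi$ at $T$ (defined by contour integrals in the context), for all $G\in\mathcal L$, $$D_T\phi[G]=\sum_{i=1}^\infty\phi'(\lambda_i)P_iGP_i+\sum_{i\neq k}\frac{\phi(\lambda_k)-\phi(\lambda_i)}{\lambda_k-\lambda_i}P_iGP_k$$ and $$\begin{aligned}D_T^2\phi[G,G]={}&\sum_{i,j,k=1}^\infty\mathbf 1_{\{\lambda_i\neq\lambda_j\neq\lambda_k\neq\lambda_i\}}\,P_iGP_jGP_k\cdot\frac{(\lambda_j-\lambda_k)\phi(\lambda_i)+(\lambda_k-\lambda_i)\phi(\lambda_j)+(\lambda_i-\lambda_j)\phi(\lambda_k)}{\lambda_i^2(\lambda_j-\lambda_k)+\lambda_j^2(\lambda_k-\lambda_i)+\lambda_k^2(\lambda_i-\lambda_j)}\\&+\sum_{i,j=1}^\infty\frac{\mathbf 1_{\{\lambda_j\neq\lamb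da_i\}}}{\lambda_j-\lambda_i}\big(P_jGP_jGP_i+P_iGP_jGP_j+P_jGP_iGP_j\big)\Big[\phi'(\lambda_j)-\frac{\phi(\lambda_i)-\phi(\lambda_j)}{\lambda_i-\lambda_j}\Big]\\&+\sum_{i=1}^\infty\phi''(\lambda_i)P_iGP_iGP_i.\end{aligned}$$
   Context: $\sigma(T)$ is the spectrum of $T$ and $R(z,T)=(zI-T)^{-1}$ is the resolvent for $z\notin\sigma(T)$. In the expansion $T=\sum_i\lambda_iP_i$ the finite-dimensional eigenspace of each non-zero eigenvalue is decomposed into mutually orthogonal one-dimensional spaces, so that eigenvalues are listed with repetition according to multiplicity; the resolvent is then $R(z,T)=\sum_{i=1}^\infty\frac1{z-\lambda_i}P_i$. The operator $\phi(T)$ is $\frac1{2\pi i}\int_\Gamma\phi(z)R(z,T)\,dz$. For $G\in\mathcal L$ one defines $D_T\phi[G]=\frac1{2\pi i}\int_\Gamma\phi(z)R(z,T)GR(z,T)\,dz$ and $D_T^2\phi[G,G]=\frac1{2\pi i}\int_\Gamma\phi(z)R(z,T)(GR(z,T))^2\,dz$; these are what is called the first and (in diagonal form) second Fréchet derivative of $\phi$ at $T$, and they are the first- and second-order terms in the expansion $\phi(T+G)=\phi(T)+D_T\phi[G]+D_T^2\phi[G,G]+S_{\phi,T,2}[G]$, whose remainder $S_{\phi,T,2}[G]$ is of order $\|G\|^3$ for small $G$.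
   Formalization: Second derivative: last coefficient is φ''(λ_i)/2, not φ''(λ_i), and for repeated eigenvalues the last two sums run over all indices with coinciding eigenvalues; first derivative: the quotient at λ_i=λ_k, i≠k, means φ'(λ_i). The printed formulas fail or are undefined there. *)

(* Defs.v *)
From Stdlib Require Import Reals Lra List ClassicalEpsilon.
From Coquelicot Require Import Coquelicot.
Open Scope R_scope.

(** * Restriction of scalars from C to R

    [RInt] takes values in real complete normed modules; [realify V] has the
    same carrier, topology and norm as [V]. *)

Section Realify.

Lemma realify_scal_assoc (V : ModuleSpace C_Ring) (x y : R) (u : V) :
  scal (RtoC x) (scal (RtoC y) u) = scal (RtoC (x * y)) u.
Proof. rewrite scal_assoc, RtoC_mult. reflexivity. Qed.

Lemma realify_scal_distr_r (V : ModuleSpace C_Ring) (x y : R) (u : V) :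
  scal (RtoC (x + y)) u = plus (scal (RtoC x) u) (scal (RtoC y) u).
Proof. rewrite RtoC_plus. exact (scal_distr_r (RtoC x) (RtoC y) u). Qed.

Definition realify_ModuleSpace_mixin (V : ModuleSpace C_Ring) :
  ModuleSpace.mixin_of R_Ring V :=
  ModuleSpace.Mixin R_Ring V (fun (r : R) (u : V) => scal (RtoC r) u)
    (realify_scal_assoc V)
    (fun u => scal_one u)
    (fun r u v => scal_distr_l (RtoC r) u v)
    (realify_scal_distr_r V).

Variable V : CompleteNormedModule C_AbsRing.

Definition realify_NormedModuleAux : NormedModuleAux R_AbsRing :=
  NormedModuleAux.Pack R_AbsRing V
    (NormedModuleAux.Class R_AbsRing V
       (ModuleSpace.Class R_Ring V _ (realify_ModuleSpace_mixin V))
       (UniformSpace.class V)) V.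

Lemma realify_norm_scal (r : R) (u : V) :
  norm (scal (RtoC r) u) <= Rabs r * norm u.
Proof.
  rewrite <- (Cmod_R r). exact (norm_scal (RtoC r) u).
Qed.

Definition realify_NormedModule_mixin :
  NormedModule.mixin_of R_AbsRing realify_NormedModuleAux :=
  NormedModule.Mixin R_AbsRing realify_NormedModuleAux
    (fun u => @norm C_AbsRing V u) (@norm_factor C_AbsRing V)
    (fun u v => norm_triangle u v)
    realify_norm_scal
    (fun u v eps h => norm_compat1 u v eps h)
    (fun u v eps h => norm_compat2 u v eps h)
    (fun u h => norm_eq_zero u h).

Definition realify : CompleteNormedModule R_AbsRing :=
  CompleteNormedModule.Pack R_AbsRing V
    (CompleteNormedModule.Class R_AbsRing V
       (NormedModule.Class R_AbsRing V _ realify_NormedModule_mixin)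
       (CompleteSpace.mixin _ (CompleteSpace.class V))) V.

End Realify.

(** * Smooth contours *)

(** A closed curve is parametrized by [R] with period 1; [jc_inj] says that it
    is simple. *)
Record jordan_curve := {
  jc_pos : R -> C;
  jc_vel : R -> C;
  jc_derive : forall t,
    is_derive (K := R_AbsRing) (V := C_R_NormedModule) jc_pos t (jc_vel t);
  jc_cont : forall t, continuous (U := C_UniformSpace) jc_vel t;
  jc_regular : forall t, jc_vel t <> 0%C;
  jc_periodic : forall t, jc_pos (t + 1) = jc_pos t;
  jc_inj : forall s t, 0 <= s < 1 -> 0 <= t < 1 -> jc_pos s = jc_pos t -> s = t
}.

Definition on_curve (g : jordan_curve) (z : C) : Prop := exists t, jc_pos g t = z.

Definition contour_int {V : CompleteNormedModule C_AbsRing}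
    (Gam : list jordan_curve) (f : C -> V) : V :=
  fold_right
    (fun g acc =>
       plus (@RInt (realify V)
               (fun t => @scal C_AbsRing V (jc_vel g t) (f (jc_pos g t))) 0 1)
            acc)
    zero Gam.

Definition two_pi_i : C := (RtoC (2 * PI) * Ci)%C.

Definition winding (Gam : list jordan_curve) (w : C) : C :=
  (contour_int (V := C_CompleteNormedModule) Gam (fun z => / (z - w)) / two_pi_i)%C.

Definition closure_of (A : C -> Prop) (z : C) : Prop :=
  ~ locally (T := C_UniformSpace) z (fun w => ~ A w).

Definition boundary_of (A : C -> Prop) (z : C) : Prop :=
  closure_of A z /\ closure_of (fun w => ~ A w) z.

(** [Gam] parametrizes the boundary of [Om] by finitely many disjoint smooth
    Jordan curves. The orientation is the positive one of the holomorphic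
    functional calculus: [Gam] winds once around the points of [Om] and not
    at all around the points off its closure. *)
Record positive_boundary (Om : C -> Prop) (Gam : list jordan_curve) : Prop := {
  pb_image : forall z, boundary_of Om z <-> Exists (fun g => on_curve g z) Gam;
  pb_disjoint :
    ForallOrdPairs (fun g h => forall z, on_curve g z -> ~ on_curve h z) Gam;
  pb_inside : forall w, Om w -> winding Gam w = 1%C;
  pb_outside : forall w, ~ closure_of Om w -> winding Gam w = 0%C
}.

Definition analytic_on (A : C -> Prop) (f : C -> C) : Prop :=
  forall z0, A z0 -> exists (a : nat -> C) (r : posreal),
    forall z, Cmod (z - z0) < r ->
      is_pseries (K := C_AbsRing) (V := C_NormedModule) a (z - z0)%C (f z).

(** * Operators on a Hilbert space

    Bounded operators are the functions satisfying Coquelicot's [is_linear],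
    which includes boundedness. *)

Record is_inner_product {H : NormedModule C_AbsRing} (ip : H -> H -> C) : Prop := {
  ip_plus : forall x y z, ip (plus x y) z = (ip x z + ip y z)%C;
  ip_scal : forall (c : C) x y, ip (scal c x) y = (c * ip x y)%C;
  ip_sym : forall x y, ip x y = Cconj (ip y x);
  ip_norm : forall x, ip x x = RtoC (norm x ^ 2)
}.

Definition separable (H : NormedModule C_AbsRing) : Prop :=
  exists u : nat -> H, forall (x : H) (eps : posreal),
    exists n, norm (minus x (u n)) < eps.

Section Operators.

Context {H : CompleteNormedModule C_AbsRing}.
Variable ip : H -> H -> C.

Definition hermitian (T : H -> H) : Prop := forall x y, ip (T x) y = ip x (T y).

Definition compact_operator (T : H -> H) : Prop :=
  forall u : nat -> H, (exists M, forall n, norm (u n) <= M) ->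
  exists (s : nat -> nat) (l : H),
    (forall n, (s n < s (S n))%nat) /\
    filterlim (fun n => T (u (s n))) eventually (locally l).

Definition is_resolvent (T : H -> H) (z : C) (S : H -> H) : Prop :=
  is_linear S /\
  (forall x, S (minus (scal z x) (T x)) = x) /\
  (forall x, minus (scal z (S x)) (T (S x)) = x).

Definition spectrum (T : H -> H) (z : C) : Prop := ~ exists S, is_resolvent T z S.

Definition resolvent (T : H -> H) (z : C) : H -> H :=
  epsilon (inhabits (fun x : H => x)) (is_resolvent T z).

(** The integrands are norm-continuous along the contour, so the operator
    integrals are computed vector by vector. *)
Definition deriv1 (Gam : list jordan_curve) (T : H -> H) (phi : C -> C)
    (G : H -> H) (x : H) : H :=
  scal (/ two_pi_i)%C
    (contour_int Gam (fun z =>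
       let Rz := resolvent T z in scal (phi z) (Rz (G (Rz x))))).

Definition deriv2 (Gam : list jordan_curve) (T : H -> H) (phi : C -> C)
    (G : H -> H) (x : H) : H :=
  scal (/ two_pi_i)%C
    (contour_int Gam (fun z =>
       let Rz := resolvent T z in scal (phi z) (Rz (G (Rz (G (Rz x))))))).

Definition orthogonal_projection (P : H -> H) : Prop :=
  is_linear P /\ (forall x, P (P x) = P x) /\ hermitian P.

Definition eigenline (T P : H -> H) (l : R) : Prop :=
  exists e : H, e <> zero /\ T e = scal (RtoC l) e /\
    forall y, (exists x, P x = y) <-> exists c : C, y = scal c e.

(** The projections resolve the identity, so an orthonormal basis of the kernel
    of [T] is part of the expansion. The zero projections allowed by [ee_line]
    only serve to pad the sequence when [H] is finite-dimensional. *)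
Record eigen_expansion (T : H -> H) (lam : nat -> R) (P : nat -> H -> H) : Prop := {
  ee_proj : forall i, orthogonal_projection (P i);
  ee_line : forall i, eigenline T (P i) (lam i) \/ forall x, P i x = zero;
  ee_orth : forall i j x, i <> j -> P i (P j x) = zero;
  ee_id : forall x, is_series (fun i => P i x) x;
  ee_op : forall x, is_series (fun i => scal (RtoC (lam i)) (P i x)) (T x)
}.

(** Sums of operators converge in the strong operator topology; multiple sums
    are limits of square (cubic) partial sums. *)
Definition strong_sum1 (F : nat -> H -> H) (S : H -> H) : Prop :=
  forall x, is_series (fun i => F i x) (S x).

Definition strong_sum2 (F : nat -> nat -> H -> H) (S : H -> H) : Prop :=
  forall x,
    filterlim (fun N => sum_n (fun i => sum_n (fun j => F i j x) N) N)
      eventually (locally (S x)).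

Definition strong_sum3 (F : nat -> nat -> nat -> H -> H) (S : H -> H) : Prop :=
  forall x,
    filterlim
      (fun N =>
         sum_n (fun i => sum_n (fun j => sum_n (fun k => F i j k x) N) N) N)
      eventually (locally (S x)).

End Operators.

Definition indic (Q : Prop) : C :=
  if excluded_middle_informative Q then 1%C else 0%C.

(** The difference quotient, with its limit value at coincident points. *)
Definition diff_quot (phi : C -> C) (a b : R) : C :=
  if Req_EM_T a b then C_derive phi a else ((phi b - phi a) / (b - a))%C.

Definition coef_distinct (phi : C -> C) (a b c : R) : C :=
  (((b - c) * phi a + (c - a) * phi b + (a - b) * phi c)
   / (a ^ 2 * (b - c) + b ^ 2 * (c - a) + c ^ 2 * (a - b)))%C.

(** Coefficient of the terms in which the eigenvalue [b] occurs twice and the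
    eigenvalue [a] once. *)
Definition coef_double (phi : C -> C) (a b : R) : C :=
  (/ (b - a) * (C_derive phi b - (phi a - phi b) / (a - b)))%C.

(* Main.v *)
(** The Cauchy formula for the contour follows Dixon: the function equal to
    [int dq(z, w) dz] on [D] and to [int phi(z) / (z - w) dz] off [D] has a second-order
    Taylor expansion at every point and tends to [0] at infinity, hence vanishes by a
    Liouville argument. Expanding [int phi(z) / (z - w) dz = 2 i pi phi(w)] to second order
    in [w] gives the integrals with double and triple poles, so that
    [1 / (2 i pi) int phi(z) / ((z - a) (z - b) (z - c)) dz] is the divided difference of
    [phi] at [a, b, c] in all cases of coincidence.

    For operators, let [Q2 A B = 1 / (2 i pi) int phi R A R B R dz] and [E N = sum_(i <= N) P i].
    The cubic partial sum of the divided differences times [P i A P j B P k] is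
    [E N (Q2 (A E N) B) E N], which converges strongly to [Q2 A B]. To restrict the sum to
    [lam i = lam j], [A] is replaced by its block diagonal part [dA] with respect to the
    eigenspaces, which is bounded; similarly for [lam j = lam k] and [B], and for
    [lam i = lam k] one takes the block diagonal part of [Q2 (A E N) B] itself. The three sums
    of the theorem are combinations of these, by inclusion and exclusion. *)

Require Import Defs.
From Stdlib Require Import Reals ZArith Lra Lia List ClassicalEpsilon ssreflect.
From Coquelicot Require Import Coquelicot.
Open Scope R_scope.

(** * Limits, linear maps and inner products *)

(** The spectral sums converge only strongly, so a sum restricted to coinciding eigenvalues cannot
    be extracted from the total one by rearrangement: each restricted sum has to be exhibited as the
    sum attached to some bounded operator. Block diagonal parts serve for this because they never
    increase the norm, even with infinitely many blocks. The truncation stands inside the integral,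
    between two resolvents, because cubic partial sums cut the middle index too; removing it in the
    limit needs convergence that is uniform along the contour, which compactness provides. On the
    scalar side only winding numbers of the contour are given, hence Dixon's route. Complex
    differentiability enters as an expansion up to the quadratic term with a cubic remainder: this
    form passes under the integral by one norm estimate, is strong enough for a maximum principle,
    and has unique coefficients, so that both derivatives can be read off by comparison. *)

Lemma sq_le_inv (a b : R) : 0 <= b -> a ^ 2 <= b ^ 2 -> a <= b.
Proof. intros hb h. apply Rnot_lt_le. intro hlt. nra. Qed.

Lemma sq_lt_inv (a b : R) : 0 <= b -> a ^ 2 < b ^ 2 -> a < b.
Proof. intros hb h. apply Rnot_le_lt. intro hlt. nra. Qed.

Lemma plus_minus_cancel {G : AbelianGroup} (x y : G) : plus x (minus y x) = y.
Proof. rewrite /minus plus_comm -plus_assoc plus_opp_l. apply plus_zero_r. Qed.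

Lemma norm_minus_sym {V : NormedModule C_AbsRing} (x y : V) :
  norm (minus x y) = norm (minus y x).
Proof. rewrite -norm_opp opp_minus. reflexivity. Qed.

Definition tends {V : NormedModule C_AbsRing} (u : nat -> V) (l : V) : Prop :=
  filterlim u eventually (locally l).

Section SequenceLimits.

Context {V : NormedModule C_AbsRing}.

(** Balls of the uniform structure and balls of the norm agree only up to the constant
    [norm_factor]; the conversion is made here once. *)
Lemma tends_norm (u : nat -> V) (l : V) :
  tends u l <->
  forall eps : R, 0 < eps ->
    exists N, forall n, (N <= n)%nat -> norm (minus (u n) l) < eps.
Proof.
  unfold tends. rewrite filterlim_locally. split.
  - intros h eps he.
    assert (hf := @norm_factor_gt_0 _ V).
    assert (he' : 0 < eps / @norm_factor _ V) by (apply Rdiv_lt_0_compat; assumption).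
    destruct (h (mkposreal _ he')) as [N hN].
    exists N. intros n hn.
    replace eps with (@norm_factor _ V * mkposreal _ he') by (simpl; field; lra).
    apply norm_compat2, hN, hn.
  - intros h eps. destruct (h eps (cond_pos eps)) as [N hN].
    exists N. intros n hn. apply norm_compat1, hN, hn.
Qed.

Lemma tends_of_norm (u : nat -> V) (l : V) :
  (forall eps : R, 0 < eps ->
    exists N, forall n, (N <= n)%nat -> norm (minus (u n) l) < eps) ->
  tends u l.
Proof. apply tends_norm. Qed.

Lemma tends_to_norm (u : nat -> V) (l : V) :
  tends u l -> forall eps : R, 0 < eps ->
    exists N, forall n, (N <= n)%nat -> norm (minus (u n) l) < eps.
Proof. apply tends_norm. Qed.

Lemma tends_unique (u : nat -> V) (l m : V) :
  tends u l -> tends u m -> l = m.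
Proof. apply filterlim_locally_unique. Qed.

Lemma tends_linear {W : NormedModule C_AbsRing} (f : V -> W) (u : nat -> V) (l : V) :
  is_linear f -> tends u l ->
  tends (fun n => f (u n)) (f l).
Proof.
  intros hf hu. exact (filterlim_comp _ _ _ u f _ _ _ hu (linear_cont f l hf)).
Qed.

Lemma tends_plus (u v : nat -> V) (l m : V) :
  tends u l -> tends v m ->
  filterlim (fun n => plus (u n) (v n)) eventually (locally (plus l m)).
Proof.
  intros hu hv.
  exact (filterlim_comp_2 (G := locally l) (H := locally m) u v plus hu hv (filterlim_plus l m)).
Qed.

Lemma tends_scal (c : C) (u : nat -> V) (l : V) :
  tends u l ->
  tends (fun n => scal c (u n)) (scal c l).
Proof.
  intros hu. exact (filterlim_comp _ _ _ u (fun x => scal c x) _ _ _ hu (filterlim_scal_r c l)).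
Qed.

Lemma tends_norm_le (u : nat -> V) (l : V) (M : R) :
  tends u l -> (forall n, norm (u n) <= M) -> norm l <= M.
Proof.
  intros hu hM. apply Rnot_lt_le. intro hlt.
  destruct (tends_to_norm u l hu (norm l - M)) as [N hN]; [lra|].
  specialize (hN N (le_n N)). specialize (hM N).
  assert (h := norm_triangle_inv l (u N)).
  rewrite -norm_opp opp_minus in hN.
  assert (h2 := Rle_abs (norm l - norm (u N))). lra.
Qed.

Lemma tends_ext (u v : nat -> V) (l : V) :
  (forall n, u n = v n) -> tends u l ->
  tends v l.
Proof. intros h. exact (filterlim_ext u v h). Qed.

End SequenceLimits.

Section Linear.

Context {U V : NormedModule C_AbsRing}.

Lemma linear_sum_n (f : U -> V) (u : nat -> U) (n : nat) :
  is_linear f -> f (sum_n u n) = sum_n (fun i => f (u i)) n.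
Proof.
  intros hf. induction n as [|n IH].
  - rewrite !sum_O. reflexivity.
  - rewrite !sum_Sn (linear_plus f hf) IH. reflexivity.
Qed.

Lemma linear_bound (f : U -> V) :
  is_linear f -> exists M, 0 <= M /\ forall x, norm (f x) <= M * norm x.
Proof.
  intros hf. destruct (linear_norm f hf) as [M [h1 h2]]. exists M. split; [lra|exact h2].
Qed.

Lemma is_linear_of_bound (f : U -> V) (M : R) :
  (forall x y, f (plus x y) = plus (f x) (f y)) ->
  (forall (k : C) x, f (scal k x) = scal k (f x)) ->
  (forall x, norm (f x) <= M * norm x) -> is_linear f.
Proof.
  intros h1 h2 h3. apply (Build_is_linear f h1 h2).
  (* [is_linear] asks for a positive constant, while [M] may be zero or negative. *)
  exists (Rmax M 1). split; [apply Rlt_le_trans with 1; [lra|apply Rmax_r]|].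
  intros x. apply Rle_trans with (1 := h3 x).
  apply Rmult_le_compat_r; [apply norm_ge_0|apply Rmax_l].
Qed.

Lemma is_linear_sum_n (F : nat -> U -> V) (n : nat) :
  (forall i, is_linear (F i)) -> is_linear (fun x => sum_n (fun i => F i x) n).
Proof.
  intros hF.
  assert (hb : exists M, forall x, norm (sum_n (fun i => F i x) n) <= M * norm x).
  { induction n as [|n [M hM]].
    - destruct (linear_bound _ (hF 0%nat)) as [M [_ hM]]. exists M.
      intros x. rewrite sum_O. apply hM.
    - destruct (linear_bound _ (hF (S n))) as [M' [_ hM']]. exists (M + M').
      intros x. rewrite sum_Sn. rewrite Rmult_plus_distr_r.
      apply Rle_trans with (1 := norm_triangle _ _).
      apply Rplus_le_compat; [apply hM|apply hM']. }
  destruct hb as [M hM]. apply is_linear_of_bound with M.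
  - intros x y. rewrite -sum_n_plus. apply sum_n_ext. intro i. apply (linear_plus _ (hF i)).
  - intros k x. eapply eq_trans; [|exact (sum_n_scal_l k _ n)]. apply sum_n_ext. intro i.
    apply (linear_scal _ (hF i)).
  - exact hM.
Qed.

Lemma is_linear_scal_const (c : C) (f : U -> V) :
  is_linear f -> is_linear (fun x => scal c (f x)).
Proof.
  intros hf. apply is_linear_comp with (1 := hf).
  exact (is_linear_scal_r (V := V) c Cmult_comm).
Qed.

Lemma is_linear_minus (f g : U -> V) :
  is_linear f -> is_linear g -> is_linear (fun x => minus (f x) (g x)).
Proof.
  intros hf hg.
  apply (is_linear_comp (fun x => (f x, opp (g x))) (fun t => plus (fst t) (snd t))).
  - apply is_linear_prod; [exact hf|]. exact (is_linear_comp g opp hg is_linear_opp).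
  - apply is_linear_plus.
Qed.

End Linear.

Lemma is_linear_scal_vec {V : NormedModule C_AbsRing} (v : V) :
  is_linear (U := C_NormedModule) (fun c : C => scal c v).
Proof.
  apply (is_linear_of_bound (U := C_NormedModule) _ (norm v)).
  - intros x y. exact (scal_distr_r (V := V) x y v).
  - intros k x. symmetry. exact (scal_assoc (V := V) k x v).
  - intros x. rewrite Rmult_comm. exact (norm_scal (V := V) x v).
Qed.

Lemma Cconj_RtoC (r : R) : Cconj (RtoC r) = RtoC r.
Proof. unfold Cconj, RtoC. simpl. rewrite Ropp_0. reflexivity. Qed.

Section InnerProduct.

Context {H : NormedModule C_AbsRing} {ip : H -> H -> C} (Hip : is_inner_product ip).

Lemma ip_plus_r x y z : ip x (plus y z) = (ip x y + ip x z)%C.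
Proof.
  rewrite (ip_sym _ Hip) (ip_plus _ Hip) Cplus_conj -!(ip_sym _ Hip). reflexivity.
Qed.

Lemma ip_scal_r (c : C) x y : ip x (scal c y) = (Cconj c * ip x y)%C.
Proof.
  rewrite (ip_sym _ Hip) (ip_scal _ Hip) Cmult_conj -!(ip_sym _ Hip). reflexivity.
Qed.

Lemma ip_zero_l x : ip zero x = 0%C.
Proof.
  transitivity (ip (scal (RtoC 0) zero) x).
  - f_equal. symmetry. exact (scal_zero_l (K := C_Ring) (V := H) zero).
  - rewrite (ip_scal _ Hip). apply Cmult_0_l.
Qed.

Lemma ip_zero_r x : ip x zero = 0%C.
Proof. rewrite (ip_sym _ Hip) ip_zero_l. apply Cconj_RtoC. Qed.

Lemma ip_opp_r x y : ip x (opp y) = (- ip x y)%C.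
Proof.
  assert (h : (ip x y + ip x (opp y) = 0)%C)
    by (rewrite -ip_plus_r plus_opp_r; apply ip_zero_r).
  transitivity (- ip x y + (ip x y + ip x (opp y)))%C; [ring|]. rewrite h. ring.
Qed.

Lemma ip_minus_r x y z : ip x (minus y z) = (ip x y - ip x z)%C.
Proof. unfold minus. rewrite ip_plus_r ip_opp_r. reflexivity. Qed.

Lemma ip_orth_sym x y : ip x y = 0%C -> ip y x = 0%C.
Proof. intros h. rewrite (ip_sym _ Hip) h. apply Cconj_RtoC. Qed.

Lemma norm_pythagoras x y : ip x y = 0%C -> norm (plus x y) ^ 2 = norm x ^ 2 + norm y ^ 2.
Proof.
  intros h. apply RtoC_inj.
  rewrite RtoC_plus -!(ip_norm _ Hip) (ip_plus _ Hip) !ip_plus_r h (ip_orth_sym _ _ h).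
  ring.
Qed.

(** Pythagoras for the decomposition of [x] into its component [scal c y] along [y] and the
    orthogonal remainder; the former has norm |ip x y| / norm y. *)
Lemma ip_cauchy_schwarz x y : Cmod (ip x y) <= norm x * norm y.
Proof.
  destruct (Req_dec (norm y) 0) as [h0|h0].
  { rewrite (norm_eq_zero _ h0) ip_zero_r Cmod_0 norm_zero. lra. }
  assert (hy : 0 < norm y) by (destruct (norm_ge_0 y); [assumption|congruence]).
  set (c := (ip x y / RtoC (norm y ^ 2))%C).
  assert (hyC : RtoC (norm y ^ 2) <> 0%C).
  { intro e. apply RtoC_inj in e. apply pow_nonzero in e; assumption. }
  assert (hort : ip (minus x (scal c y)) (scal c y) = 0%C).
  { rewrite ip_scal_r (ip_sym _ Hip) ip_minus_r Cminus_conj -(ip_sym _ Hip).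
    rewrite ip_scal_r (Cmult_conj (Cconj c)) Cconj_conj (ip_norm _ Hip) Cconj_RtoC.
    unfold c at 2. field. exact hyC. }
  assert (hp := norm_pythagoras _ _ hort).
  rewrite {1}/minus -plus_assoc plus_opp_l plus_zero_r in hp.
  assert (hc : norm (scal c y) ^ 2 = Cmod (ip x y) ^ 2 / norm y ^ 2).
  { apply RtoC_inj. rewrite -(ip_norm _ Hip) (ip_scal _ Hip) ip_scal_r (ip_norm _ Hip).
    unfold c. rewrite RtoC_div; [|apply pow_nonzero; assumption].
    rewrite (Cmod2_conj (ip x y)) Cdiv_conj; [|assumption].
    rewrite Cconj_RtoC. field. assumption. }
  apply Rsqr_incr_0_var; [|apply Rmult_le_pos; apply norm_ge_0].
  unfold Rsqr.
  assert (h1 : Cmod (ip x y) ^ 2 / norm y ^ 2 <= norm x ^ 2)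
    by (rewrite -hc hp; assert (h := pow2_ge_0 (norm (minus x (scal c y)))); lra).
  apply (Rmult_le_compat_r (norm y ^ 2)) in h1; [|apply pow2_ge_0].
  unfold Rdiv in h1. rewrite Rmult_assoc Rinv_l in h1; [|apply pow_nonzero; assumption].
  nra.
Qed.

Lemma is_linear_ip_l y : is_linear (V := C_NormedModule) (fun x => ip x y).
Proof.
  apply (is_linear_of_bound (V := C_NormedModule) _ (norm y)).
  - intros x z. apply (ip_plus _ Hip).
  - intros k x. apply (ip_scal _ Hip).
  - intros x. rewrite Rmult_comm. apply ip_cauchy_schwarz.
Qed.

Lemma norm_sq_sum_n_m (y : nat -> H) n m :
  (forall i j, i <> j -> ip (y i) (y j) = 0%C) ->
  norm (sum_n_m y n m) ^ 2 = sum_n_m (fun k => norm (y k) ^ 2) n m.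
Proof.
  intros ho.
  assert (hs : forall n m j, (m < j)%nat -> ip (sum_n_m y n m) (y j) = 0%C).
  { intros n0 m0. induction m0 as [|m0 IH]; intros j hj.
    - destruct n0 as [|n0].
      + rewrite sum_n_n. apply ho. lia.
      + rewrite sum_n_m_zero; [|lia ..]. apply ip_zero_l.
    - destruct (Nat.le_gt_cases n0 (S m0)) as [h|h].
      + rewrite sum_n_Sm; [|lia ..]. rewrite (ip_plus _ Hip) IH; [|lia ..].
        rewrite ho; [|lia ..]. apply Cplus_0_r.
      + rewrite sum_n_m_zero; [|lia ..]. apply ip_zero_l. }
  induction m as [|m IH].
  - destruct n as [|n].
    + rewrite !sum_n_n. reflexivity.
    + rewrite !sum_n_m_zero; [|lia ..]. rewrite norm_zero. simpl. change (@zero R_AbelianMonoid) with 0. ring.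
  - destruct (Nat.le_gt_cases n (S m)) as [h|h].
    + rewrite !sum_n_Sm; [|lia ..]. rewrite norm_pythagoras; [|apply hs; lia].
      rewrite IH. reflexivity.
    + rewrite !sum_n_m_zero; [|lia ..]. rewrite norm_zero. change (@zero R_AbelianMonoid) with 0. ring.
Qed.

End InnerProduct.

(** By Pythagoras the squared norm of a section of the series is a section of the convergent series
    of squares, so the partial sums are Cauchy. Every infinite sum of blocks constructed below
    exists for this reason. *)
Lemma orthogonal_series {H : CompleteNormedModule C_AbsRing} {ip : H -> H -> C}
    (Hip : is_inner_product ip) (y : nat -> H) (B : R) :
  0 <= B ->
  (forall i j, i <> j -> ip (y i) (y j) = 0%C) ->
  (forall n, sum_n (fun k => norm (y k) ^ 2) n <= B ^ 2) ->
  exists l, is_series y l /\ norm l <= B.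
Proof.
  intros hB ho hb.
  assert (hex : ex_series (fun k => norm (y k) ^ 2)).
  { apply ex_finite_lim_seq_incr with (M := B ^ 2).
    - intros n. rewrite sum_Sn. change plus with Rplus.
      assert (h := pow2_ge_0 (norm (y (S n)))). lra.
    - exact hb. }
  assert (hy : ex_series y).
  { apply ex_series_Cauchy. intros eps.
    assert (he : 0 < eps ^ 2) by (apply pow_lt, cond_pos).
    destruct (Cauchy_ex_series _ hex (mkposreal _ he)) as [N hN].
    exists N. intros n m hn hm. specialize (hN n m hn hm). simpl in hN.
    apply sq_lt_inv; [left; apply cond_pos|].
    rewrite (norm_sq_sum_n_m Hip); [|assumption].
    exact (Rle_lt_trans _ _ _ (Rle_abs _) hN). }
  destruct hy as [l hl]. exists l. split; [exact hl|].
  apply tends_norm_le with (1 := hl). intros n.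
  apply sq_le_inv; [exact hB|].
  rewrite /sum_n (norm_sq_sum_n_m Hip); [|assumption]. apply hb.
Qed.

(** * Orthogonal families of projections and block compression *)

Section Series.

Context {V : NormedModule C_AbsRing}.

Lemma is_series_unique_norm (u : nat -> V) (l m : V) :
  is_series u l -> is_series u m -> l = m.
Proof. apply tends_unique. Qed.

Lemma is_series_linear {W : NormedModule C_AbsRing} (f : V -> W) (u : nat -> V) (l : V) :
  is_linear f -> is_series u l -> is_series (fun i => f (u i)) (f l).
Proof.
  intros hf hu.
  refine (tends_ext (fun n => f (sum_n u n)) _ _ _ (tends_linear f _ _ hf hu)).
  intro n. apply linear_sum_n, hf.
Qed.

Lemma sum_n_single (u : nat -> V) (i N : nat) :
  (i <= N)%nat -> (forall j, j <> i -> u j = zero) -> sum_n u N = u i.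
Proof.
  intros hi h. induction N as [|n IH].
  - rewrite sum_O. f_equal. lia.
  - rewrite sum_Sn. destruct (Nat.eq_dec (S n) i) as [e|e].
    + assert (h0 : sum_n u n = zero).
      { clear IH hi. assert (hn : forall m, (m <= n)%nat -> sum_n u m = zero).
        { induction m as [|m IH]; intros hm.
          - rewrite sum_O. apply h. lia.
          - rewrite sum_Sn IH; [|lia]. rewrite (h (S m)); [|lia]. apply plus_zero_l. }
        apply hn. lia. }
      rewrite h0 e. apply plus_zero_l.
    + rewrite IH; [|lia]. rewrite (h (S n)); [|exact e]. apply plus_zero_r.
Qed.

Lemma is_series_single (u : nat -> V) (i : nat) :
  (forall j, j <> i -> u j = zero) -> is_series u (u i).
Proof.
  intros h. apply tends_of_norm. intros eps he. exists i. intros n hn.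
  rewrite (sum_n_single u i n hn h) minus_eq_zero norm_zero. exact he.
Qed.

Lemma is_series_zero (u : nat -> V) : (forall j, u j = zero) -> is_series u zero.
Proof. intros h. rewrite -(h 0%nat). apply is_series_single. intros j _. apply h. Qed.

(** A total choice of the sum, so that blocks and pinchings can be defined as functions before their
    convergence is proved. *)
Definition ssum (u : nat -> V) : V := epsilon (inhabits zero) (is_series u).

Lemma ssum_correct (u : nat -> V) (l : V) : is_series u l -> is_series u (ssum u).
Proof. intros h. exact (epsilon_spec _ _ (ex_intro _ l h)). Qed.

Lemma ssum_eq (u : nat -> V) (l : V) : is_series u l -> ssum u = l.
Proof. intros h. apply (is_series_unique_norm u); [exact (ssum_correct u l h)|exact h]. Qed.

End Series.

(** Isolated as a notion because it serves twice: for the projections [P i] and for the coarser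
    projections [blk m]. *)
Definition orth_family {Hs : CompleteNormedModule C_AbsRing} (ip : Hs -> Hs -> C)
    (B : nat -> Hs -> Hs) : Prop :=
  (forall i, orthogonal_projection ip (B i)) /\
  (forall i j x, i <> j -> B i (B j x) = zero).

Section OrthFamily.

Context {Hs : CompleteNormedModule C_AbsRing}.
(* Reading the operations of [Hs] through one canonical path keeps [rewrite] effective. *)
Local Notation H := (CompleteNormedModule.NormedModule C_AbsRing Hs).
Context {ip : H -> H -> C} (Hip : is_inner_product ip).
Context (B : nat -> H -> H) (HB : orth_family ip B).

Lemma orth_family_linear i : is_linear (B i).
Proof. apply HB. Qed.

Lemma orth_family_zero i : B i zero = zero.
Proof. exact (linear_zero _ (orth_family_linear i)). Qed.

Lemma orth_family_idem i x : B i (B i x) = B i x.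
Proof. apply HB. Qed.

Lemma orth_family_ip i j x y : i <> j -> ip (B i x) (B j y) = 0%C.
Proof.
  intros h. destruct HB as [hp ho]. destruct (hp i) as [_ [_ hh]].
  rewrite (hh x (B j y)) ho; [|exact h]. apply (ip_zero_r Hip).
Qed.

Lemma orth_family_sum k x n :
  B k (sum_n (fun j => B j x) n) = if Nat.leb k n then B k x else zero.
Proof.
  rewrite (linear_sum_n _ _ _ (orth_family_linear k)). destruct HB as [hp ho].
  induction n as [|n IH].
  - rewrite sum_O. destruct (Nat.leb_spec k 0) as [h|h].
    + replace k with 0%nat by lia. apply orth_family_idem.
    + apply ho. lia.
  - rewrite sum_Sn IH. destruct (Nat.leb_spec k n); destruct (Nat.leb_spec k (S n)); try lia.
    + rewrite ho; [|lia]. apply plus_zero_r.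
    + replace k with (S n) by lia. rewrite orth_family_idem. apply plus_zero_l.
    + rewrite ho; [|lia]. apply plus_zero_r.
Qed.

(** The partial sum [s] is orthogonal to [x - s], because every [B k] with [k <= n] is self-adjoint
    and annihilates that difference; Pythagoras does the rest. *)
Lemma bessel x n : sum_n (fun k => norm (B k x) ^ 2) n <= norm x ^ 2.
Proof.
  assert (hs : norm (sum_n (fun k => B k x) n) ^ 2 = sum_n (fun k => norm (B k x) ^ 2) n).
  { apply (norm_sq_sum_n_m Hip). intros i j hij. apply orth_family_ip, hij. }
  rewrite -hs.
  set (s := sum_n (fun k => B k x) n).
  assert (ho : ip s (minus x s) = 0%C).
  { rewrite /s (linear_sum_n (V := C_NormedModule) (fun z => ip z _) _ _ (is_linear_ip_l Hip _)).
    transitivity (sum_n (fun _ => zero : C_NormedModule) n).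
    - apply sum_n_ext_loc. intros k hk. destruct HB as [hp _].
      destruct (hp k) as [hl [_ hh]].
      rewrite (hh x) (linear_minus _ _ _ hl) orth_family_sum.
      apply Nat.leb_le in hk. rewrite hk minus_eq_zero. apply (ip_zero_r Hip).
    - exact (sum_n_m_const_zero (G := NormedModule.AbelianMonoid _ C_NormedModule) 0 n). }
  assert (hp := norm_pythagoras Hip _ _ ho).
  rewrite plus_minus_cancel in hp. rewrite hp.
  assert (h := pow2_ge_0 (norm (minus x s))). lra.
Qed.

Lemma norm_orth_sum_le x n : norm (sum_n (fun k => B k x) n) <= norm x.
Proof.
  apply sq_le_inv; [apply norm_ge_0|].
  rewrite /sum_n (norm_sq_sum_n_m Hip).
  - apply bessel.
  - intros i j hij. apply orth_family_ip, hij.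
Qed.

(** Bessel's inequality turns domination of components into convergence with the same constant. It
    is applied to blocks with [c = 1], to pinchings, and to the resolvent with [c = / d]. *)
Lemma orth_multiplier (y : nat -> H) (c : R) x :
  0 <= c -> (forall k, B k (y k) = y k) -> (forall k, norm (y k) <= c * norm (B k x)) ->
  exists l, is_series y l /\ norm l <= c * norm x.
Proof.
  intros hc hy hb. apply (orthogonal_series Hip).
  - apply Rmult_le_pos; [exact hc|apply norm_ge_0].
  - intros i j hij. rewrite -(hy i) -(hy j). apply orth_family_ip, hij.
  - intros n. rewrite Rpow_mult_distr.
    apply Rle_trans with (c ^ 2 * sum_n (fun k => norm (B k x) ^ 2) n).
    + eapply Rle_trans; [|right; exact (sum_n_mult_l (K := R_Ring) (c ^ 2) _ n)].
      change mult with Rmult. unfold sum_n. apply sum_n_m_le. intros k. rewrite -Rpow_mult_distr.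
      apply pow_incr. split; [apply norm_ge_0|apply hb].
    + apply Rmult_le_compat_l; [apply pow2_ge_0|apply bessel].
Qed.

End OrthFamily.

(** * Pinching: the block diagonal part of a bounded operator *)

Section Pinching.

Context {Hs : CompleteNormedModule C_AbsRing}.
Local Notation H := (CompleteNormedModule.NormedModule C_AbsRing Hs).
Context {ip : H -> H -> C} (Hip : is_inner_product ip).
Context (P : nat -> H -> H) (HP : orth_family ip P).
Context (Hid : forall x, is_series (fun i => P i x) x).

(** Identities between blocks are checked component by component, which avoids manipulating their
    defining series. *)
Lemma orth_family_ext x y : (forall i, P i x = P i y) -> x = y.
Proof.
  intros h. apply (is_series_unique_norm (fun i => P i x)); [apply Hid|].
  refine (is_series_ext _ _ _ _ (Hid y)). intros i. symmetry. apply h.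
Qed.

Definition trunc (n : nat) (x : H) : H := sum_n (fun i => P i x) n.

Lemma is_linear_trunc n : is_linear (trunc n).
Proof. apply (is_linear_sum_n P). intros i. apply HP. Qed.

Lemma norm_trunc_le n x : norm (trunc n x) <= norm x.
Proof. apply (norm_orth_sum_le Hip P HP). Qed.

Lemma trunc_lim x : tends (fun n => trunc n x) x.
Proof. apply Hid. Qed.

(** A uniform bound reduces strong convergence to the vectors [P k x], whose finite sums are dense
    by [Hid]. *)
Lemma strong_lim_zero (A : nat -> H -> H) (c : R) :
  0 <= c -> (forall n, is_linear (A n)) -> (forall n x, norm (A n x) <= c * norm x) ->
  (forall k x, tends (fun n => A n (P k x)) zero) ->
  forall x, tends (fun n => A n x) zero.
Proof.
  intros hc hl hb h x. apply tends_of_norm. intros eps he.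
  (* Division by [c + 1] covers the case [c = 0]. *)
  assert (he2 : 0 < eps / 2 / (c + 1)) by (apply Rdiv_lt_0_compat; lra).
  destruct (tends_to_norm _ _ (trunc_lim x) _ he2) as [K hK].
  assert (hs : tends (fun n => A n (trunc K x)) zero).
  { unfold trunc. clear hK. induction K as [|m IH].
    - apply tends_ext with (2 := h 0%nat x). intros n. rewrite sum_O. reflexivity.
    - rewrite -(plus_zero_l zero).
      apply tends_ext with (2 := tends_plus _ _ _ _ IH (h (S m) x)).
      intros n. rewrite sum_Sn. symmetry. apply (linear_plus _ (hl n)). }
  specialize (hK K (le_n K)). assert (he3 : 0 < eps / 2) by lra.
  destruct (tends_to_norm _ _ hs _ he3) as [N hN].
  exists N. intros n hn. specialize (hN n hn).
  rewrite minus_zero_r in hN. rewrite minus_zero_r.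
  assert (e : A n x = plus (A n (trunc K x)) (A n (minus x (trunc K x)))).
  { rewrite -(linear_plus _ (hl n)) plus_minus_cancel. reflexivity. }
  rewrite e. apply Rle_lt_trans with (1 := norm_triangle (V := H) _ _).
  rewrite norm_minus_sym in hK.
  assert (h1 : norm (A n (minus x (trunc K x))) < eps / 2).
  { apply Rle_lt_trans with (1 := hb n _).
    apply Rle_lt_trans with ((c + 1) * norm (minus x (trunc K x))).
    - apply Rmult_le_compat_r; [apply norm_ge_0|lra].
    - apply (Rmult_lt_compat_l (c + 1)) in hK; [|lra].
      replace ((c + 1) * (eps / 2 / (c + 1))) with (eps / 2) in hK by (field; lra).
      exact hK. }
  lra.
Qed.

Context (cls : nat -> nat).

(** The labelling [cls] is left free: in the second-order sums equal eigenvalues share a label,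
    while in the first-order sums the identity labelling isolates the diagonal [i = k]. *)
Definition blk (m : nat) (x : H) : H :=
  ssum (fun i => if Nat.eqb (cls i) m then P i x else zero).

Lemma blk_spec m x :
  is_series (fun i => if Nat.eqb (cls i) m then P i x else zero) (blk m x) /\
  norm (blk m x) <= norm x.
Proof.
  destruct (orth_multiplier Hip P HP
    (fun i => if Nat.eqb (cls i) m then P i x else zero) 1 x) as [l [h1 h2]].
  - lra.
  - intros k. destruct (Nat.eqb _ _).
    + apply (orth_family_idem P HP).
    + apply (orth_family_zero P HP).
  - intros k. rewrite Rmult_1_l. destruct (Nat.eqb _ _); [lra|].
    rewrite norm_zero. apply norm_ge_0.
  - unfold blk. rewrite (ssum_eq _ _ h1). split; [exact h1|]. lra.
Qed.

Lemma is_linear_blk m : is_linear (blk m).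
Proof.
  apply is_linear_of_bound with 1.
  - intros x y. apply ssum_eq.
    refine (is_series_ext _ _ _ _ (is_series_plus _ _ _ _ (proj1 (blk_spec m x)) (proj1 (blk_spec m y)))).
    intros i. destruct (Nat.eqb _ _).
    + symmetry. apply linear_plus, HP.
    + apply plus_zero_r.
  - intros k x. apply ssum_eq.
    refine (is_series_ext _ _ _ _ (is_series_scal k _ _ (proj1 (blk_spec m x)))).
    intros i. destruct (Nat.eqb _ _).
    + symmetry. exact (linear_scal _ (orth_family_linear P HP i) k x).
    + exact (scal_zero_r (V := H) k).
  - intros x. rewrite Rmult_1_l. apply blk_spec.
Qed.

Lemma proj_blk i m x : P i (blk m x) = if Nat.eqb (cls i) m then P i x else zero.
Proof.
  assert (hl := orth_family_linear P HP i).
  assert (h := is_series_linear _ _ _ hl (proj1 (blk_spec m x))).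
  apply (is_series_unique_norm _ _ _ h).
  set (u := fun j => _) in h |- *.
  replace (if Nat.eqb (cls i) m then P i x else zero) with (u i).
  - apply is_series_single. intros j hj. unfold u. destruct (Nat.eqb _ _).
    + apply HP. congruence.
    + apply (orth_family_zero P HP).
  - unfold u. destruct (Nat.eqb _ _).
    + apply (orth_family_idem P HP).
    + apply (orth_family_zero P HP).
Qed.

Lemma blk_proj i m x : blk m (P i x) = if Nat.eqb (cls i) m then P i x else zero.
Proof.
  apply orth_family_ext. intros j. rewrite proj_blk.
  destruct (Nat.eq_dec j i) as [e|e].
  - subst j. destruct (Nat.eqb _ _); [reflexivity|].
    symmetry. apply (orth_family_zero P HP).
  - assert (h : P j (P i x) = zero) by (apply HP; exact e).
    rewrite h. destruct (Nat.eqb (cls i) m); destruct (Nat.eqb (cls j) m);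
      rewrite ?h ?(orth_family_zero P HP); reflexivity.
Qed.

Lemma ip_blk m x w : (forall i, cls i = m -> P i w = zero) -> ip (blk m x) w = 0%C.
Proof.
  intros h.
  assert (hs := is_series_linear _ _ _ (is_linear_ip_l Hip w) (proj1 (blk_spec m x))).
  apply (is_series_unique_norm _ _ _ hs). apply (is_series_zero (V := C_NormedModule)). intros i.
  destruct (Nat.eqb_spec (cls i) m) as [e|e].
  - destruct HP as [hp _]. destruct (hp i) as [_ [hi hh]].
    rewrite -hi (hh (P i x) w) h; [|exact e]. apply (ip_zero_r Hip).
  - apply (ip_zero_l Hip).
Qed.

Lemma blk_orth_family : orth_family ip blk.
Proof.
  (* Self-adjointness: both sides equal [ip (blk m x) (blk m y)], since [blk m x] is orthogonal to
     [y - blk m y]. *)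
  assert (hbb : forall m x y, ip (blk m x) y = ip (blk m x) (blk m y)).
  { intros m x y.
    assert (h : ip (blk m x) (minus y (blk m y)) = 0%C).
    { apply ip_blk. intros i hi. rewrite (linear_minus _ _ _ (orth_family_linear P HP i)).
      rewrite proj_blk. apply Nat.eqb_eq in hi. rewrite hi minus_eq_zero. reflexivity. }
    rewrite (ip_minus_r Hip) in h.
    transitivity (ip (blk m x) y - ip (blk m x) (blk m y) + ip (blk m x) (blk m y))%C.
    - ring.
    - rewrite h. ring. }
  split; [intros m; split; [|split]|].
  - apply is_linear_blk.
  - intros x. apply orth_family_ext. intros i. rewrite !proj_blk.
    destruct (Nat.eqb _ _); reflexivity.
  - intros x y. rewrite (hbb m x y) (ip_sym _ Hip x) (hbb m y x) -(ip_sym _ Hip). reflexivity.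
  - intros i j x hij. apply orth_family_ext. intros k. rewrite !proj_blk.
    rewrite (orth_family_zero P HP).
    destruct (Nat.eqb_spec (cls k) i); [|reflexivity].
    destruct (Nat.eqb_spec (cls k) j); [congruence|reflexivity].
Qed.

(** In matrix terms, the entries of [L] between different blocks are erased. The pieces act on
    orthogonal components of [x] and have orthogonal ranges, so the norm does not grow. *)
Definition pinch (L : H -> H) (x : H) : H := ssum (fun m => blk m (L (blk m x))).

Definition bounded_by (c : R) (L : H -> H) : Prop :=
  is_linear L /\ 0 <= c /\ forall x, norm (L x) <= c * norm x.

Lemma pinch_spec c L x :
  bounded_by c L ->
  is_series (fun m => blk m (L (blk m x))) (pinch L x) /\ norm (pinch L x) <= c * norm x.
Proof.
  intros [hl [hc hb]].
  destruct (orth_multiplier Hip blk blk_orth_family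
    (fun m => blk m (L (blk m x))) c x) as [l [h1 h2]].
  - exact hc.
  - intros k. apply (orth_family_idem blk blk_orth_family).
  - intros k. apply Rle_trans with (1 := proj2 (blk_spec k _)). apply hb.
  - unfold pinch. rewrite (ssum_eq _ _ h1). split; assumption.
Qed.

Lemma bounded_by_pinch c L : bounded_by c L -> bounded_by c (pinch L).
Proof.
  intros hL. destruct (hL) as [hl [hc _]].
  assert (hn : forall x, norm (pinch L x) <= c * norm x)
    by (intros x; apply (pinch_spec c L x hL)).
  split; [|split; assumption].
  apply is_linear_of_bound with c.
  - intros x y. apply ssum_eq.
    refine (is_series_ext _ _ _ _ (is_series_plus _ _ _ _ (proj1 (pinch_spec c L x hL)) (proj1 (pinch_spec c L y hL)))).
    intros i. rewrite (linear_plus _ (is_linear_blk i)) (linear_plus _ hl)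
      (linear_plus _ (is_linear_blk i)). reflexivity.
  - intros k x. apply ssum_eq.
    refine (is_series_ext _ _ _ _ (is_series_scal k _ _ (proj1 (pinch_spec c L x hL)))).
    intros i. rewrite (linear_scal _ (is_linear_blk i)) (linear_scal _ hl)
      (linear_scal _ (is_linear_blk i)). reflexivity.
  - exact hn.
Qed.

Lemma pinch_minus c d L M x :
  bounded_by c L -> bounded_by d M ->
  pinch (fun y => minus (L y) (M y)) x = minus (pinch L x) (pinch M x).
Proof.
  intros hL hM. apply ssum_eq.
  refine (is_series_ext _ _ _ _ (is_series_minus _ _ _ _ (proj1 (pinch_spec c L x hL)) (proj1 (pinch_spec d M x hM)))).
  intros i. rewrite (linear_minus _ _ _ (is_linear_blk i)). reflexivity.
Qed.

Lemma pinch_proj c L k x : bounded_by c L -> pinch L (P k x) = blk (cls k) (L (P k x)).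
Proof.
  intros hL. apply ssum_eq.
  set (F := fun m => blk m (L (blk m (P k x)))).
  assert (e : blk (cls k) (L (P k x)) = F (cls k)).
  { unfold F. rewrite blk_proj Nat.eqb_refl. reflexivity. }
  rewrite e. apply is_series_single. intros j hj. unfold F. rewrite blk_proj.
  destruct (Nat.eqb_spec (cls k) j); [congruence|].
  rewrite (linear_zero _ (proj1 hL)). exact (linear_zero _ (is_linear_blk _)).
Qed.

Lemma proj_pinch_proj c L i k x :
  bounded_by c L ->
  P i (pinch L (P k x)) = if Nat.eqb (cls i) (cls k) then P i (L (P k x)) else zero.
Proof. intros hL. rewrite (pinch_proj c); [|exact hL]. apply proj_blk. Qed.

Lemma norm_pinch_proj c L k x :
  bounded_by c L -> norm (pinch L (P k x)) <= norm (L (P k x)).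
Proof. intros hL. rewrite (pinch_proj c); [|exact hL]. apply blk_spec. Qed.

End Pinching.

(** * Contour integrals *)

(** The plane carries two uniform structures here, that of a product and that of the modulus. They
    have the same neighbourhoods, and continuity of products and of scalar multiplication is
    formulated in the second. *)
Lemma contC_iff_abs {T : UniformSpace} (f : T -> C) (t : T) :
  continuous (U := C_UniformSpace) f t <->
  continuous (U := AbsRing_UniformSpace C_AbsRing) f t.
Proof. split; intros h Q hQ; apply h; apply locally_C; exact hQ. Qed.

Section RealVariable.

Context {V : NormedModule C_AbsRing}.

Lemma continuous_R_of_norm (f : R -> V) (t : R) :
  (forall eps, 0 < eps -> exists d, 0 < d /\
     forall s, Rabs (s - t) < d -> norm (minus (f s) (f t)) < eps) ->
  continuous f t.
Proof.
  intros h. apply filterlim_locally. intros eps.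
  destruct (h eps (cond_pos eps)) as [d [hd h1]].
  exists (mkposreal d hd). intros s hs. apply norm_compat1, h1. exact hs.
Qed.

Lemma continuous_R_to_norm (f : R -> V) (t : R) :
  continuous f t ->
  forall eps, 0 < eps -> exists d, 0 < d /\
     forall s, Rabs (s - t) < d -> norm (minus (f s) (f t)) < eps.
Proof.
  intros h eps he.
  assert (hf := @norm_factor_gt_0 _ V).
  assert (he' : 0 < eps / @norm_factor _ V) by (apply Rdiv_lt_0_compat; assumption).
  destruct (proj1 (filterlim_locally f (f t)) h (mkposreal _ he')) as [d hd].
  exists d. split; [apply cond_pos|]. intros s hs.
  replace eps with (@norm_factor _ V * mkposreal _ he') by (simpl; field; lra).
  apply norm_compat2, hd. exact hs.
Qed.

Lemma continuous_R_scal (k : R -> C) (f : R -> V) (t : R) :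
  continuous (U := C_UniformSpace) k t -> continuous f t ->
  continuous (fun s => scal (k s) (f s)) t.
Proof.
  intros hk hf. apply contC_iff_abs in hk. exact (continuous_scal k f t hk hf).
Qed.

End RealVariable.

Lemma Riemann_sum_linear {V W : CompleteNormedModule C_AbsRing} (l : V -> W)
    (f : R -> V) (p : SF_seq) :
  is_linear l ->
  l (Riemann_sum (V := realify V) f p) = Riemann_sum (V := realify W) (fun t => l (f t)) p.
Proof.
  intros hl. unfold Riemann_sum.
  generalize (SF_h p, @zero R_AbelianMonoid) (SF_t p).
  intros x s. revert x. induction s as [|y s IH]; intros x; simpl.
  - exact (linear_zero l hl).
  - eapply eq_trans; [apply (linear_plus l hl)|].
    assert (h := linear_scal l hl (RtoC (fst y - fst x)) (f (snd y))).
    apply f_equal2; [exact h|apply IH].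
Qed.

Lemma is_RInt_linear {V W : CompleteNormedModule C_AbsRing} (l : V -> W)
    (f : R -> V) (a b : R) (I : V) :
  is_linear l -> is_RInt (V := realify V) f a b I ->
  is_RInt (V := realify W) (fun t => l (f t)) a b (l I).
Proof.
  intros hl hI. unfold is_RInt in *.
  apply filterlim_ext with
    (fun ptd => l (@scal R_Ring (realify V) (sign (b - a)) (Riemann_sum (V := realify V) f ptd))).
  - intros p. eapply eq_trans; [apply (linear_scal l hl (RtoC (sign (b - a))))|].
    apply (f_equal (fun x : W => scal (RtoC (sign (b - a))) x)).
    apply Riemann_sum_linear, hl.
  - exact (filterlim_comp _ _ _ _ l _ _ _ hI (linear_cont l I hl)).
Qed.

Lemma jc_pos_continuous (g : jordan_curve) (t : R) :
  continuous (U := C_UniformSpace) (jc_pos g) t.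
Proof.
  apply (ex_derive_continuous (K := R_AbsRing) (V := C_R_NormedModule)).
  exists (jc_vel g t). apply jc_derive.
Qed.

(** Continuity is asked of the composition with each parametrization, because the resolvent is
    controlled only at points of the contour. *)
Definition cont_along (Gam : list jordan_curve) {V : NormedModule C_AbsRing} (f : C -> V) : Prop :=
  forall g, In g Gam -> forall t : R, continuous (fun s => f (jc_pos g s)) t.

Definition on_contour (Gam : list jordan_curve) (z : C) : Prop :=
  exists g, In g Gam /\ on_curve g z.

Section ContourIntegral.

Context {V : CompleteNormedModule C_AbsRing}.
Local Notation curve_int g f :=
  (@RInt (realify V) (fun t => @scal C_AbsRing V (jc_vel g t) (f (jc_pos g t))) 0 1).

Lemma curve_int_correct (g : jordan_curve) (f : C -> V) :
  (forall t : R, continuous (fun s => f (jc_pos g s)) t) ->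
  is_RInt (V := realify V) (fun t => @scal C_AbsRing V (jc_vel g t) (f (jc_pos g t))) 0 1
    (curve_int g f).
Proof.
  intros h. apply (RInt_correct (V := realify V)).
  apply (ex_RInt_continuous (V := realify V)). intros t _.
  exact (continuous_R_scal (V := V) _ _ _ (jc_cont g t) (h t)).
Qed.

Lemma contour_int_ext (Gam : list jordan_curve) (f1 f2 : C -> V) :
  (forall z, on_contour Gam z -> f1 z = f2 z) -> contour_int Gam f1 = contour_int Gam f2.
Proof.
  unfold contour_int. induction Gam as [|g Gam IH]; intros h; simpl; [reflexivity|].
  f_equal.
  - apply (RInt_ext (V := realify V)). intros t _. rewrite h; [reflexivity|].
    exists g. split; [left; reflexivity|]. exists t. reflexivity.
  - apply IH. intros z [g' [h1 h2]]. apply h. exists g'. split; [right; exact h1|exact h2].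
Qed.

Lemma contour_int_plus (Gam : list jordan_curve) (f1 f2 : C -> V) :
  cont_along Gam f1 -> cont_along Gam f2 ->
  contour_int Gam (fun z => plus (f1 z) (f2 z)) = plus (contour_int Gam f1) (contour_int Gam f2).
Proof.
  unfold contour_int. induction Gam as [|g Gam IH]; intros h1 h2; simpl.
  - symmetry. exact (plus_zero_l (G := V) zero).
  - rewrite IH; [|intros g' hg; apply h1; right; exact hg|intros g' hg; apply h2; right; exact hg].
    assert (e : curve_int g (fun z => plus (f1 z) (f2 z)) = plus (curve_int g f1) (curve_int g f2)).
    { apply (is_RInt_unique (V := realify V)).
      eapply (is_RInt_ext (V := realify V));
        [|exact (is_RInt_plus (V := realify V) _ _ _ _ _ _
            (curve_int_correct g f1 (h1 g (or_introl eq_refl)))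
            (curve_int_correct g f2 (h2 g (or_introl eq_refl))))].
      intros t _. symmetry. exact (scal_distr_l (V := V) (jc_vel g t) _ _). }
    rewrite e. set (a := curve_int g f1). set (b := curve_int g f2).
    rewrite -!plus_assoc. f_equal. rewrite !plus_assoc. f_equal. apply plus_comm.
Qed.

(** [K] is chosen before the integrand: it adds up bounds of the velocities, in place of the total
    length of the curves. *)
Lemma contour_int_bound (Gam : list jordan_curve) :
  exists K, 0 <= K /\ forall (f : C -> V) (M : R), cont_along Gam f ->
    (forall z, on_contour Gam z -> norm (f z) <= M) -> norm (contour_int Gam f) <= K * M.
Proof.
  unfold contour_int. induction Gam as [|g Gam [K [hK IH]]].
  - exists 0. split; [lra|]. intros f M _ _. simpl. rewrite norm_zero. lra.
  - destruct (bounded_continuity (V := C_NormedModule) (jc_vel g) 0 1) as [L hL].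
    { intros t _. apply jc_cont. }
    assert (hL0 : 0 <= L) by (specialize (hL 0 ltac:(lra)); assert (h := norm_ge_0 (V := C_NormedModule) (jc_vel g 0)); lra).
    exists (L + K). split.
    { apply Rplus_le_le_0_compat; [|exact hK]. exact hL0. }
    intros f M hf hM. simpl.
    apply Rle_trans with (1 := norm_triangle (V := V) _ _). rewrite Rmult_plus_distr_r.
    apply Rplus_le_compat.
    + replace (L * M) with ((1 - 0) * (L * M)) by ring.
      apply (norm_RInt_le_const (V := realify V)
        (fun t => @scal C_AbsRing V (jc_vel g t) (f (jc_pos g t))) 0 1); [lra| |].
      2:{ apply curve_int_correct. apply hf. left. reflexivity. }
      intros t ht. apply Rle_trans with (1 := norm_scal (V := V) _ _).
      apply Rmult_le_compat; [apply Cmod_ge_0|apply norm_ge_0| |].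
      * left. exact (hL t ht).
      * apply hM. exists g. split; [left; reflexivity|]. exists t. reflexivity.
    + apply IH.
      * intros g' hg. apply hf. right. exact hg.
      * intros z [g' [h1 h2]]. apply hM. exists g'. split; [right; exact h1|exact h2].
Qed.

End ContourIntegral.

Lemma contour_int_linear {V W : CompleteNormedModule C_AbsRing} (Gam : list jordan_curve)
    (l : V -> W) (f : C -> V) :
  is_linear l -> cont_along Gam f ->
  l (contour_int Gam f) = contour_int Gam (fun z => l (f z)).
Proof.
  intros hl. unfold contour_int. induction Gam as [|g Gam IH]; intros h; simpl.
  - exact (linear_zero l hl).
  - eapply eq_trans; [apply (linear_plus l hl)|].
    apply f_equal2; [|apply IH; intros g' hg; apply h; right; exact hg].
    symmetry. apply (is_RInt_unique (V := realify W)).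
    eapply (is_RInt_ext (V := realify W));
      [|exact (is_RInt_linear l _ _ _ _ hl (curve_int_correct g f (h g (or_introl eq_refl))))].
    intros t _. exact (linear_scal l hl (jc_vel g t) _).
Qed.

(** * Power series in one complex variable *)

(* The two sides of an equation in a module over [C] may have a type that [ring] does not
   recognize as [C]. *)
Ltac eqC := match goal with |- @eq _ ?x ?y => change (@eq C x y) end.

Lemma locally_Cmod (z : C) (Q : C -> Prop) :
  locally (T := C_UniformSpace) z Q <->
  exists d, 0 < d /\ forall w, Cmod (w - z) < d -> Q w.
Proof.
  rewrite locally_C. split.
  - intros [d hd]. exists d. split; [apply cond_pos|]. intros w hw. apply hd. exact hw.
  - intros [d [hd h]]. exists (mkposreal d hd). intros w hw. apply h. exact hw.
Qed.

Lemma Cmod_minus_sym (z w : C) : Cmod (z - w) = Cmod (w - z).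
Proof. rewrite -Cmod_opp. f_equal. ring. Qed.

Lemma Cmod_minus_triangle (x y z : C) : Cmod (x - z) <= Cmod (x - y) + Cmod (y - z).
Proof. replace (x - z)%C with ((x - y) + (y - z))%C by ring. apply Cmod_triangle. Qed.

Lemma Cmod_plus_inv (x y : C) : Cmod x <= Cmod (x + y) + Cmod y.
Proof.
  replace x with ((x + y) + (- y))%C at 1 by ring. rewrite -(Cmod_opp y). apply Cmod_triangle.
Qed.

Lemma Cmod_sub_le (x y : C) : Cmod (x - y) <= Cmod x + Cmod y.
Proof. rewrite -(Cmod_opp y). apply Cmod_triangle. Qed.

Lemma Cminus_neq_0 (z w : C) : z <> w -> (z - w)%C <> 0%C.
Proof.
  intros h e. apply h. replace z with (z - w + w)%C by ring. rewrite e. ring.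
Qed.

Section ContinuityC.

Context {T : UniformSpace}.
Notation cc f t := (continuous (T := T) (U := C_UniformSpace) f t).

Lemma contC_const (c : C) (t : T) : cc (fun _ => c) t.
Proof. apply continuous_const. Qed.

Lemma contC_plus (f g : T -> C) (t : T) : cc f t -> cc g t -> cc (fun s => f s + g s)%C t.
Proof. intros hf hg. exact (continuous_plus (V := C_NormedModule) f g t hf hg). Qed.

Lemma contC_mult (f g : T -> C) (t : T) : cc f t -> cc g t -> cc (fun s => f s * g s)%C t.
Proof.
  intros hf hg. apply contC_iff_abs. apply contC_iff_abs in hf, hg.
  exact (continuous_mult f g t hf hg).
Qed.

Lemma contC_opp (f : T -> C) (t : T) : cc f t -> cc (fun s => - f s)%C t.
Proof. intros hf. exact (continuous_opp (V := C_NormedModule) f t hf). Qed.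

Lemma contC_minus (f g : T -> C) (t : T) : cc f t -> cc g t -> cc (fun s => f s - g s)%C t.
Proof. intros hf hg. apply contC_plus; [exact hf|]. apply contC_opp, hg. Qed.

End ContinuityC.

Lemma contC_of_Cmod (f : C -> C) (z : C) :
  (forall eps, 0 < eps -> exists d, 0 < d /\
     forall w, Cmod (w - z) < d -> Cmod (f w - f z) < eps) ->
  continuous (T := C_UniformSpace) (U := C_UniformSpace) f z.
Proof.
  intros h Q hQ. apply locally_Cmod in hQ. destruct hQ as [e [he hQ]].
  apply locally_Cmod. destruct (h e he) as [d [hd h1]]. exists d. split; [exact hd|].
  intros w hw. apply hQ, h1, hw.
Qed.

Lemma contC_to_Cmod (f : C -> C) (z : C) :
  continuous (T := C_UniformSpace) (U := C_UniformSpace) f z ->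
  forall eps, 0 < eps -> exists d, 0 < d /\
     forall w, Cmod (w - z) < d -> Cmod (f w - f z) < eps.
Proof.
  intros h eps he. apply locally_Cmod. apply (h (fun y => Cmod (y - f z) < eps)).
  apply locally_Cmod. exists eps. split; [exact he|]. intros w hw. exact hw.
Qed.

Lemma contC_inv_at (z : C) : z <> 0%C ->
  continuous (T := C_UniformSpace) (U := C_UniformSpace) Cinv z.
Proof.
  intros hz. apply contC_of_Cmod. intros eps he.
  assert (hz' : 0 < Cmod z) by (apply Cmod_gt_0; exact hz).
  (* The first bound keeps |w| above |z| / 2; the second then controls |w - z| / (|w| |z|). *)
  exists (Rmin (Cmod z / 2) (eps * (Cmod z) ^ 2 / 2)). split.
  { apply Rmin_pos; [lra|]. assert (h := pow_lt _ 2 hz'). apply Rdiv_lt_0_compat; [nra|lra]. }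
  intros w hw.
  assert (h1 : Cmod (w - z) < Cmod z / 2) by (apply Rlt_le_trans with (1 := hw); apply Rmin_l).
  assert (h2 : Cmod (w - z) < eps * Cmod z ^ 2 / 2)
    by (apply Rlt_le_trans with (1 := hw); apply Rmin_r).
  assert (h3 : Cmod z / 2 < Cmod w).
  { assert (h := Cmod_triangle (z - w) w). rewrite Cmod_minus_sym in h.
    replace (z - w + w)%C with z in h by ring. lra. }
  assert (hw0 : w <> 0%C) by (apply Cmod_gt_0; lra).
  replace (/ w - / z)%C with ((z - w) * (/ w * / z))%C by (field; split; assumption).
  rewrite !Cmod_mult !Cmod_inv; [|assumption ..].
  rewrite Cmod_minus_sym.
  apply Rmult_lt_reg_r with (Cmod w * Cmod z); [nra|].
  set (x := Cmod w) in *. set (y := Cmod z) in *.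
  replace (Cmod (w - z) * (/ x * / y) * (x * y)) with (Cmod (w - z)) by (field; split; lra).
  apply Rlt_le_trans with (1 := h2).
  assert (h4 : eps * y * (y / 2) <= eps * y * x) by (apply Rmult_le_compat_l; [nra|lra]).
  nra.
Qed.

Lemma contC_inv {T : UniformSpace} (f : T -> C) (t : T) :
  f t <> 0%C -> continuous (U := C_UniformSpace) f t ->
  continuous (U := C_UniformSpace) (fun s => / f s)%C t.
Proof.
  intros h hf. exact (continuous_comp f Cinv t hf (contC_inv_at _ h)).
Qed.

Lemma contC_div {T : UniformSpace} (f g : T -> C) (t : T) :
  g t <> 0%C -> continuous (U := C_UniformSpace) f t -> continuous (U := C_UniformSpace) g t ->
  continuous (U := C_UniformSpace) (fun s => f s / g s)%C t.
Proof. intros h hf hg. apply contC_mult; [exact hf|]. apply contC_inv; assumption. Qed.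

Ltac contC :=
  repeat lazymatch goal with
  | h : continuous ?f ?t |- continuous (fun s => ?f s) ?t => exact h
  | h : continuous ?f ?t |- continuous ?f ?t => exact h
  | |- continuous (fun _ => ?c) _ => apply (contC_const c)
  | |- continuous (fun s => (@?f s + @?g s)%C) _ => apply (contC_plus f g)
  | |- continuous (fun s => (@?f s - @?g s)%C) _ => apply (contC_minus f g)
  | |- continuous (fun s => (@?f s * @?g s)%C) _ => apply (contC_mult f g)
  | |- continuous (fun s => (@?f s / @?g s)%C) _ => apply (contC_div f g)
  | |- continuous (fun s => s) _ => apply continuous_id
  end.

Lemma C_derive_of_limit (f : C -> C) (z l : C) :
  (forall eps, 0 < eps -> exists d, 0 < d /\ forall w, w <> z -> Cmod (w - z) < d ->
     Cmod ((f w - f z) / (w - z) - l) < eps) ->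
  C_derive f z = l.
Proof.
  intros h. apply is_C_lim_unique. intros Q hQ.
  apply locally_Cmod in hQ. destruct hQ as [e [he hQ]].
  destruct (h e he) as [d [hd h1]]. apply locally_Cmod. exists d. split; [exact hd|].
  intros w hw hne. apply hQ. apply h1; assumption.
Qed.

Lemma Cmod_pow_n (z : C) (n : nat) : Cmod (pow_n (K := C_Ring) z n) = Cmod z ^ n.
Proof.
  induction n as [|n IH]; simpl.
  - apply Cmod_1.
  - rewrite -IH. apply Cmod_mult.
Qed.

(** The estimate n rho^(n-1) |z - w|, multiplied through by [rho] so that no exponent n - 1
    occurs. *)
Lemma pow_n_sub_bound (z w : C) (rho : R) (n : nat) :
  Cmod z <= rho -> Cmod w <= rho ->
  Cmod (pow_n (K := C_Ring) z n - pow_n (K := C_Ring) w n)%C * rho <= INR n * rho ^ n * Cmod (z - w).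
Proof.
  intros hz hw. assert (h0 := Cmod_ge_0 z). induction n as [|n IH].
  - simpl. replace (@one C_Ring - @one C_Ring)%C with (RtoC 0) by (change (@one C_Ring) with (RtoC 1); ring).
    rewrite Cmod_0. lra.
  - rewrite S_INR.
    replace (pow_n (K := C_Ring) z (S n) - pow_n (K := C_Ring) w (S n))%C with
      (z * (pow_n (K := C_Ring) z n - pow_n (K := C_Ring) w n) + (z - w) * pow_n (K := C_Ring) w n)%C
      by (simpl; change mult with Cmult; ring).
    set (p := (pow_n z n - pow_n w n)%C) in *.
    assert (h := Cmod_triangle (z * p) ((z - w) * pow_n (K := C_Ring) w n)).
    rewrite !Cmod_mult Cmod_pow_n in h.
    assert (hp : Cmod w ^ n <= rho ^ n) by (apply pow_incr; split; [apply Cmod_ge_0|exact hw]).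
    assert (hd := Cmod_ge_0 (z - w)). assert (hp0 := Cmod_ge_0 p).
    apply Rle_trans with ((Cmod z * Cmod p + Cmod (z - w) * Cmod w ^ n) * rho).
    + apply Rmult_le_compat_r; [lra|exact h].
    + simpl.
      assert (h1 : Cmod z * (Cmod p * rho) <= rho * (INR n * rho ^ n * Cmod (z - w))).
      { apply Rmult_le_compat; [lra| |exact hz|exact IH]. apply Rmult_le_pos; lra. }
      assert (h2 : Cmod (z - w) * rho * Cmod w ^ n <= Cmod (z - w) * rho * rho ^ n).
      { apply Rmult_le_compat_l; [|exact hp]. apply Rmult_le_pos; lra. }
      nra.
Qed.

Lemma INR_le_pow2 (n : nat) : INR n <= 2 ^ n.
Proof.
  induction n as [|n IH]; [simpl; lra|]. rewrite S_INR. simpl.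
  assert (h : 1 <= 2 ^ n) by (apply pow_R1_Rle; lra). lra.
Qed.

Lemma pseries_coef_bound (a : nat -> C) (q : R) (l : C) :
  0 < q -> is_pseries (K := C_AbsRing) (V := C_NormedModule) a (RtoC q) l ->
  exists M, 0 <= M /\ forall n, Cmod (a n) * q ^ n <= M.
Proof.
  intros hq h.
  destruct (filterlim_bounded (K := C_AbsRing) (V := C_NormedModule) _ (ex_intro _ l h)) as [M hM].
  (* Each term is a difference of two consecutive partial sums, all of which are bounded by [M]. *)
  exists (M + M).
  assert (hM0 : 0 <= M) by (apply Rle_trans with (2 := hM 0%nat); apply (norm_ge_0 (V := C_NormedModule))).
  split; [lra|]. intros n.
  assert (e : Cmod (a n) * q ^ n = Cmod (@scal C_AbsRing C_NormedModule (pow_n (K := C_Ring) (RtoC q) n) (a n))).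
  { transitivity (Cmod (pow_n (K := C_Ring) (RtoC q) n * a n)).
    - rewrite Cmod_mult Cmod_pow_n Cmod_R Rabs_pos_eq; [|lra]. ring.
    - reflexivity. }
  rewrite e. destruct n as [|n].
  - specialize (hM 0%nat). rewrite sum_O in hM. apply Rle_trans with M; [exact hM|lra].
  - assert (h1 := hM (S n)). assert (h2 := hM n). rewrite sum_Sn in h1.
    set (x := sum_n _ n) in *. set (y := scal _ _) in *.
    apply Rle_trans with (Cmod (plus (y : C_NormedModule) x) + Cmod x).
    + exact (Cmod_plus_inv y x).
    + rewrite plus_comm. apply Rplus_le_compat; assumption.
Qed.

(** On the disc of radius [q / 4] the crude bound n <= 2^n still leaves the ratio 1/2, so the
    differences of the terms are dominated by 4 M / q |z - w| times a geometric series of sum 2. *)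
Lemma pseries_lipschitz (a : nat -> C) (q : R) (l : C) :
  0 < q -> is_pseries (K := C_AbsRing) (V := C_NormedModule) a (RtoC q) l ->
  exists L, 0 <= L /\ forall z w lz lw : C, Cmod z <= q / 4 -> Cmod w <= q / 4 ->
    is_pseries (K := C_AbsRing) (V := C_NormedModule) a z lz ->
    is_pseries (K := C_AbsRing) (V := C_NormedModule) a w lw ->
    Cmod (lz - lw) <= L * Cmod (z - w).
Proof.
  intros hq h. destruct (pseries_coef_bound a q l hq h) as [M [hM0 hM]].
  exists (8 * M / q). split; [apply Rdiv_le_0_compat; lra|].
  intros z w lz lw hz hw h1 h2.
  set (u := fun n => (a n * (pow_n (K := C_Ring) z n - pow_n (K := C_Ring) w n))%C : C_NormedModule).
  assert (hs : is_series u (lz - lw)%C).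
  { refine (is_series_ext _ _ _ _ (is_series_minus _ _ _ _ h1 h2)).
    intros n. unfold u. change scal with Cmult. change plus with Cplus. change opp with Copp.
    eqC.
    change (AbsRing.Ring C_AbsRing) with C_Ring. ring. }
  assert (hd := Cmod_ge_0 (z - w)).
  assert (hterm : forall n, Cmod (u n) <= 4 * M / q * Cmod (z - w) * (1 / 2) ^ n).
  { intros n. unfold u. rewrite Cmod_mult.
    assert (hb := pow_n_sub_bound z w (q / 4) n hz hw).
    set (p := Cmod (pow_n z n - pow_n w n)%C) in *.
    assert (hp : p <= 4 / q * (q / 4) ^ n * 2 ^ n * Cmod (z - w)).
    { apply Rmult_le_reg_r with (q / 4); [lra|]. apply Rle_trans with (1 := hb).
      replace (4 / q * (q / 4) ^ n * 2 ^ n * Cmod (z - w) * (q / 4)) with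
        (2 ^ n * (q / 4) ^ n * Cmod (z - w)) by (field; lra).
      apply Rmult_le_compat_r; [exact hd|]. apply Rmult_le_compat_r; [apply pow_le; lra|].
      apply INR_le_pow2. }
    apply Rle_trans with (Cmod (a n) * (4 / q * (q / 4) ^ n * 2 ^ n * Cmod (z - w))).
    - apply Rmult_le_compat_l; [apply Cmod_ge_0|exact hp].
    - replace (Cmod (a n) * (4 / q * (q / 4) ^ n * 2 ^ n * Cmod (z - w))) with
        (Cmod (a n) * q ^ n * (4 / q * Cmod (z - w) * (1 / 2) ^ n)).
      + replace (4 * M / q * Cmod (z - w) * (1 / 2) ^ n) with
          (M * (4 / q * Cmod (z - w) * (1 / 2) ^ n)) by (field; lra).
        apply Rmult_le_compat_r; [|apply hM].
        apply Rmult_le_pos; [|apply pow_le; lra]. apply Rmult_le_pos; [|exact hd].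
        apply Rdiv_le_0_compat; lra.
      + assert (ex : exists hf, hf = 1 / 2) by (eexists; reflexivity). destruct ex as [hf ehf].
        rewrite -ehf. replace (q / 4) with (q * hf * hf) by (rewrite ehf; field).
        rewrite !Rpow_mult_distr.
        assert (e : hf ^ n * 2 ^ n = 1) by (rewrite -Rpow_mult_distr ehf; replace (1 / 2 * 2) with 1 by field; apply pow1).
        transitivity (Cmod (a n) * q ^ n * (4 / q * Cmod (z - w) * (hf ^ n * (hf ^ n * 2 ^ n)))).
        * rewrite e. ring.
        * ring. }
  apply (tends_norm_le (V := C_NormedModule) (sum_n u) _ _ hs). intros n.
  change norm with Cmod.
  apply Rle_trans with (4 * M / q * Cmod (z - w) * (2 * (1 - (1 / 2) ^ S n))).
  - induction n as [|n IH].
    + rewrite sum_O. apply Rle_trans with (1 := hterm 0%nat). simpl. lra.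
    + rewrite sum_Sn. apply Rle_trans with (1 := Cmod_triangle _ _).
      specialize (hterm (S n)). simpl in *. lra.
  - assert (h3 : 0 <= (1 / 2) ^ S n) by (apply pow_le; lra).
    assert (h4 : 0 <= 4 * M / q * Cmod (z - w)).
    { apply Rmult_le_pos; [|exact hd]. apply Rdiv_le_0_compat; lra. }
    replace (8 * M / q * Cmod (z - w)) with (4 * M / q * Cmod (z - w) * 2) by (field; lra).
    apply Rmult_le_compat_l; [exact h4|]. lra.
Qed.

(** * Divided differences of analytic functions *)

(** Near [w0], [psi] is the power series shifted by three places, hence Lipschitz. Elsewhere it is
    obtained by solving the identity for it, so the identity holds for every [z]; later it is
    applied at contour points far from [w0]. *)
Lemma analytic_expansion (D : C -> Prop) (phi : C -> C) (w0 : C) :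
  open (T := C_UniformSpace) D -> analytic_on D phi -> D w0 ->
  exists (a1 a2 : C) (psi : C -> C) (r L : R),
    0 < r /\ 0 <= L /\ (forall z, Cmod (z - w0) < r -> D z) /\
    (forall z, phi z = phi w0 + a1 * (z - w0) + a2 * ((z - w0) * (z - w0))
                        + psi z * ((z - w0) * (z - w0) * (z - w0)))%C /\
    (forall z w, Cmod (z - w0) < r -> Cmod (w - w0) < r ->
       Cmod (psi z - psi w) <= L * Cmod (z - w)).
Proof.
  intros Do Ha Hw.
  destruct (proj1 (locally_Cmod w0 D) (Do w0 Hw)) as [rD [hrD hD]].
  destruct (Ha w0 Hw) as [a [r0 hr0]].
  assert (hpos := cond_pos r0).
  assert (ha0 : a 0%nat = phi w0).
  { assert (h0 : Cmod (w0 - w0) < r0) by (replace (w0 - w0)%C with (RtoC 0) by ring; rewrite Cmod_0; exact hpos).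
    specialize (hr0 w0 h0). replace (w0 - w0)%C with (RtoC 0) in hr0 by ring.
    exact (is_series_unique_norm (V := C_NormedModule) _ _ _
      (is_pseries_0 (K := C_AbsRing) (V := C_NormedModule) a) hr0). }
  set (b := PS_decr_n (K := C_AbsRing) (V := C_NormedModule) a 3).
  set (psi := fun z : C => match excluded_middle_informative (z = w0) with
    | left _ => a 3%nat
    | right _ => ((phi z - phi w0 - a 1%nat * (z - w0) - a 2%nat * ((z - w0) * (z - w0)))
                  / ((z - w0) * (z - w0) * (z - w0)))%C
    end).
  assert (hpsi : forall z, Cmod (z - w0) < r0 ->
    is_pseries (K := C_AbsRing) (V := C_NormedModule) b (z - w0)%C (psi z)).
  { intros z hz. unfold psi. destruct (excluded_middle_informative (z = w0)) as [e|e].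
    - subst z. replace (w0 - w0)%C with (RtoC 0) by ring.
      exact (is_pseries_0 (K := C_AbsRing) (V := C_NormedModule) b).
    - assert (hne := Cminus_neq_0 z w0 e).
      assert (hinv : mult (K := C_Ring) (/ (z - w0))%C (z - w0)%C = one).
      { change (/ (z - w0) * (z - w0) = 1)%C. field. exact hne. }
      assert (h := is_pseries_decr_n (K := C_AbsRing) (V := C_NormedModule) a 3 (z - w0)%C
        (/ (z - w0))%C (phi z) hinv ltac:(lia) (hr0 z hz)).
      refine (eq_ind _ (is_pseries (K := C_AbsRing) (V := C_NormedModule) b (z - w0)%C) h _ _).
      change (3 - 1)%nat with 2%nat. rewrite !sum_Sn sum_O. simpl.
      change (@scal _ C_NormedModule) with Cmult. change mult with Cmult.
      repeat match goal with |- context [@plus ?m] => change (@plus m) with Cplus end.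
      change opp with Copp.
      change (@one (AbsRing.Ring C_AbsRing)) with (RtoC 1).
      eqC.
      rewrite ha0. field. exact hne. }
  (* A real displacement inside the disc of convergence, at which the coefficients of [psi] are
     bounded. *)
  assert (hq : 0 < r0 / 2) by lra.
  assert (hb := hpsi (w0 + RtoC (r0 / 2))%C).
  replace (w0 + RtoC (r0 / 2) - w0)%C with (RtoC (r0 / 2)) in hb by ring.
  rewrite Cmod_R Rabs_pos_eq in hb; [|lra]. specialize (hb ltac:(lra)).
  destruct (pseries_lipschitz b (r0 / 2) _ hq hb) as [L [hL0 hL]].
  exists (a 1%nat), (a 2%nat), psi, (Rmin rD (r0 / 2 / 4)), L.
  split; [apply Rmin_pos; lra|]. split; [exact hL0|]. split; [|split].
  - intros z hz. apply hD. apply Rlt_le_trans with (1 := hz). apply Rmin_l.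
  - intros z. unfold psi. destruct (excluded_middle_informative (z = w0)) as [e|e].
    + subst z. ring.
    + field. apply Cminus_neq_0, e.
  - intros z w hz hw.
    assert (hz' : Cmod (z - w0) < r0 / 2 / 4) by (apply Rlt_le_trans with (1 := hz); apply Rmin_r).
    assert (hw' : Cmod (w - w0) < r0 / 2 / 4) by (apply Rlt_le_trans with (1 := hw); apply Rmin_r).
    replace (z - w)%C with ((z - w0) - (w - w0))%C by ring.
    apply hL; [lra|lra|apply hpsi; lra|apply hpsi; lra].
Qed.

Lemma Lipschitz_continuous_at (f : C -> C) (w : C) (d L : R) :
  0 < d -> 0 <= L -> (forall z, Cmod (z - w) < d -> Cmod (f z - f w) <= L * Cmod (z - w)) ->
  continuous (T := C_UniformSpace) (U := C_UniformSpace) f w.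
Proof.
  intros hd hL h. apply contC_of_Cmod. intros eps he.
  exists (Rmin d (eps / (L + 1))). split.
  { apply Rmin_pos; [exact hd|]. apply Rdiv_lt_0_compat; lra. }
  intros z hz.
  assert (h1 : Cmod (z - w) < d) by (apply Rlt_le_trans with (1 := hz); apply Rmin_l).
  assert (h2 : Cmod (z - w) < eps / (L + 1)) by (apply Rlt_le_trans with (1 := hz); apply Rmin_r).
  apply Rle_lt_trans with (1 := h z h1).
  apply (Rmult_lt_compat_l (L + 1)) in h2; [|lra].
  replace ((L + 1) * (eps / (L + 1))) with eps in h2 by (field; lra).
  assert (h3 := Cmod_ge_0 (z - w)). lra.
Qed.

Section Analytic.

Context (D : C -> Prop) (phi : C -> C).
Context (Dopen : open (T := C_UniformSpace) D) (Hphi : analytic_on D phi).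

Definition dq (z w : C) : C :=
  match excluded_middle_informative (z = w) with
  | left _ => C_derive phi w
  | right _ => ((phi z - phi w) / (z - w))%C
  end.

Lemma dq_diag w : dq w w = C_derive phi w.
Proof. unfold dq. destruct (excluded_middle_informative (w = w)); [reflexivity|congruence]. Qed.

Lemma dq_neq z w : z <> w -> dq z w = ((phi z - phi w) / (z - w))%C.
Proof. intros h. unfold dq. destruct (excluded_middle_informative (z = w)); [contradiction|reflexivity]. Qed.

Lemma analytic_continuous w :
  D w -> continuous (T := C_UniformSpace) (U := C_UniformSpace) phi w.
Proof.
  intros hw.
  destruct (analytic_expansion D phi w Dopen Hphi hw) as [a1 [a2 [psi [r [L [hr [hL [_ [he hl]]]]]]]]].
  assert (hcpsi : continuous (T := C_UniformSpace) (U := C_UniformSpace) psi w).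
  { apply (Lipschitz_continuous_at _ _ r L); [exact hr|exact hL|]. intros z hz.
    apply hl; [exact hz|]. replace (w - w)%C with (RtoC 0) by ring. rewrite Cmod_0. exact hr. }
  assert (hid : continuous (T := C_UniformSpace) (U := C_UniformSpace) (fun z => z - w)%C w).
  { contC. }
  refine (continuous_ext _ _ _ (fun z => eq_sym (he z)) _).
  contC.
Qed.

Lemma C_derive_expansion w a1 a2 psi r L :
  0 < r -> 0 <= L ->
  (forall z, phi z = phi w + a1 * (z - w) + a2 * ((z - w) * (z - w))
                        + psi z * ((z - w) * (z - w) * (z - w)))%C ->
  (forall z v, Cmod (z - w) < r -> Cmod (v - w) < r ->
       Cmod (psi z - psi v) <= L * Cmod (z - v)) ->
  C_derive phi w = a1 /\
  continuous (T := C_UniformSpace) (U := C_UniformSpace) (fun z => dq z w) w.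
Proof.
  intros hr hL he hl.
  (* The difference quotient with its pole cancelled; it is continuous at [w], where its value is
     [a1]. *)
  set (g := fun z => (a1 + a2 * (z - w) + psi z * ((z - w) * (z - w)))%C).
  assert (hcpsi : continuous (T := C_UniformSpace) (U := C_UniformSpace) psi w).
  { apply (Lipschitz_continuous_at _ _ r L); [exact hr|exact hL|]. intros z hz.
    apply hl; [exact hz|]. replace (w - w)%C with (RtoC 0) by ring. rewrite Cmod_0. exact hr. }
  assert (hid : continuous (T := C_UniformSpace) (U := C_UniformSpace) (fun z => z - w)%C w).
  { contC. }
  assert (hg : continuous (T := C_UniformSpace) (U := C_UniformSpace) g w).
  { unfold g. contC. }
  assert (hgw : g w = a1) by (unfold g; ring).
  assert (hq : forall z, z <> w -> ((phi z - phi w) / (z - w) = g z)%C).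
  { intros z hz. rewrite (he z). unfold g. field. apply Cminus_neq_0, hz. }
  assert (hd : C_derive phi w = a1).
  { apply C_derive_of_limit. intros eps heps.
    destruct (contC_to_Cmod g w hg eps heps) as [d [hd1 hd2]]. exists d. split; [exact hd1|].
    intros z hz hzd. rewrite (hq z hz) -hgw. apply hd2, hzd. }
  split; [exact hd|].
  refine (continuous_ext g _ _ _ hg). intros z.
  destruct (excluded_middle_informative (z = w)) as [e|e].
  - subst z. rewrite dq_diag hd. exact hgw.
  - rewrite (dq_neq z w e). symmetry. apply hq, e.
Qed.

Lemma dq_continuous_diag w :
  D w -> continuous (T := C_UniformSpace) (U := C_UniformSpace) (fun z => dq z w) w.
Proof.
  intros hw.
  destruct (analytic_expansion D phi w Dopen Hphi hw) as [a1 [a2 [psi [r [L [hr [hL [_ [he hl]]]]]]]]].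
  apply (C_derive_expansion w a1 a2 psi r L hr hL he hl).
Qed.

Lemma dq_continuous z w :
  D z -> D w -> continuous (T := C_UniformSpace) (U := C_UniformSpace) (fun v => dq v w) z.
Proof.
  intros hz hw. destruct (excluded_middle_informative (z = w)) as [e|e].
  - subst z. apply dq_continuous_diag, hw.
  - apply (continuous_ext_loc _ (fun v => (phi v - phi w) / (v - w))%C).
    + apply locally_Cmod. exists (Cmod (z - w)).
      split; [apply Cmod_gt_0, Cminus_neq_0, e|]. intros v hv. symmetry. apply dq_neq.
      intros ev. subst v. rewrite Cmod_minus_sym in hv. lra.
    + apply contC_div.
      * apply Cminus_neq_0, e.
      * apply contC_minus; [apply analytic_continuous, hz|apply contC_const].
      * contC.
Qed.

(** Newton's interpolation of [dq z] at [w0], with the third-order remainder controlled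
    by a divided difference of [psi]; the diagonal [z = w] is reached by continuity. *)
Lemma dq_newton w0 a1 a2 psi r L K z w :
  (forall z, Cmod (z - w0) < r -> D z) ->
  (forall z, phi z = phi w0 + a1 * (z - w0) + a2 * ((z - w0) * (z - w0))
                        + psi z * ((z - w0) * (z - w0) * (z - w0)))%C ->
  0 <= L -> (forall z w, Cmod (z - w0) < r -> Cmod (w - w0) < r ->
       Cmod (psi z - psi w) <= L * Cmod (z - w)) ->
  Cmod (w - w0) < r -> L <= K -> Cmod (psi z - psi w) <= K * Cmod (z - w) ->
  Cmod (dq z w - ((a1 + a2 * (z - w0) + psi z * ((z - w0) * (z - w0)))
                  + (a2 + psi z * (z - w0)) * (w - w0)
                  + psi z * ((w - w0) * (w - w0)))) <= K * Cmod (w - w0) ^ 3.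
Proof.
  intros hD he hL hl hw hLK hz.
  set (G := fun z => ((a1 + a2 * (z - w0) + psi z * ((z - w0) * (z - w0)))
                  + (a2 + psi z * (z - w0)) * (w - w0)
                  + psi z * ((w - w0) * (w - w0)))%C).
  assert (hne : forall v, v <> w -> Cmod (psi v - psi w) <= K * Cmod (v - w) ->
    Cmod (dq v w - G v) <= K * Cmod (w - w0) ^ 3).
  { intros v hv hb. rewrite (dq_neq v w hv).
    replace ((phi v - phi w) / (v - w) - G v)%C with
      ((w - w0) * (w - w0) * (w - w0) * ((psi v - psi w) / (v - w)))%C.
    - rewrite Cmod_mult Cmod_div; [|apply Cminus_neq_0, hv].
      rewrite !Cmod_mult. rewrite Rmult_comm.
      replace (Cmod (w - w0) ^ 3) with (Cmod (w - w0) * Cmod (w - w0) * Cmod (w - w0)) by ring.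
      apply Rmult_le_compat_r.
      { assert (h := Cmod_ge_0 (w - w0)). apply Rmult_le_pos; [|exact h]. apply Rmult_le_pos; exact h. }
      assert (hpos : 0 < Cmod (v - w)) by (apply Cmod_gt_0, Cminus_neq_0, hv).
      apply Rmult_le_reg_r with (Cmod (v - w)); [exact hpos|].
      unfold Rdiv. rewrite Rmult_assoc Rinv_l; [|lra]. rewrite Rmult_1_r. exact hb.
    - rewrite (he v) (he w). unfold G. field. apply Cminus_neq_0, hv. }
  fold (G z). destruct (excluded_middle_informative (z = w)) as [e|e]; [|apply hne; assumption].
  subst z. clear hz.
  assert (hcpsi : continuous (T := C_UniformSpace) (U := C_UniformSpace) psi w).
  { apply (Lipschitz_continuous_at _ _ (r - Cmod (w - w0)) L); [lra|exact hL|]. intros z hz.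
    apply hl; [|exact hw]. assert (h := Cmod_minus_triangle z w w0). lra. }
  assert (hid : continuous (T := C_UniformSpace) (U := C_UniformSpace) (fun z => z - w0)%C w).
  { contC. }
  assert (hc : continuous (T := C_UniformSpace) (U := C_UniformSpace) (fun v => dq v w - G v)%C w).
  { apply contC_minus; [apply dq_continuous_diag, hD, hw|].
    unfold G. contC. }
  (* If the bound failed at [w], it would by continuity also fail at the nearby point [w + s], which
     is off the diagonal and still in the disc. *)
  apply Rnot_lt_le. intros hlt.
  destruct (contC_to_Cmod _ _ hc (Cmod (dq w w - G w) - K * Cmod (w - w0) ^ 3)) as [d [hd hd2]]; [lra|].
  set (s := Rmin d (r - Cmod (w - w0)) / 2).
  assert (hm : 0 < Rmin d (r - Cmod (w - w0))) by (apply Rmin_pos; lra).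
  assert (hm1 := Rmin_l d (r - Cmod (w - w0))). assert (hm2 := Rmin_r d (r - Cmod (w - w0))).
  set (v := (w + RtoC s)%C).
  assert (hs : Cmod (v - w) = s).
  { unfold v. replace (w + RtoC s - w)%C with (RtoC s) by ring. rewrite Cmod_R.
    apply Rabs_pos_eq. unfold s. lra. }
  assert (hvw : v <> w).
  { intros e. rewrite e in hs. replace (w - w)%C with (RtoC 0) in hs by ring.
    rewrite Cmod_0 in hs. unfold s in hs. lra. }
  assert (h1 := hd2 v ltac:(rewrite hs; unfold s; lra)).
  assert (h2 : Cmod (dq v w - G v) <= K * Cmod (w - w0) ^ 3).
  { apply hne; [exact hvw|]. apply Rle_trans with (L * Cmod (v - w)).
    - apply hl; [|exact hw]. assert (h := Cmod_minus_triangle v w w0). unfold s in hs. lra.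
    - apply Rmult_le_compat_r; [apply Cmod_ge_0|exact hLK]. }
  assert (h3 := Cmod_triangle (dq w w - G w - (dq v w - G v)) (dq v w - G v)).
  replace (dq w w - G w - (dq v w - G v) + (dq v w - G v))%C with (dq w w - G w)%C in h3 by ring.
  rewrite (Cmod_minus_sym (dq w w - G w)) in h3. lra.
Qed.

(** On the diagonal [z = w], [dq_newton] expands the derivative itself: phi'(w) is a1 + 2 a2 x + 3
    psi(w) x^2 up to a cubic error, with x = w - w0. *)
Lemma C_derive2_expansion w0 a1 a2 psi r L :
  0 < r -> 0 <= L -> (forall z, Cmod (z - w0) < r -> D z) ->
  (forall z, phi z = phi w0 + a1 * (z - w0) + a2 * ((z - w0) * (z - w0))
                        + psi z * ((z - w0) * (z - w0) * (z - w0)))%C ->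
  (forall z w, Cmod (z - w0) < r -> Cmod (w - w0) < r ->
       Cmod (psi z - psi w) <= L * Cmod (z - w)) ->
  C_derive (C_derive phi) w0 = (2 * a2)%C.
Proof.
  intros hr hL hD he hl. apply C_derive_of_limit. intros eps heps.
  rewrite (proj1 (C_derive_expansion w0 a1 a2 psi r L hr hL he hl)).
  set (M := Cmod (psi w0) + L * r).
  assert (hM0 : 0 <= M) by (assert (h := Cmod_ge_0 (psi w0)); unfold M; nra).
  assert (hw00 : Cmod (w0 - w0) < r) by (replace (w0 - w0)%C with (RtoC 0) by ring; rewrite Cmod_0; exact hr).
  (* [3 * M] bounds the quadratic term, since |psi| <= [M] on the disc; [L * r] bounds the cubic
     error after one factor is estimated by [r]; 1 makes [B] positive. *)
  set (B := 3 * M + L * r + 1).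
  assert (hB : 0 < B) by (unfold B; nra).
  exists (Rmin r (eps / B)). split; [apply Rmin_pos; [exact hr|apply Rdiv_lt_0_compat; lra]|].
  intros w hne hw.
  assert (hw1 : Cmod (w - w0) < r) by (apply Rlt_le_trans with (1 := hw); apply Rmin_l).
  assert (hw2 : Cmod (w - w0) < eps / B) by (apply Rlt_le_trans with (1 := hw); apply Rmin_r).
  assert (hz0 : Cmod (psi w - psi w) <= L * Cmod (w - w)).
  { replace (psi w - psi w)%C with (RtoC 0) by ring. rewrite Cmod_0.
    apply Rmult_le_pos; [exact hL|apply Cmod_ge_0]. }
  assert (h := dq_newton w0 a1 a2 psi r L L w w hD he hL hl hw1 (Rle_refl L) hz0).
  rewrite dq_diag in h.
  set (x := (w - w0)%C) in *.
  assert (hx : x <> 0%C) by (apply Cminus_neq_0, hne).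
  assert (hxp : 0 < Cmod x) by (apply Cmod_gt_0; exact hx).
  assert (hpsi : Cmod (psi w) <= M).
  { assert (h1 := hl w w0 hw1 hw00). assert (h2 := Cmod_triangle (psi w - psi w0) (psi w0)).
    replace (psi w - psi w0 + psi w0)%C with (psi w) in h2 by ring. fold x in h1. unfold M. nra. }
  replace ((C_derive phi w - a1) / x - 2 * a2)%C with
    ((C_derive phi w - (a1 + a2 * x + psi w * (x * x) + (a2 + psi w * x) * x + psi w * (x * x))
      + 3 * (psi w * (x * x))) / x)%C by (field; exact hx).
  rewrite Cmod_div; [|exact hx].
  apply Rle_lt_trans with (B * Cmod x).
  - apply Rmult_le_reg_r with (Cmod x); [exact hxp|].
    unfold Rdiv. rewrite Rmult_assoc Rinv_l; [|lra]. rewrite Rmult_1_r.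
    apply Rle_trans with (1 := Cmod_triangle _ _).
    rewrite !Cmod_mult Cmod_R Rabs_pos_eq; [|lra].
    assert (h4 : 3 * (Cmod (psi w) * (Cmod x * Cmod x)) <= 3 * (M * (Cmod x * Cmod x))) by nra.
    assert (h5 : L * Cmod x ^ 3 <= L * r * (Cmod x * Cmod x)).
    { replace (L * Cmod x ^ 3) with (L * Cmod x * (Cmod x * Cmod x)) by ring.
      apply Rmult_le_compat_r; [nra|]. apply Rmult_le_compat_l; lra. }
    unfold B. nra.
  - apply (Rmult_lt_compat_l B) in hw2; [|exact hB].
    replace (B * (eps / B)) with eps in hw2 by (field; lra). exact hw2.
Qed.

End Analytic.

(** * A Liouville theorem from second-order expansions *)

(** The maximum is taken in one variable after the other; uniform continuity makes the partial
    maximum [M] continuous. *)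
Lemma continuous_2d_attains_max (f : R -> R -> R) (a b : R) :
  a <= b -> (forall x y, continuity_2d_pt f x y) ->
  exists x0 y0, a <= x0 <= b /\ a <= y0 <= b /\
    forall x y, a <= x <= b -> a <= y <= b -> f x y <= f x0 y0.
Proof.
  intros hab hf.
  assert (hy : forall x, exists y0, a <= y0 <= b /\ forall y, a <= y <= b -> f x y <= f x y0).
  { intros x. destruct (continuity_ab_maj (f x) a b hab) as [y0 [h1 h2]].
    - intros c _. apply continuity_pt_filterlim. apply filterlim_locally. intros eps.
      destruct (hf x c eps) as [d hd]. exists d. intros v hv. apply (hd x v).
      + rewrite Rminus_diag Rabs_R0. apply cond_pos.
      + exact hv.
    - exists y0. split; [exact h2|]. exact h1. }
  destruct (choice _ hy) as [Y hY].
  set (M := fun x => f x (Y x)).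
  assert (hM : forall c, a <= c <= b -> continuity_pt M c).
  { intros c hc. apply continuity_pt_filterlim. apply filterlim_locally. intros eps.
    (* The first variable gets a margin of 1 because points near an endpoint [c] may leave the
       interval. *)
    destruct (uniform_continuity_2d f (a - 1) (b + 1) a b (fun x y _ _ => hf x y) eps) as [d hd].
    assert (hd1 : 0 < Rmin d 1) by (apply Rmin_pos; [apply cond_pos|lra]).
    exists (mkposreal _ hd1). intros x hx.
    assert (hx1 : Rabs (x - c) < d) by (apply Rlt_le_trans with (1 := hx); apply Rmin_l).
    assert (hx2 : Rabs (x - c) < 1) by (apply Rlt_le_trans with (1 := hx); apply Rmin_r).
    apply Rabs_lt_between' in hx2.
    assert (hclose : forall y, a <= y <= b -> Rabs (f x y - f c y) < eps).
    { intros y hyy. apply hd; try lra. rewrite Rminus_diag Rabs_R0. apply cond_pos. }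
    destruct (hY x) as [hx3 hx4]. destruct (hY c) as [hc3 hc4].
    change (Rabs (M x - M c) < eps). unfold M.
    assert (h1 := hclose _ hx3). assert (h2 := hclose _ hc3).
    apply Rabs_lt_between' in h1, h2. apply Rabs_lt_between'.
    specialize (hx4 _ hc3). specialize (hc4 _ hx3). lra. }
  destruct (continuity_ab_maj M a b hab hM) as [x0 [h1 h2]].
  exists x0, (Y x0). split; [exact h2|]. split; [apply hY|].
  intros x y hx hyy. apply Rle_trans with (M x); [apply hY, hyy|apply h1, hx].
Qed.

Definition second_order_at (h : C -> C) (w0 : C) (b c : C) : Prop :=
  exists K d, 0 < d /\ 0 <= K /\ forall w, Cmod (w - w0) < d ->
    Cmod (h w - (h w0 + b * (w - w0) + c * ((w - w0) * (w - w0)))) <= K * Cmod (w - w0) ^ 3.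

Lemma second_order_continuous (h : C -> C) (w0 b c : C) :
  second_order_at h w0 b c -> continuous (T := C_UniformSpace) (U := C_UniformSpace) h w0.
Proof.
  intros [K [d [hd [hK hb]]]].
  apply (Lipschitz_continuous_at h w0 (Rmin d 1) (K + Cmod b + Cmod c)).
  - apply Rmin_pos; lra.
  - assert (h1 := Cmod_ge_0 b). assert (h2 := Cmod_ge_0 c). lra.
  - intros z hz.
    assert (hz1 : Cmod (z - w0) < d) by (apply Rlt_le_trans with (1 := hz); apply Rmin_l).
    assert (hz2 : Cmod (z - w0) < 1) by (apply Rlt_le_trans with (1 := hz); apply Rmin_r).
    specialize (hb z hz1). set (x := (z - w0)%C) in *.
    assert (hx := Cmod_ge_0 x). assert (h1 := Cmod_ge_0 b). assert (h2 := Cmod_ge_0 c).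
    replace (h z - h w0)%C with ((h z - (h w0 + b * x + c * (x * x))) + (b * x + c * (x * x)))%C by ring.
    apply Rle_trans with (1 := Cmod_triangle _ _).
    assert (h3 := Cmod_triangle (b * x) (c * (x * x))). rewrite !Cmod_mult in h3.
    assert (h4 : Cmod x * Cmod x <= Cmod x) by nra.
    assert (h5 : Cmod x ^ 3 <= Cmod x) by (simpl; nra).
    assert (h6 : K * Cmod x ^ 3 <= K * Cmod x) by (apply Rmult_le_compat_l; lra).
    assert (h7 : Cmod c * (Cmod x * Cmod x) <= Cmod c * Cmod x) by (apply Rmult_le_compat_l; lra).
    lra.
Qed.

Lemma Re_le_Cmod (z : C) : Re z <= Cmod z.
Proof. apply Rle_trans with (1 := Rle_abs _). apply re_le_Cmod. Qed.

Lemma Cmod_le_sum (x y : R) : Cmod (x, y) <= Rabs x + Rabs y.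
Proof.
  replace (x, y) with (RtoC x + Ci * RtoC y)%C.
  - apply Rle_trans with (1 := Cmod_triangle _ _).
    rewrite Cmod_mult Cmod_Ci !Cmod_R. lra.
  - unfold Ci, RtoC, Cplus, Cmult. simpl. f_equal; ring.
Qed.

(** The average of [h] over the four points [w0 + s], [w0 - s], [w0 + i s], [w0 - i s] is
    [h w0] up to [O(s^3)], since the terms in [b] and [c] cancel; adding [eps |w|^2] to
    [Re (k h)] therefore excludes interior maxima. *)
Lemma liouville_second_order (h : C -> C) :
  (forall w0, exists b c, second_order_at h w0 b c) ->
  (forall eps, 0 < eps -> exists r, forall w, r <= Cmod w -> Cmod (h w) < eps) ->
  forall w, h w = 0%C.
Proof.
  intros hexp hinf w1. apply NNPP. intros hne.
  (* Multiplication by the conjugate makes the real part of [k * h w1] equal to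
     [m = |h w1|^2 > 0]. *)
  set (k := Cconj (h w1)).
  assert (hkpos : 0 < Cmod k) by (unfold k; rewrite Cmod_conj; apply Cmod_gt_0; exact hne).
  set (m := Cmod k ^ 2).
  assert (hm : 0 < m) by (apply pow_lt, hkpos).
  assert (hkw1 : Re (k * h w1) = m).
  { unfold m, k. rewrite Cmod_conj. rewrite Cmult_comm -(Cmod2_conj (h w1)). reflexivity. }
  destruct (hinf (m / 2 / Cmod k)) as [r hr].
  { apply Rdiv_lt_0_compat; [lra|exact hkpos]. }
  set (S := Rmax (Rmax r (Cmod w1)) 1).
  assert (hS1 : 1 <= S) by apply Rmax_r.
  assert (hSr : r <= S) by (apply Rle_trans with (2 := Rmax_l _ _); apply Rmax_l).
  assert (hSw : Cmod w1 <= S) by (apply Rle_trans with (2 := Rmax_l _ _); apply Rmax_r).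
  (* On the square of half-side [S] the added term is at most m/4. Outside the disc of radius [S]
     the real part is below m/2, so the maximum, which is at least [m], is attained inside the
     disc. *)
  set (e := m / (8 * S ^ 2)).
  assert (hS2 : 0 < S ^ 2) by (apply pow_lt; lra).
  assert (he : 0 < e) by (apply Rdiv_lt_0_compat; lra).
  assert (heS : e * S ^ 2 = m / 8) by (unfold e; field; lra).
  set (v := fun x y : R => Re (k * h (x, y)) + e * (x ^ 2 + y ^ 2)).
  assert (hv : forall x y, continuity_2d_pt v x y).
  { intros x y eps. destruct (hexp (x, y)) as [b [c hbc]].
    apply second_order_continuous in hbc.
    assert (he2 : 0 < eps / 2 / Cmod k).
    { apply Rdiv_lt_0_compat; [|exact hkpos]. assert (h0 := cond_pos eps). lra. }
    destruct (contC_to_Cmod _ _ hbc _ he2) as [d [hd hd2]].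
    assert (hx := Rabs_pos x). assert (hy := Rabs_pos y).
    set (B := e * (2 * Rabs x + 2 * Rabs y + 2)).
    assert (hB : 0 < B) by (unfold B; apply Rmult_lt_0_compat; lra).
    assert (he3 : 0 < eps / 2 / B).
    { apply Rdiv_lt_0_compat; [|exact hB]. assert (h0 := cond_pos eps). lra. }
    assert (hdel : 0 < Rmin (d / 2) (Rmin 1 (eps / 2 / B))) by (apply Rmin_pos; [lra|apply Rmin_pos; lra]).
    exists (mkposreal _ hdel). simpl. intros u t hu ht.
    assert (hu1 : Rabs (u - x) < d / 2) by (apply Rlt_le_trans with (1 := hu); apply Rmin_l).
    assert (ht1 : Rabs (t - y) < d / 2) by (apply Rlt_le_trans with (1 := ht); apply Rmin_l).
    assert (hu2 : Rabs (u - x) < 1).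
    { apply Rlt_le_trans with (1 := hu). apply Rle_trans with (1 := Rmin_r _ _). apply Rmin_l. }
    assert (ht2 : Rabs (t - y) < 1).
    { apply Rlt_le_trans with (1 := ht). apply Rle_trans with (1 := Rmin_r _ _). apply Rmin_l. }
    assert (hu3 : Rabs (u - x) < eps / 2 / B).
    { apply Rlt_le_trans with (1 := hu). apply Rle_trans with (1 := Rmin_r _ _). apply Rmin_r. }
    assert (ht3 : Rabs (t - y) < eps / 2 / B).
    { apply Rlt_le_trans with (1 := ht). apply Rle_trans with (1 := Rmin_r _ _). apply Rmin_r. }
    assert (hC : Cmod ((u, t) - (x, y))%C < d).
    { replace ((u, t) - (x, y))%C with (u - x, t - y) by reflexivity.
      apply Rle_lt_trans with (1 := Cmod_le_sum _ _). lra. }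
    specialize (hd2 _ hC). unfold v.
    replace (Re (k * h (u, t)) + e * (u ^ 2 + t ^ 2) - (Re (k * h (x, y)) + e * (x ^ 2 + y ^ 2)))
      with (Re (k * (h (u, t) - h (x, y))) + e * ((u - x) * (u + x) + (t - y) * (t + y)))
      by (unfold Re; simpl; ring).
    apply Rle_lt_trans with (1 := Rabs_triang _ _).
    assert (h1 : Rabs (Re (k * (h (u, t) - h (x, y)))) < eps / 2).
    { apply Rle_lt_trans with (1 := re_le_Cmod _). rewrite Cmod_mult.
      apply (Rmult_lt_compat_l (Cmod k)) in hd2; [|exact hkpos].
      replace (Cmod k * (eps / 2 / Cmod k)) with (eps / 2) in hd2 by (field; lra). exact hd2. }
    assert (h2 : Rabs (e * ((u - x) * (u + x) + (t - y) * (t + y))) < eps / 2).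
    { rewrite Rabs_mult (Rabs_pos_eq e); [|lra].
      assert (hu4 : Rabs (u + x) <= 2 * Rabs x + 1).
      { replace (u + x) with ((u - x) + 2 * x) by ring. apply Rle_trans with (1 := Rabs_triang _ _).
        rewrite Rabs_mult (Rabs_pos_eq 2); [|lra]. lra. }
      assert (ht4 : Rabs (t + y) <= 2 * Rabs y + 1).
      { replace (t + y) with ((t - y) + 2 * y) by ring. apply Rle_trans with (1 := Rabs_triang _ _).
        rewrite Rabs_mult (Rabs_pos_eq 2); [|lra]. lra. }
      assert (h3 := Rabs_triang ((u - x) * (u + x)) ((t - y) * (t + y))).
      rewrite !Rabs_mult in h3.
      set (q := eps / 2 / B) in *.
      assert (h4 : Rabs (u - x) * Rabs (u + x) <= q * (2 * Rabs x + 1)).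
      { apply Rmult_le_compat; [apply Rabs_pos|apply Rabs_pos|lra|exact hu4]. }
      assert (h5 : Rabs (t - y) * Rabs (t + y) < q * (2 * Rabs y + 1)).
      { apply Rle_lt_trans with (Rabs (t - y) * (2 * Rabs y + 1)).
        - apply Rmult_le_compat_l; [apply Rabs_pos|exact ht4].
        - apply Rmult_lt_compat_r; lra. }
      replace (eps / 2) with (e * (q * (2 * Rabs x + 2 * Rabs y + 2))).
      - apply Rmult_lt_compat_l; [exact he|]. lra.
      - unfold q, B. field. lra. }
    lra. }
  destruct (continuous_2d_attains_max v (- S) S ltac:(lra) hv) as [x0 [y0 [hx0 [hy0 hmax]]]].
  set (w0 := (x0, y0) : C).
  assert (hfar : forall w, S <= Cmod w -> Re (k * h w) < m / 2).
  { intros w hw. apply Rle_lt_trans with (1 := Re_le_Cmod _). rewrite Cmod_mult.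
    assert (h1 := hr w ltac:(lra)). apply (Rmult_lt_compat_l (Cmod k)) in h1; [|exact hkpos].
    replace (Cmod k * (m / 2 / Cmod k)) with (m / 2) in h1 by (field; lra). exact h1. }
  assert (hw1v : m <= v x0 y0).
  { apply Rle_trans with (v (fst w1) (snd w1)).
    - unfold v. rewrite -(surjective_pairing w1) hkw1.
      assert (h1 : 0 <= fst w1 ^ 2) by apply pow2_ge_0.
      assert (h2 : 0 <= snd w1 ^ 2) by apply pow2_ge_0. nra.
    - assert (h1 := Rmax_Cmod w1).
      assert (h2 := Rle_trans _ _ _ (Rmax_l _ _) h1). assert (h3 := Rle_trans _ _ _ (Rmax_r _ _) h1).
      apply hmax; apply Rabs_le_between; lra. }
  assert (hin : Cmod w0 < S).
  { apply Rnot_le_lt. intros hle. assert (h1 := hfar w0 hle).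
    unfold v in hw1v. fold w0 in hw1v.
    assert (h2 : x0 ^ 2 <= S ^ 2) by nra. assert (h3 : y0 ^ 2 <= S ^ 2) by nra.
    assert (h4 : e * (x0 ^ 2 + y0 ^ 2) <= e * (2 * S ^ 2)) by (apply Rmult_le_compat_l; lra).
    lra. }
  destruct (hexp w0) as [b [c [K [d [hd [hK hb]]]]]].
  assert (hkK : 0 <= Cmod k * K) by (apply Rmult_le_pos; lra).
  set (A := Cmod k * K + 1).
  (* [s] keeps the four points within the range of the expansion and within the disc of radius [S].
     The summand 1 in [A] makes the cubic error strictly smaller than the gain [e * s ^ 2]. *)
  set (s := Rmin (d / 2) (Rmin (S - Cmod w0) (e / A))).
  assert (hA : 0 < A) by (unfold A; lra).
  assert (hs : 0 < s).
  { apply Rmin_pos; [lra|]. apply Rmin_pos; [lra|]. apply Rdiv_lt_0_compat; assumption. }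
  assert (hs1 : s < d) by (assert (h1 := Rmin_l (d / 2) (Rmin (S - Cmod w0) (e / A))); fold s in h1; lra).
  assert (hs2 : s <= S - Cmod w0).
  { apply Rle_trans with (1 := Rmin_r _ _). apply Rmin_l. }
  assert (hs3 : A * s <= e).
  { assert (h1 : s <= e / A) by (apply Rle_trans with (1 := Rmin_r _ _); apply Rmin_r).
    apply (Rmult_le_compat_l A) in h1; [|lra].
    replace (A * (e / A)) with e in h1 by (field; lra). exact h1. }
  assert (hpt : forall u : C, Cmod u = s ->
    Re (k * (h w0 + b * u + c * (u * u))) + e * (fst (w0 + u)%C ^ 2 + snd (w0 + u)%C ^ 2)
      <= v x0 y0 + Cmod k * K * s ^ 3).
  { intros u hu.
    assert (h1 : Cmod (w0 + u - w0) < d) by (replace (w0 + u - w0)%C with u by ring; lra).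
    specialize (hb _ h1). replace (w0 + u - w0)%C with u in hb by ring. rewrite hu in hb.
    assert (h2 : v (fst (w0 + u)%C) (snd (w0 + u)%C) <= v x0 y0).
    { assert (h3 : Cmod (w0 + u) <= S) by (apply Rle_trans with (1 := Cmod_triangle _ _); lra).
      assert (h4 := Rle_trans _ _ _ (Rmax_l _ _) (Rmax_Cmod (w0 + u)%C)).
      assert (h5 := Rle_trans _ _ _ (Rmax_r _ _) (Rmax_Cmod (w0 + u)%C)).
      apply hmax; apply Rabs_le_between; lra. }
    unfold v at 1 in h2. rewrite -(surjective_pairing (w0 + u)%C) in h2.
    set (p := (h w0 + b * u + c * (u * u))%C) in *.
    assert (h6 : Re (k * p) <= Re (k * h (w0 + u)%C) + Cmod k * K * s ^ 3).
    { replace (Re (k * p)) with (Re (k * h (w0 + u)%C) + Re (k * (p - h (w0 + u)%C)))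
        by (unfold Re; simpl; ring).
      apply Rplus_le_compat_l. apply Rle_trans with (1 := Re_le_Cmod _).
      rewrite Cmod_mult Rmult_assoc. apply Rmult_le_compat_l; [lra|].
      rewrite Cmod_minus_sym. exact hb. }
    lra. }
  assert (hc1 : Cmod (RtoC s) = s) by (rewrite Cmod_R; apply Rabs_pos_eq; lra).
  assert (hc2 : Cmod (- RtoC s) = s) by (rewrite Cmod_opp; exact hc1).
  assert (hc3 : Cmod (Ci * RtoC s) = s) by (rewrite Cmod_mult Cmod_Ci hc1; ring).
  assert (hc4 : Cmod (- (Ci * RtoC s)) = s) by (rewrite Cmod_opp; exact hc3).
  assert (g1 := hpt _ hc1). assert (g2 := hpt _ hc2).
  assert (g3 := hpt _ hc3). assert (g4 := hpt _ hc4).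
  unfold v in g1, g2, g3, g4. fold w0 in g1, g2, g3, g4.
  destruct k as [k1 k2], b as [b1 b2], c as [c1 c2], (h w0) as [p1 p2].
  unfold w0, Re, Ci, RtoC, Cplus, Cmult, Copp in g1, g2, g3, g4. simpl in g1, g2, g3, g4.
  assert (hsum : e * s ^ 2 <= Cmod (k1, k2) * K * s ^ 3) by (simpl; lra).
  assert (hfin : Cmod (k1, k2) * K * s ^ 3 = (Cmod (k1, k2) * K * s) * s ^ 2) by ring.
  assert (hs4 : 0 < s ^ 2) by (apply pow_lt, hs).
  assert (hAs : Cmod (k1, k2) * K * s = A * s - s) by (unfold A; ring).
  rewrite hfin hAs in hsum.
  assert (h9 : (A * s - s) * s ^ 2 < e * s ^ 2) by (apply Rmult_lt_compat_r; lra).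
  lra.
Qed.

(** * Scalar contour integrals *)

(** Tested on small positive reals: after division by [s], |b + c s| is O(s^2), which forces first
    [b] and then [c] to vanish. *)
Lemma second_order_coef_zero (b c : C) (K d : R) :
  0 < d -> 0 <= K ->
  (forall u, Cmod u < d -> Cmod (b * u + c * (u * u)) <= K * Cmod u ^ 3) ->
  b = 0%C /\ c = 0%C.
Proof.
  intros hd hK h.
  assert (hs : forall s, 0 < s < d -> Cmod (b + c * RtoC s) <= K * s ^ 2).
  { intros s hs. assert (hm : Cmod (RtoC s) = s) by (rewrite Cmod_R; apply Rabs_pos_eq; lra).
    specialize (h (RtoC s) ltac:(rewrite hm; lra)). rewrite hm in h.
    replace (b * RtoC s + c * (RtoC s * RtoC s))%C with ((b + c * RtoC s) * RtoC s)%C in h by ring.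
    rewrite Cmod_mult hm in h.
    apply Rmult_le_reg_r with s; [lra|]. apply Rle_trans with (1 := h). right. ring. }
  assert (hb : b = 0%C).
  { apply Cmod_eq_0. apply Rle_antisym; [|apply Cmod_ge_0].
    apply Rnot_lt_le. intros hpos.
    set (A := Cmod c + K + 1). assert (hc := Cmod_ge_0 c).
    assert (hA : 0 < A) by (unfold A; lra).
    set (s := Rmin (Rmin (d / 2) 1) (Cmod b / 2 / A)).
    assert (h0 : 0 < Cmod b / 2 / A) by (apply Rdiv_lt_0_compat; lra).
    assert (hs0 : 0 < s) by (apply Rmin_pos; [apply Rmin_pos; lra|exact h0]).
    assert (hs1 : s <= d / 2) by (apply Rle_trans with (1 := Rmin_l _ _); apply Rmin_l).
    assert (hs2 : s <= 1) by (apply Rle_trans with (1 := Rmin_l _ _); apply Rmin_r).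
    assert (hs3 : s <= Cmod b / 2 / A) by apply Rmin_r.
    apply (Rmult_le_compat_l A) in hs3; [|lra].
    replace (A * (Cmod b / 2 / A)) with (Cmod b / 2) in hs3 by (field; lra).
    specialize (hs s ltac:(lra)).
    assert (h1 := Cmod_plus_inv b (c * RtoC s)).
    rewrite Cmod_mult Cmod_R Rabs_pos_eq in h1; [|lra].
    assert (h2 : K * s ^ 2 <= K * s) by (apply Rmult_le_compat_l; [exact hK|nra]).
    unfold A in hs3. nra. }
  split; [exact hb|]. subst b.
  apply Cmod_eq_0. apply Rle_antisym; [|apply Cmod_ge_0].
  apply Rnot_lt_le. intros hpos.
  set (s := Rmin (d / 2) (Cmod c / 2 / (K + 1))).
  assert (h0 : 0 < Cmod c / 2 / (K + 1)) by (apply Rdiv_lt_0_compat; lra).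
  assert (hs0 : 0 < s) by (apply Rmin_pos; [lra|exact h0]).
  assert (hs1 : s <= d / 2) by apply Rmin_l.
  assert (hs3 : s <= Cmod c / 2 / (K + 1)) by apply Rmin_r.
  apply (Rmult_le_compat_l (K + 1)) in hs3; [|lra].
  replace ((K + 1) * (Cmod c / 2 / (K + 1))) with (Cmod c / 2) in hs3 by (field; lra).
  specialize (hs s ltac:(lra)). rewrite Cplus_0_l Cmod_mult Cmod_R Rabs_pos_eq in hs; [|lra].
  assert (h2 : Cmod c <= K * s).
  { apply Rmult_le_reg_r with s; [exact hs0|]. apply Rle_trans with (1 := hs). right. ring. }
  lra.
Qed.

Lemma second_order_unique (f g : C -> C) (w0 b c b' c' : C) :
  (exists d, 0 < d /\ forall w, Cmod (w - w0) < d -> f w = g w) ->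
  second_order_at f w0 b c -> second_order_at g w0 b' c' -> b = b' /\ c = c'.
Proof.
  intros [d [hd hfg]] [K1 [d1 [hd1 [hK1 h1]]]] [K2 [d2 [hd2 [hK2 h2]]]].
  assert (hm : 0 < Rmin d (Rmin d1 d2)) by (apply Rmin_pos; [exact hd|apply Rmin_pos; assumption]).
  destruct (second_order_coef_zero (b - b') (c - c') (K1 + K2) (Rmin d (Rmin d1 d2)) hm ltac:(lra)) as [e1 e2].
  - intros u hu.
    assert (hu0 : Cmod u < d) by (apply Rlt_le_trans with (1 := hu); apply Rmin_l).
    assert (hu1 : Cmod u < d1).
    { apply Rlt_le_trans with (1 := hu). apply Rle_trans with (1 := Rmin_r _ _). apply Rmin_l. }
    assert (hu2 : Cmod u < d2).
    { apply Rlt_le_trans with (1 := hu). apply Rle_trans with (1 := Rmin_r _ _). apply Rmin_r. }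
    assert (e0 : f w0 = g w0).
    { apply hfg. replace (w0 - w0)%C with (RtoC 0) by ring. rewrite Cmod_0. exact hd. }
    assert (e : (w0 + u - w0 = u)%C) by ring.
    specialize (h1 (w0 + u)%C). specialize (h2 (w0 + u)%C). specialize (hfg (w0 + u)%C).
    rewrite e in h1, h2, hfg. specialize (h1 hu1). specialize (h2 hu2). specialize (hfg hu0).
    replace ((b - b') * u + (c - c') * (u * u))%C with
      ((g (w0 + u) - (g w0 + b' * u + c' * (u * u)))
       - (f (w0 + u) - (f w0 + b * u + c * (u * u))))%C by (rewrite hfg e0; ring).
    apply Rle_trans with (1 := Cmod_sub_le _ _). lra.
  - split.
    + replace b with (b - b' + b')%C by ring. rewrite e1. ring.
    + replace c with (c - c' + c')%C by ring. rewrite e2. ring.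
Qed.

(** Moves every parameter into [[0, 1)], so that compactness of a segment yields bounds on the whole
    curve. *)
Lemma jc_pos_IZR (g : jordan_curve) (t : R) (n : Z) : jc_pos g (t + IZR n) = jc_pos g t.
Proof.
  revert t. assert (hnat : forall (m : nat) t, jc_pos g (t + INR m) = jc_pos g t).
  { induction m as [|m IH]; intros t.
    - simpl. rewrite Rplus_0_r. reflexivity.
    - rewrite S_INR -Rplus_assoc jc_periodic. apply IH. }
  intros t. destruct (Z.le_gt_cases 0 n) as [h|h].
  - rewrite -(Z2Nat.id n h) -INR_IZR_INZ. apply hnat.
  - rewrite -(hnat (Z.to_nat (- n)) (t + IZR n)). f_equal.
    rewrite INR_IZR_INZ Z2Nat.id; [|lia]. rewrite opp_IZR. ring.
Qed.

Lemma contour_bounded (Gam : list jordan_curve) (F : C -> C) :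
  (forall z, on_contour Gam z -> continuous (T := C_UniformSpace) (U := C_UniformSpace) F z) ->
  exists M, 0 <= M /\ forall z, on_contour Gam z -> Cmod (F z) <= M.
Proof.
  induction Gam as [|g Gam IH]; intros h.
  - exists 0. split; [lra|]. intros z [g [[] _]].
  - destruct IH as [M [hM0 hM]].
    { intros z [g' [h1 h2]]. apply h. exists g'. split; [right; exact h1|exact h2]. }
    destruct (bounded_continuity (V := C_NormedModule) (fun t => F (jc_pos g t)) 0 1) as [L hL].
    { intros t _. apply (continuous_comp (jc_pos g) F); [apply jc_pos_continuous|].
      apply h. exists g. split; [left; reflexivity|]. exists t. reflexivity. }
    exists (Rmax M L). split; [apply Rle_trans with (1 := hM0); apply Rmax_l|].
    intros z [g' [[e|h1] h2]].
    + subst g'. destruct h2 as [t ht].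
      apply Rle_trans with L; [|apply Rmax_r].
      assert (hb := base_Int_part t).
      specialize (hL (t + IZR (- Int_part t))). rewrite jc_pos_IZR ht opp_IZR in hL.
      left. apply hL. lra.
    + apply Rle_trans with M; [|apply Rmax_l]. apply hM. exists g'. split; assumption.
Qed.

Lemma cont_along_of_continuous (Gam : list jordan_curve) (F : C -> C) :
  (forall z, on_contour Gam z -> continuous (T := C_UniformSpace) (U := C_UniformSpace) F z) ->
  cont_along Gam (V := C_NormedModule) F.
Proof.
  intros h g hg t. apply (continuous_comp (jc_pos g) F); [apply jc_pos_continuous|].
  apply h. exists g. split; [exact hg|]. exists t. reflexivity.
Qed.

Definition cint (Gam : list jordan_curve) (F : C -> C) : C :=
  contour_int (V := C_CompleteNormedModule) Gam F.

Section ScalarIntegral.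

Context (Gam : list jordan_curve).
Notation ca F := (forall z, on_contour Gam z -> continuous (T := C_UniformSpace) (U := C_UniformSpace) F z).

Lemma cint_plus (F1 F2 : C -> C) :
  ca F1 -> ca F2 -> cint Gam (fun z => F1 z + F2 z)%C = (cint Gam F1 + cint Gam F2)%C.
Proof.
  intros h1 h2.
  exact (contour_int_plus (V := C_CompleteNormedModule) Gam F1 F2
    (cont_along_of_continuous _ _ h1) (cont_along_of_continuous _ _ h2)).
Qed.

Lemma cint_mult_r (F : C -> C) (c : C) :
  ca F -> cint Gam (fun z => F z * c)%C = (cint Gam F * c)%C.
Proof.
  intros h. symmetry.
  exact (contour_int_linear (V := C_CompleteNormedModule) (W := C_CompleteNormedModule) Gam
    (fun x : C => Cmult x c) F (is_linear_scal_vec (V := C_NormedModule) c) (cont_along_of_continuous _ _ h)).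
Qed.

Lemma cint_minus (F1 F2 : C -> C) :
  ca F1 -> ca F2 -> cint Gam (fun z => F1 z - F2 z)%C = (cint Gam F1 - cint Gam F2)%C.
Proof.
  intros h1 h2.
  transitivity (cint Gam (fun z => F1 z + F2 z * (- (1)))%C).
  - apply (contour_int_ext (V := C_CompleteNormedModule)). intros z _.
    assert (e : (F1 z - F2 z = F1 z + F2 z * (- (1)))%C) by ring. exact e.
  - rewrite cint_plus; [|exact h1|intros z hz; apply contC_mult; [apply h2, hz|apply contC_const]].
    rewrite cint_mult_r; [|exact h2]. ring.
Qed.

(** Integrates a second-order expansion in [u] term by term. [Kg] depends on the contour only, so
    one constant serves all points [w] near [w0]. *)
Lemma cint_second_order :
  exists Kg, 0 <= Kg /\ forall (F A B E : C -> C) (u : C) (M : R),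
    ca F -> ca A -> ca B -> ca E ->
    (forall z, on_contour Gam z -> Cmod (F z - (A z + B z * u + E z * (u * u))) <= M) ->
    Cmod (cint Gam F - (cint Gam A + cint Gam B * u + cint Gam E * (u * u))) <= Kg * M.
Proof.
  destruct (contour_int_bound (V := C_CompleteNormedModule) Gam) as [Kg [hKg hb]].
  exists Kg. split; [exact hKg|]. intros F A B E u M hF hA hB hE hM.
  assert (hBu : ca (fun z => B z * u)%C).
  { intros z hz. apply contC_mult; [apply hB, hz|apply contC_const]. }
  assert (hEu : ca (fun z => E z * (u * u))%C).
  { intros z hz. apply contC_mult; [apply hE, hz|apply contC_const]. }
  assert (hAB : ca (fun z => A z + B z * u)%C).
  { intros z hz. apply contC_plus; [apply hA, hz|apply hBu, hz]. }
  assert (hABE : ca (fun z => A z + B z * u + E z * (u * u))%C).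
  { intros z hz. apply contC_plus; [apply hAB, hz|apply hEu, hz]. }
  assert (e : (cint Gam F - (cint Gam A + cint Gam B * u + cint Gam E * (u * u)))%C =
    cint Gam (fun z => F z - (A z + B z * u + E z * (u * u)))%C).
  { rewrite cint_minus; [|exact hF|exact hABE]. rewrite cint_plus; [|exact hAB|exact hEu].
    rewrite cint_plus; [|exact hA|exact hBu]. rewrite !cint_mult_r; [reflexivity|assumption ..]. }
  rewrite e. apply hb; [|exact hM]. apply (cont_along_of_continuous Gam).
  intros z hz. apply contC_minus; [apply hF, hz|apply hABE, hz].
Qed.

End ScalarIntegral.

(** * The Cauchy formula *)

(** The finite geometric expansion of 1 / (x - u) with x = z - w0 and u = w - w0: the remainder is
    u^3 / (x^3 (x - u)), and |u| < d/2 keeps |x - u| at least d/2. *)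
Lemma off_contour_second_order (Gam : list jordan_curve) (f : C -> C) (w0 : C) (d : R) :
  (forall z, on_contour Gam z -> continuous (T := C_UniformSpace) (U := C_UniformSpace) f z) ->
  0 < d -> (forall z, on_contour Gam z -> d <= Cmod (z - w0)) ->
  second_order_at (fun w => cint Gam (fun z => f z / (z - w))%C) w0
    (cint Gam (fun z => f z / ((z - w0) * (z - w0)))%C)
    (cint Gam (fun z => f z / ((z - w0) * (z - w0) * (z - w0)))%C).
Proof.
  intros hf hd hfar.
  destruct (contour_bounded Gam f hf) as [M [hM0 hM]].
  destruct (cint_second_order Gam) as [Kg [hKg hb]].
  assert (hd3 : 0 < d * d * d) by (apply Rmult_lt_0_compat; nra).
  assert (hne : forall z w, on_contour Gam z -> Cmod (w - w0) < d -> (z - w)%C <> 0%C).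
  { intros z w hz hw e. specialize (hfar z hz).
    replace (z - w0)%C with ((z - w) + (w - w0))%C in hfar by ring.
    rewrite e Cplus_0_l in hfar. lra. }
  assert (hne0 : forall z, on_contour Gam z -> (z - w0)%C <> 0%C).
  { intros z hz. apply hne; [exact hz|]. replace (w0 - w0)%C with (RtoC 0) by ring.
    rewrite Cmod_0. exact hd. }
  exists (Kg * (M / (d * d * d) / (d / 2))), (d / 2). split; [lra|]. split.
  { apply Rmult_le_pos; [exact hKg|]. apply Rdiv_le_0_compat; [|lra]. apply Rdiv_le_0_compat; lra. }
  intros w hw. set (u := (w - w0)%C) in *.
  rewrite Rmult_assoc. apply hb.
  - intros z hz. specialize (hf z hz). assert (h := hne z w hz ltac:(fold u; lra)). contC. exact h.
  - intros z hz. specialize (hf z hz). assert (h := hne0 z hz). contC. exact h.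
  - intros z hz. specialize (hf z hz). assert (h := hne0 z hz). contC.
    apply Cmult_neq_0; exact h.
  - intros z hz. specialize (hf z hz). assert (h := hne0 z hz). contC.
    apply Cmult_neq_0; [apply Cmult_neq_0; exact h|exact h].
  - intros z hz. assert (h := hne0 z hz). assert (h1 := hne z w hz ltac:(fold u; lra)).
    set (x := (z - w0)%C) in *.
    assert (ew : (z - w)%C = (x - u)%C) by (unfold x, u; ring).
    rewrite ew in h1 |- *.
    replace (f z / (x - u) - (f z / x + f z / (x * x) * u + f z / (x * x * x) * (u * u)))%C with
      (f z * (u * u * u) / (x * x * x * (x - u)))%C by (field; split; assumption).
    rewrite Cmod_div.
    2:{ apply Cmult_neq_0; [|exact h1]. apply Cmult_neq_0; [|exact h]. apply Cmult_neq_0; exact h. }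
    rewrite !Cmod_mult.
    assert (hx : d <= Cmod x) by (apply hfar, hz).
    assert (hxu : d / 2 <= Cmod (x - u)).
    { assert (h2 := Cmod_plus_inv x (- u)). rewrite Cmod_opp in h2.
      change (x + - u)%C with (x - u)%C in h2. lra. }
    replace (M / (d * d * d) / (d / 2) * Cmod u ^ 3) with
      (M * Cmod u ^ 3 * / (d * d * d * (d / 2))) by (field; lra).
    unfold Rdiv at 1.
    assert (hu := Cmod_ge_0 u).
    assert (hX : d * d * d <= Cmod x * Cmod x * Cmod x).
    { apply Rmult_le_compat; [nra|lra| |exact hx]. nra. }
    apply Rmult_le_compat.
    + apply Rmult_le_pos; [apply Cmod_ge_0|]. apply Rmult_le_pos; [|exact hu].
      apply Rmult_le_pos; exact hu.
    + left. apply Rinv_0_lt_compat. apply Rmult_lt_0_compat; lra.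
    + replace (Cmod u ^ 3) with (Cmod u * Cmod u * Cmod u) by ring.
      apply Rmult_le_compat_r; [|apply hM, hz].
      apply Rmult_le_pos; [|exact hu]. apply Rmult_le_pos; exact hu.
    + apply Rinv_le_contravar.
      * apply Rmult_lt_0_compat; lra.
      * apply Rmult_le_compat; lra.
Qed.

Section Cauchy.

Context (D : C -> Prop) (phi : C -> C).
Context (Dopen : open (T := C_UniformSpace) D) (Hphi : analytic_on D phi).
Context (Om : C -> Prop) (Gam : list jordan_curve).
Context (Om_open : open (T := C_UniformSpace) Om).
Context (Om_bounded : exists M : R, forall z, Om z -> Cmod z <= M).
Context (HGam : positive_boundary Om Gam).
Context (Om_D : forall z, closure_of Om z -> D z).

Lemma on_contour_boundary z : on_contour Gam z <-> boundary_of Om z.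
Proof.
  rewrite (pb_image _ _ HGam z) Exists_exists. reflexivity.
Qed.

Lemma on_contour_D z : on_contour Gam z -> D z.
Proof. intros h. apply Om_D. apply on_contour_boundary in h. apply h. Qed.

Lemma ball_outside_contour w d :
  (forall v, Cmod (v - w) < d -> ~ Om v) -> forall z, on_contour Gam z -> d <= Cmod (z - w).
Proof.
  intros h z hz. apply on_contour_boundary in hz. destruct hz as [hc _].
  apply Rnot_lt_le. intros hlt. apply hc. apply locally_Cmod.
  exists (d - Cmod (z - w)). split; [lra|]. intros v hv. apply h.
  assert (h1 := Cmod_minus_triangle v z w). lra.
Qed.

Lemma ball_inside_contour w d :
  (forall v, Cmod (v - w) < d -> Om v) -> forall z, on_contour Gam z -> d <= Cmod (z - w).
Proof.
  intros h z hz. apply on_contour_boundary in hz. destruct hz as [_ hc].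
  apply Rnot_lt_le. intros hlt. apply hc. apply locally_Cmod.
  exists (d - Cmod (z - w)). split; [lra|]. intros v hv hn. apply hn, h.
  assert (h1 := Cmod_minus_triangle v z w). lra.
Qed.

Lemma outside_ball w :
  ~ closure_of Om w -> exists d, 0 < d /\ forall v, Cmod (v - w) < d -> ~ Om v.
Proof. intros h. apply NNPP in h. apply locally_Cmod. exact h. Qed.

Lemma phi_continuous_on_contour z :
  on_contour Gam z -> continuous (T := C_UniformSpace) (U := C_UniformSpace) phi z.
Proof. intros hz. apply (analytic_continuous D phi Dopen Hphi). apply on_contour_D, hz. Qed.

Lemma two_pi_i_neq_0 : two_pi_i <> 0%C.
Proof.
  unfold two_pi_i. apply Cmult_neq_0.
  - intros e. apply RtoC_inj in e. assert (h := PI_RGT_0). lra.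
  - intros e. assert (h := Cmod_Ci). rewrite e Cmod_0 in h. lra.
Qed.

Lemma cint_winding w (c : C) :
  winding Gam w = c -> cint Gam (fun z => / (z - w))%C = (c * two_pi_i)%C.
Proof.
  intros h. rewrite -h. unfold winding.
  change (contour_int (V := C_CompleteNormedModule) Gam (fun z => / (z - w))%C)
    with (cint Gam (fun z => / (z - w))%C).
  field. apply two_pi_i_neq_0.
Qed.

(** The winding integral is the link between the two branches of [dixon]: outside it vanishes, so
    that the branches agree; inside it equals [two_pi_i], so that vanishing of [dixon] becomes the
    Cauchy formula. *)
Lemma cint_dq_off_contour w d :
  D w -> 0 < d -> (forall z, on_contour Gam z -> d <= Cmod (z - w)) ->
  cint Gam (fun z => dq phi z w) =
    (cint Gam (fun z => phi z / (z - w))%C - cint Gam (fun z => / (z - w))%C * phi w)%C.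
Proof.
  intros hw hd hfar.
  assert (hne : forall z, on_contour Gam z -> (z - w)%C <> 0%C).
  { intros z hz e. specialize (hfar z hz). rewrite e Cmod_0 in hfar. lra. }
  assert (hinv : forall z, on_contour Gam z ->
    continuous (T := C_UniformSpace) (U := C_UniformSpace) (fun z => / (z - w))%C z).
  { intros z hz. apply contC_inv; [apply hne, hz|]. contC. }
  rewrite -cint_mult_r; [|exact hinv]. rewrite -cint_minus.
  - apply (contour_int_ext (V := C_CompleteNormedModule)). intros z hz.
    rewrite dq_neq.
    + assert (e : ((phi z - phi w) / (z - w) = phi z / (z - w) - / (z - w) * phi w)%C)
        by (field; apply hne, hz). exact e.
    + intros e. apply (hne z hz). rewrite e. ring.
  - intros z hz. assert (h := phi_continuous_on_contour z hz). contC. apply hne, hz.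
  - intros z hz. assert (h := hinv z hz). contC.
Qed.

Definition dixon (w : C) : C :=
  match excluded_middle_informative (D w) with
  | left _ => cint Gam (fun z => dq phi z w)
  | right _ => cint Gam (fun z => phi z / (z - w))%C
  end.

Lemma dixon_D w : D w -> dixon w = cint Gam (fun z => dq phi z w).
Proof.
  intros h. unfold dixon. destruct (excluded_middle_informative (D w)); [reflexivity|contradiction].
Qed.

Lemma dixon_outside w d :
  0 < d -> (forall v, Cmod (v - w) < d -> ~ Om v) ->
  dixon w = cint Gam (fun z => phi z / (z - w))%C.
Proof.
  intros hd h. unfold dixon. destruct (excluded_middle_informative (D w)) as [hw|hw]; [|reflexivity].
  rewrite (cint_dq_off_contour w d hw hd (ball_outside_contour w d h)).
  assert (hc : ~ closure_of Om w).
  { intros hcl. apply hcl. apply locally_Cmod. exists d. split; [exact hd|exact h]. }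
  rewrite (cint_winding w 0%C (pb_outside _ _ HGam w hc)). ring.
Qed.

(** Here [w0] may lie on the contour, so no distance from it is available. The expansion of [dq z]
    in the second variable is used instead; its remainder is controlled by [psi], uniformly in
    [z]. *)
Lemma dixon_second_order_D w0 : D w0 -> exists b c, second_order_at dixon w0 b c.
Proof.
  intros hw0.
  destruct (analytic_expansion D phi w0 Dopen Hphi hw0) as [a1 [a2 [psi [r [L [hr [hL [hD [he hl]]]]]]]]].
  assert (hw00 : Cmod (w0 - w0) < r).
  { replace (w0 - w0)%C with (RtoC 0) by ring. rewrite Cmod_0. exact hr. }
  assert (hcpsi : forall z, D z -> continuous (T := C_UniformSpace) (U := C_UniformSpace) psi z).
  { intros z hz. destruct (excluded_middle_informative (z = w0)) as [e|e].
    - subst z. apply (Lipschitz_continuous_at _ _ r L); [exact hr|exact hL|]. intros z hz'.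
      apply hl; assumption.
    - assert (hcphi := analytic_continuous D phi Dopen Hphi z hz).
      apply (continuous_ext_loc _ (fun z => (phi z - phi w0 - a1 * (z - w0) - a2 * ((z - w0) * (z - w0)))
        / ((z - w0) * (z - w0) * (z - w0)))%C).
      + apply locally_Cmod. exists (Cmod (z - w0)).
        split; [apply Cmod_gt_0, Cminus_neq_0, e|]. intros v hv.
        rewrite (he v). eqC. field. apply Cminus_neq_0. intros ev. subst v.
        rewrite Cmod_minus_sym in hv. lra.
      + contC. assert (h := Cminus_neq_0 z w0 e).
        apply Cmult_neq_0; [apply Cmult_neq_0; exact h|exact h]. }
  destruct (contour_bounded Gam psi (fun z hz => hcpsi z (on_contour_D z hz))) as [M [hM0 hM]].
  destruct (cint_second_order Gam) as [Kg [hKg hb]].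
  set (N := M + Cmod (psi w0) + L * r).
  assert (hN : 0 <= N).
  { assert (h := Cmod_ge_0 (psi w0)). assert (h1 : 0 <= L * r) by (apply Rmult_le_pos; lra). unfold N. lra. }
  (* Contour points within [r] of [w0] use the Lipschitz constant [L]. For the others |z - w| is at
     least r/2, and the difference of the values of [psi] is at most [N]. *)
  set (K := L + N * (2 / r)).
  assert (hNr : 0 <= N * (2 / r)) by (apply Rmult_le_pos; [exact hN|apply Rdiv_le_0_compat; lra]).
  assert (hLK : L <= K) by (unfold K; lra).
  assert (hlip : forall z w, on_contour Gam z -> Cmod (w - w0) < r / 2 ->
    Cmod (psi z - psi w) <= K * Cmod (z - w)).
  { intros z w hz hw. assert (hzw := Cmod_ge_0 (z - w)).
    destruct (Rlt_le_dec (Cmod (z - w0)) r) as [h|h].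
    - apply Rle_trans with (L * Cmod (z - w)); [apply hl; lra|]. apply Rmult_le_compat_r; assumption.
    - assert (h1 : r / 2 <= Cmod (z - w)).
      { assert (h2 := Cmod_minus_triangle z w w0). lra. }
      assert (h3 : Cmod (psi w) <= Cmod (psi w0) + L * r).
      { assert (h4 := hl w w0 ltac:(lra) hw00).
        assert (h5 := Cmod_minus_triangle (psi w) (psi w0) 0).
        replace (psi w - 0)%C with (psi w) in h5 by ring.
        replace (psi w0 - 0)%C with (psi w0) in h5 by ring.
        assert (h6 : L * Cmod (w - w0) <= L * r) by (apply Rmult_le_compat_l; lra). lra. }
      apply Rle_trans with N.
      + apply Rle_trans with (1 := Cmod_sub_le _ _). specialize (hM z hz). unfold N. lra.
      + apply Rle_trans with (N * (2 / r) * Cmod (z - w)).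
        * rewrite -{1}(Rmult_1_r N) Rmult_assoc. apply Rmult_le_compat_l; [exact hN|].
          apply Rmult_le_reg_r with (r / 2); [lra|].
          replace (2 / r * Cmod (z - w) * (r / 2)) with (Cmod (z - w)) by (field; lra). lra.
        * apply Rmult_le_compat_r; [exact hzw|]. unfold K. lra. }
  assert (hA : forall z, (a1 + a2 * (z - w0) + psi z * ((z - w0) * (z - w0)))%C = dq phi z w0).
  { intros z. destruct (excluded_middle_informative (z = w0)) as [e|e].
    - subst z. rewrite dq_diag (proj1 (C_derive_expansion phi w0 a1 a2 psi r L hr hL he hl)). ring.
    - rewrite dq_neq; [|exact e]. rewrite (he z). field. apply Cminus_neq_0, e. }
  exists (cint Gam (fun z => a2 + psi z * (z - w0))%C), (cint Gam psi).
  exists (Kg * K), (r / 2). split; [lra|]. split; [apply Rmult_le_pos; lra|].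
  intros w hw.
  assert (hDw : D w) by (apply hD; lra).
  rewrite !dixon_D; [|exact hw0|exact hDw]. rewrite Rmult_assoc. apply hb.
  - intros z hz. apply (dq_continuous D phi Dopen Hphi); [apply on_contour_D, hz|exact hDw].
  - intros z hz. apply (dq_continuous D phi Dopen Hphi); [apply on_contour_D, hz|exact hw0].
  - intros z hz. assert (h := hcpsi z (on_contour_D z hz)). contC.
  - intros z hz. apply hcpsi, on_contour_D, hz.
  - intros z hz. rewrite -hA.
    apply (dq_newton D phi Dopen Hphi w0 a1 a2 psi r L K z w hD he hL hl); [lra|exact hLK|].
    apply hlip; assumption.
Qed.

Lemma dixon_second_order w0 : exists b c, second_order_at dixon w0 b c.
Proof.
  destruct (excluded_middle_informative (closure_of Om w0)) as [h|h].
  - apply dixon_second_order_D, Om_D, h.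
  - destruct (outside_ball w0 h) as [d [hd hball]].
    destruct (off_contour_second_order Gam phi w0 d phi_continuous_on_contour hd
      (ball_outside_contour w0 d hball)) as [K [d' [hd' [hK hb]]]].
    exists (cint Gam (fun z => phi z / ((z - w0) * (z - w0)))%C),
      (cint Gam (fun z => phi z / ((z - w0) * (z - w0) * (z - w0)))%C), K, (Rmin d' (d / 2)).
    split; [apply Rmin_pos; lra|]. split; [exact hK|]. intros w hw.
    assert (hw1 : Cmod (w - w0) < d') by (apply Rlt_le_trans with (1 := hw); apply Rmin_l).
    assert (hw2 : Cmod (w - w0) < d / 2) by (apply Rlt_le_trans with (1 := hw); apply Rmin_r).
    (* The ball of radius [d / 2] about [w] still misses [Om], so [dixon] is the Cauchy integral at
       [w] as well as at [w0]. *)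
    rewrite (dixon_outside w0 d hd hball) (dixon_outside w (d / 2)); [apply hb, hw1|lra|].
    intros v hv. apply hball. assert (h1 := Cmod_minus_triangle v w w0). lra.
Qed.

Lemma dixon_vanishes_at_infinity eps :
  0 < eps -> exists r, forall w, r <= Cmod w -> Cmod (dixon w) < eps.
Proof.
  intros heps. destruct Om_bounded as [B hB].
  destruct (contour_bounded Gam phi phi_continuous_on_contour) as [M [hM0 hM]].
  destruct (contour_int_bound (V := C_CompleteNormedModule) Gam) as [Kg [hKg hb]].
  assert (hKM : 0 <= Kg * M) by (apply Rmult_le_pos; assumption).
  (* At distance [R0] from the contour the integral is at most [Kg * M / R0]; the summand 1 makes
     this strictly less than [eps] and [R0] positive. *)
  set (R0 := (Kg * M + 1) / eps).
  assert (hR0 : 0 < R0) by (apply Rdiv_lt_0_compat; lra).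
  exists (B + R0). intros w hw.
  assert (hball : forall v, Cmod (v - w) < R0 -> ~ Om v).
  { intros v hv ho. apply hB in ho. assert (h := Cmod_minus_triangle w v 0).
    rewrite (Cmod_minus_sym w v) in h.
    replace (w - 0)%C with w in h by ring. replace (v - 0)%C with v in h by ring. lra. }
  rewrite (dixon_outside w R0 hR0 hball).
  assert (hfar := ball_outside_contour w R0 hball).
  assert (hne : forall z, on_contour Gam z -> (z - w)%C <> 0%C).
  { intros z hz e. specialize (hfar z hz). rewrite e Cmod_0 in hfar. lra. }
  apply Rle_lt_trans with (Kg * (M / R0)).
  - apply hb.
    + apply (cont_along_of_continuous Gam). intros z hz. assert (h := phi_continuous_on_contour z hz).
      contC. apply hne, hz.
    + intros z hz. change (Cmod (phi z / (z - w)) <= M / R0). rewrite Cmod_div; [|apply hne, hz].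
      apply Rmult_le_compat; [apply Cmod_ge_0| |apply hM, hz|].
      * left. apply Rinv_0_lt_compat. apply Cmod_gt_0, hne, hz.
      * apply Rinv_le_contravar; [exact hR0|apply hfar, hz].
  - replace (Kg * (M / R0)) with (eps * (Kg * M / (Kg * M + 1))) by (unfold R0; field; lra).
    rewrite -{2}(Rmult_1_r eps). apply Rmult_lt_compat_l; [exact heps|].
    apply Rmult_lt_reg_r with (Kg * M + 1); [lra|].
    unfold Rdiv. rewrite Rmult_assoc Rinv_l; lra.
Qed.

Lemma inside_ball w : Om w -> exists d, 0 < d /\ forall v, Cmod (v - w) < d -> Om v.
Proof. intros h. apply locally_Cmod, Om_open, h. Qed.

Lemma inside_D w : Om w -> D w.
Proof.
  intros h. apply Om_D. intros hn. apply locally_Cmod in hn. destruct hn as [d [hd hn]].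
  apply (hn w); [|exact h]. replace (w - w)%C with (RtoC 0) by ring. rewrite Cmod_0. exact hd.
Qed.

Theorem cauchy_formula w :
  Om w -> cint Gam (fun z => phi z / (z - w))%C = (two_pi_i * phi w)%C.
Proof.
  intros hw. destruct (inside_ball w hw) as [d [hd hball]].
  assert (h := liouville_second_order dixon dixon_second_order dixon_vanishes_at_infinity w).
  rewrite (dixon_D w (inside_D w hw)) in h.
  rewrite (cint_dq_off_contour w d (inside_D w hw) hd (ball_inside_contour w d hball)) in h.
  rewrite (cint_winding w 1%C (pb_inside _ _ HGam w hw)) in h.
  set (I := cint Gam _) in *.
  replace I with (I - 1 * two_pi_i * phi w + 1 * two_pi_i * phi w)%C by ring.
  rewrite h. ring.
Qed.

Lemma cauchy_formula_derivatives w :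
  Om w ->
  cint Gam (fun z => phi z / ((z - w) * (z - w)))%C = (two_pi_i * C_derive phi w)%C /\
  cint Gam (fun z => phi z / ((z - w) * (z - w) * (z - w)))%C
    = (two_pi_i * (C_derive (C_derive phi) w / 2))%C.
Proof.
  intros hw. destruct (inside_ball w hw) as [d [hd hball]].
  assert (hD := inside_D w hw).
  destruct (analytic_expansion D phi w Dopen Hphi hD) as [a1 [a2 [psi [r [L [hr [hL [hrD [he hl]]]]]]]]].
  rewrite (proj1 (C_derive_expansion phi w a1 a2 psi r L hr hL he hl)).
  rewrite (C_derive2_expansion D phi Dopen Hphi w a1 a2 psi r L hr hL hrD he hl).
  replace (2 * a2 / 2)%C with a2 by (field; intros e; apply RtoC_inj in e; lra).
  apply (second_order_unique (fun v => cint Gam (fun z => phi z / (z - v))%C)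
    (fun v => two_pi_i * phi v)%C w).
  - exists d. split; [exact hd|]. intros v hv. apply cauchy_formula, hball, hv.
  - apply (off_contour_second_order Gam phi w d); [exact phi_continuous_on_contour|exact hd|].
    apply ball_inside_contour, hball.
  - exists (Cmod two_pi_i * (Cmod (psi w) + L * r)), r. split; [exact hr|]. split.
    { apply Rmult_le_pos; [apply Cmod_ge_0|]. assert (h := Cmod_ge_0 (psi w)). nra. }
    intros v hv. assert (hww : Cmod (w - w) < r).
    { replace (w - w)%C with (RtoC 0) by ring. rewrite Cmod_0. exact hr. }
    rewrite (he v). set (x := (v - w)%C) in *.
    match goal with |- Cmod ?e <= _ =>
      replace e with (two_pi_i * (psi v * (x * x * x)))%C by ring end.
    rewrite (Cmod_mult two_pi_i) (Cmod_mult (psi v)) (Cmod_mult (x * x)) (Cmod_mult x x) (Rmult_assoc (Cmod two_pi_i)).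
    apply Rmult_le_compat_l; [apply Cmod_ge_0|].
    replace (Cmod x ^ 3) with (Cmod x * Cmod x * Cmod x) by ring.
    assert (hx := Cmod_ge_0 x).
    apply Rmult_le_compat_r; [apply Rmult_le_pos; [apply Rmult_le_pos|]; exact hx|].
    assert (h1 := hl v w hv hww). fold x in h1.
    assert (h2 := Cmod_triangle (psi v - psi w) (psi w)).
    replace (psi v - psi w + psi w)%C with (psi v) in h2 by ring.
    assert (h3 : L * Cmod x <= L * r) by (apply Rmult_le_compat_l; lra). lra.
Qed.

End Cauchy.

(** * Resolvents along the contour *)

Section UniformTruncation.

Context {Hs : CompleteNormedModule C_AbsRing}.
Local Notation H := (CompleteNormedModule.NormedModule C_AbsRing Hs).
Context {ip : H -> H -> C} (Hip : is_inner_product ip).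
Context (P : nat -> H -> H) (HP : orth_family ip P).
Context (Hid : forall x, is_series (fun i => P i x) x).

(** The truncations are contractions, so an index that is good at [t] is good in a neighbourhood of
    [t]: one third of [eps] for the truncation at [t] and one third for each passage between [s] and
    [t]. *)
Lemma trunc_uniform_segment (u : R -> H) (eps : R) :
  (forall t, continuous u t) -> 0 < eps ->
  exists N, forall n t, (N <= n)%nat -> 0 <= t <= 1 -> norm (minus (trunc P n (u t)) (u t)) <= eps.
Proof.
  intros hu heps.
  assert (h3 : 0 < eps / 3) by lra.
  assert (hch : forall t, exists p : posreal * nat,
    (forall s, Rabs (s - t) < fst p -> norm (minus (u s) (u t)) < eps / 3) /\
    (forall n, (snd p <= n)%nat -> norm (minus (trunc P n (u t)) (u t)) < eps / 3)).
  { intros t. destruct (continuous_R_to_norm u t (hu t) (eps / 3) h3) as [d [hd h1]].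
    destruct (tends_to_norm _ _ (trunc_lim P Hid (u t)) (eps / 3) h3) as [N hN].
    exists (mkposreal d hd, N). split; [exact h1|exact hN]. }
  destruct (choice _ hch) as [p hp].
  (* The gauge also encodes the index [snd (p t)], so that its positive lower bound provides
     an index that is valid for all [t]. *)
  assert (hdel : forall t, 0 < Rmin (fst (p t)) (/ (INR (snd (p t)) + 1))).
  { intros t. apply Rmin_pos; [apply cond_pos|]. apply Rinv_0_lt_compat.
    assert (h := pos_INR (snd (p t))). lra. }
  destruct (compactness_value_1d 0 1 (fun t => mkposreal _ (hdel t))) as [d hd].
  assert (hdp := cond_pos d).
  destruct (nfloor_ex (/ d)) as [N hN].
  { left. apply Rinv_0_lt_compat, hdp. }
  exists N. intros n s hn hs. apply NNPP. intros hneg.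
  apply (hd s hs). intros [t [ht [hst hdt]]]. simpl in hst, hdt. apply hneg. clear hneg.
  destruct (hp t) as [hp1 hp2].
  assert (hst1 : norm (minus (u s) (u t)) < eps / 3).
  { apply hp1. apply Rlt_le_trans with (1 := hst). apply Rmin_l. }
  assert (hnt : (snd (p t) <= n)%nat).
  { assert (h1 : pos d <= / (INR (snd (p t)) + 1)) by (apply Rle_trans with (1 := hdt); apply Rmin_r).
    assert (h2 := pos_INR (snd (p t))).
    apply Rinv_le_contravar in h1; [|exact hdp]. rewrite Rinv_inv in h1.
    assert (h4 : (snd (p t) < S N)%nat) by (apply INR_lt; rewrite S_INR; lra). lia. }
  specialize (hp2 n hnt).
  assert (e : minus (trunc P n (u s)) (u s) =
    plus (plus (trunc P n (minus (u s) (u t))) (minus (trunc P n (u t)) (u t))) (minus (u t) (u s))).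
  { rewrite (linear_minus _ _ _ (is_linear_trunc P HP n)).
    rewrite -(minus_trans (trunc P n (u t))) -minus_trans. reflexivity. }
  rewrite e.
  apply Rle_trans with (1 := norm_triangle (V := H) _ _).
  assert (h5 := norm_triangle (V := H) (trunc P n (minus (u s) (u t))) (minus (trunc P n (u t)) (u t))).
  assert (h6 := norm_trunc_le Hip P HP n (minus (u s) (u t))).
  rewrite (norm_minus_sym (u t)). lra.
Qed.

Lemma trunc_uniform_contour (Gam : list jordan_curve) (v : C -> H) (eps : R) :
  cont_along Gam v -> 0 < eps ->
  exists N, forall n z, (N <= n)%nat -> on_contour Gam z ->
    norm (minus (trunc P n (v z)) (v z)) <= eps.
Proof.
  intros hv heps. induction Gam as [|g Gam IH].
  - exists 0%nat. intros n z _ [g [[] _]].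
  - destruct IH as [N1 hN1]. { intros g' hg. apply hv. right. exact hg. }
    destruct (trunc_uniform_segment (fun t => v (jc_pos g t)) eps (hv g (or_introl eq_refl)) heps) as [N2 hN2].
    exists (Nat.max N1 N2). intros n z hn [g' [[e|hg] hz]].
    + subst g'. destruct hz as [t ht]. assert (hb := base_Int_part t).
      assert (h := hN2 n (t + IZR (- Int_part t)) ltac:(lia)).
      cbv beta in h. rewrite jc_pos_IZR ht opp_IZR in h. apply h. lra.
    + apply hN1; [lia|]. exists g'. split; assumption.
Qed.

End UniformTruncation.

Section Resolvent.

Context {Hs : CompleteNormedModule C_AbsRing}.
Local Notation H := (CompleteNormedModule.NormedModule C_AbsRing Hs).
Context {ip : H -> H -> C} (Hip : is_inner_product ip).
Context (T : H -> H) (HT : is_linear T) (lam : nat -> R) (P : nat -> H -> H).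
Context (Hexp : eigen_expansion ip T lam P).

Lemma expansion_orth_family : orth_family ip P.
Proof. split; [apply (ee_proj _ _ _ _ Hexp)|apply (ee_orth _ _ _ _ Hexp)]. Qed.

Let HP := expansion_orth_family.
Let Hid := ee_id _ _ _ _ Hexp.

Lemma T_proj i x : T (P i x) = scal (RtoC (lam i)) (P i x).
Proof.
  destruct (ee_line _ _ _ _ Hexp i) as [[e [_ [he hr]]]|h0].
  - destruct (proj1 (hr (P i x)) (ex_intro _ x eq_refl)) as [c hc].
    rewrite hc. transitivity (scal c (T e)); [exact (linear_scal T HT c e)|].
    rewrite he. transitivity (scal (c * RtoC (lam i))%C e); [exact (scal_assoc (V := H) c _ e)|].
    rewrite Cmult_comm. symmetry. exact (scal_assoc (V := H) (RtoC (lam i)) c e).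
  - rewrite h0. transitivity (zero : H); [exact (linear_zero T HT)|].
    symmetry. exact (scal_zero_r (V := H) _).
Qed.

Lemma proj_T i x : P i (T x) = scal (RtoC (lam i)) (P i x).
Proof.
  assert (hl := orth_family_linear P HP i).
  assert (h := is_series_linear _ _ _ hl (ee_op _ _ _ _ Hexp x)).
  apply (is_series_unique_norm (V := H) _ _ _ h).
  set (u := fun j => _) in h |- *.
  assert (e : scal (RtoC (lam i)) (P i x) = u i).
  { unfold u. rewrite -{1}(orth_family_idem P HP i x). symmetry. exact (linear_scal _ hl _ _). }
  rewrite e. apply (is_series_single (V := H)). intros j hj. unfold u.
  transitivity (scal (RtoC (lam j)) (P i (P j x))); [exact (linear_scal _ hl _ _)|].
  assert (h0 : P i (P j x) = zero) by (apply (ee_orth _ _ _ _ Hexp); congruence).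
  rewrite h0. exact (scal_zero_r (V := H) _).
Qed.

(** For a padding projection [lam i] is unconstrained and could even lie on the contour. Later
    arguments split on this alternative. *)
Lemma spectrum_or_zero i : spectrum T (RtoC (lam i)) \/ forall x, P i x = zero.
Proof.
  destruct (ee_line _ _ _ _ Hexp i) as [[e [hne [he _]]]|h0]; [left|right; exact h0].
  intros [S [hS [h1 _]]]. apply hne. rewrite -(h1 e) he.
  rewrite (minus_eq_zero (G := H)). exact (linear_zero S hS).
Qed.

Context (d : R) (hd : 0 < d).

(** The distance is asked only from those [lam i] that are spectral, since the value attached to a
    padding projection is arbitrary. *)
Definition away (z : C) : Prop :=
  ~ spectrum T z /\ forall i, spectrum T (RtoC (lam i)) -> d <= Cmod (z - RtoC (lam i)).

Lemma resolvent_spec z : away z -> is_resolvent T z (resolvent T z).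
Proof.
  intros [hz _]. apply NNPP in hz. unfold resolvent.
  exact (epsilon_spec _ _ hz).
Qed.

Lemma resolvent_linear z : away z -> is_linear (resolvent T z).
Proof. intros h. apply (resolvent_spec z h). Qed.

Lemma away_neq z i : away z -> spectrum T (RtoC (lam i)) -> (z - RtoC (lam i))%C <> 0%C.
Proof. intros [_ h] hs e. specialize (h i hs). rewrite e Cmod_0 in h. lra. Qed.

Lemma scal_inv_cancel (c : C) (x : H) : c <> 0%C -> scal (/ c)%C (scal c x) = x.
Proof.
  intros hc. transitivity (scal (/ c * c)%C x); [exact (scal_assoc (V := H) (/ c)%C c x)|].
  replace (/ c * c)%C with (RtoC 1) by (field; exact hc). exact (scal_one (V := H) x).
Qed.

Lemma resolvent_proj z i x :
  away z -> resolvent T z (P i x) = scal (/ (z - RtoC (lam i)))%C (P i x).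
Proof.
  intros hz. destruct (resolvent_spec z hz) as [hl [h1 _]].
  destruct (spectrum_or_zero i) as [hs|h0].
  - specialize (h1 (P i x)). rewrite T_proj in h1.
    assert (e : minus (scal z (P i x)) (scal (RtoC (lam i)) (P i x)) = scal (z - RtoC (lam i))%C (P i x)).
    { symmetry. exact (scal_minus_distr_r (V := H) z (RtoC (lam i)) (P i x)). }
    rewrite e in h1.
    assert (h2 : scal (z - RtoC (lam i))%C (resolvent T z (P i x)) = P i x).
    { rewrite -{2}h1. symmetry. exact (linear_scal _ hl _ _). }
    rewrite -{2}h2. symmetry. apply scal_inv_cancel, away_neq; assumption.
  - rewrite h0. transitivity (zero : H); [exact (linear_zero _ hl)|].
    symmetry. exact (scal_zero_r (V := H) _).
Qed.

Lemma proj_resolvent z i x :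
  away z -> P i (resolvent T z x) = scal (/ (z - RtoC (lam i)))%C (P i x).
Proof.
  intros hz. destruct (resolvent_spec z hz) as [hl [_ h1]].
  assert (hp := orth_family_linear P HP i).
  destruct (spectrum_or_zero i) as [hs|h0].
  - assert (e : P i x = scal (z - RtoC (lam i))%C (P i (resolvent T z x))).
    { rewrite -{1}(h1 x). transitivity (minus (scal z (P i (resolvent T z x))) (P i (T (resolvent T z x)))).
      - transitivity (minus (P i (scal z (resolvent T z x))) (P i (T (resolvent T z x)))).
        + exact (linear_minus _ _ _ hp).
        + apply (f_equal (fun y : H => minus y (P i (T (resolvent T z x))))). exact (linear_scal _ hp _ _).
      - rewrite proj_T. symmetry. exact (scal_minus_distr_r (V := H) z (RtoC (lam i)) _). }
    rewrite e. symmetry. apply scal_inv_cancel, away_neq; assumption.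
  - rewrite !h0. symmetry. exact (scal_zero_r (V := H) _).
Qed.

(** The resolvent is diagonal with respect to [P], with entries of modulus at most [/ d] on the
    non-zero projections. *)
Lemma norm_resolvent_le z x : away z -> norm (resolvent T z x) <= / d * norm x.
Proof.
  intros hz.
  assert (hd' : 0 <= / d) by (left; apply Rinv_0_lt_compat, hd).
  destruct (orth_multiplier Hip P HP (fun i => P i (resolvent T z x)) (/ d) x hd') as [l [h1 h2]].
  - intros k. apply (orth_family_idem P HP).
  - intros k. destruct (spectrum_or_zero k) as [hs|h0].
    + rewrite proj_resolvent; [|exact hz].
      apply Rle_trans with (1 := norm_scal (V := H) _ _). apply Rmult_le_compat_r; [apply norm_ge_0|].
      change (Cmod (/ (z - RtoC (lam k))) <= / d).
      rewrite Cmod_inv; [|apply away_neq; assumption].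
      apply Rinv_le_contravar; [exact hd|]. apply hz, hs.
    + rewrite !h0 norm_zero. lra.
  - rewrite (is_series_unique_norm (V := H) _ _ _ (Hid (resolvent T z x)) h1). exact h2.
Qed.

(** The resolvent identity R(w) - R(z) = (z - w) R(z) R(w), with the bound [/ d] for each factor. *)
Lemma resolvent_lipschitz z w x :
  away z -> away w ->
  norm (minus (resolvent T z x) (resolvent T w x)) <= Cmod (z - w) * (/ d * (/ d * norm x)).
Proof.
  intros hz hw.
  destruct (resolvent_spec z hz) as [hl [hz1 hz2]].
  destruct (resolvent_spec w hw) as [hlw [hw1 hw2]].
  set (y := resolvent T w x).
  assert (e : y = resolvent T z (plus (scal (z - w)%C y) x)).
  { transitivity (resolvent T z (minus (scal z y) (T y))); [symmetry; apply hz1|]. f_equal.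
    rewrite -{1}(hw2 x). fold y.
    transitivity (plus (minus (scal z y) (scal w y)) (minus (scal w y) (T y))).
    - exact (minus_trans (G := H) (scal w y) _ _).
    - apply (f_equal (fun u : H => plus u (minus (scal w y) (T y)))).
      symmetry. exact (scal_minus_distr_r (V := H) z w y). }
  assert (e2 : forall a b : H, minus (plus a b) b = a).
  { intros a b. rewrite /minus -plus_assoc plus_opp_r plus_zero_r. reflexivity. }
  assert (e3 : minus y (resolvent T z x) = scal (z - w)%C (resolvent T z y)).
  { transitivity (minus (resolvent T z (plus (scal (z - w)%C y) x)) (resolvent T z x)).
    - exact (f_equal (fun u : H => minus u (resolvent T z x)) e).
    - rewrite (linear_plus _ hl) e2. exact (linear_scal _ hl _ _). }
  rewrite norm_minus_sym.
  rewrite e3. apply Rle_trans with (1 := norm_scal (V := H) _ _).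
  apply Rmult_le_compat_l; [apply Cmod_ge_0|].
  apply Rle_trans with (1 := norm_resolvent_le z y hz).
  apply Rmult_le_compat_l; [left; apply Rinv_0_lt_compat, hd|].
  apply norm_resolvent_le, hw.
Qed.

(** * Operator-valued contour integrals *)

Context (Gam : list jordan_curve) (Haway : forall z, on_contour Gam z -> away z).

Lemma cont_along_resolvent (v : C -> H) :
  cont_along Gam v -> cont_along Gam (fun z => resolvent T z (v z)).
Proof.
  intros hv g hg t. apply continuous_R_of_norm. intros eps heps.
  assert (hon : forall s, away (jc_pos g s)).
  { intros s. apply Haway. exists g. split; [exact hg|]. exists s. reflexivity. }
  assert (hdi : 0 < / d) by (apply Rinv_0_lt_compat, hd).
  assert (h1 : 0 < eps / 2 * d) by (apply Rmult_lt_0_compat; lra).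
  destruct (continuous_R_to_norm _ t (hv g hg t) _ h1) as [d1 [hd1 hd1']].
  set (B := / d * (/ d * norm (v (jc_pos g t))) + 1).
  assert (hB : 0 < B).
  { assert (h : 0 <= / d * (/ d * norm (v (jc_pos g t)))).
    { apply Rmult_le_pos; [lra|]. apply Rmult_le_pos; [lra|apply norm_ge_0]. }
    unfold B. lra. }
  assert (h2 : 0 < eps / 2 / B) by (apply Rdiv_lt_0_compat; lra).
  destruct (continuous_R_to_norm (V := C_NormedModule) _ t (jc_pos_continuous g t) _ h2) as [d2 [hd2 hd2']].
  exists (Rmin d1 d2). split; [apply Rmin_pos; assumption|]. intros s hs.
  assert (hs1 : Rabs (s - t) < d1) by (apply Rlt_le_trans with (1 := hs); apply Rmin_l).
  assert (hs2 : Rabs (s - t) < d2) by (apply Rlt_le_trans with (1 := hs); apply Rmin_r).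
  specialize (hd1' s hs1). specialize (hd2' s hs2).
  (* The change of the vector is absorbed by the uniform bound of the resolvents, the change of the
     resolvent by its Lipschitz estimate on a fixed vector. *)
  rewrite (minus_trans (resolvent T (jc_pos g s) (v (jc_pos g t)))).
  apply Rle_lt_trans with (1 := norm_triangle (V := H) _ _).
  rewrite -(linear_minus _ _ _ (resolvent_linear _ (hon s))).
  assert (h3 := norm_resolvent_le (jc_pos g s) (minus (v (jc_pos g s)) (v (jc_pos g t))) (hon s)).
  assert (h4 := resolvent_lipschitz (jc_pos g s) (jc_pos g t) (v (jc_pos g t)) (hon s) (hon t)).
  assert (h5 : / d * norm (minus (v (jc_pos g s)) (v (jc_pos g t))) < eps / 2).
  { apply Rmult_lt_reg_l with d; [exact hd|]. rewrite -Rmult_assoc Rinv_r; [|lra]. lra. }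
  assert (h6 : Cmod (jc_pos g s - jc_pos g t) * (/ d * (/ d * norm (v (jc_pos g t)))) <= eps / 2).
  { apply Rle_trans with (eps / 2 / B * B).
    - apply Rmult_le_compat; [apply Cmod_ge_0| |left; exact hd2'|unfold B; lra].
      apply Rmult_le_pos; [lra|]. apply Rmult_le_pos; [lra|apply norm_ge_0].
    - right. field. lra. }
  lra.
Qed.

Lemma cont_along_linear (l : H -> H) (v : C -> H) :
  is_linear l -> cont_along Gam v -> cont_along Gam (fun z => l (v z)).
Proof.
  intros hl hv g hg t.
  exact (continuous_comp (fun s => v (jc_pos g s)) l t (hv g hg t) (linear_cont l _ hl)).
Qed.

Lemma cont_along_const (x : H) : cont_along Gam (fun _ => x).
Proof. intros g hg t. apply continuous_const. Qed.

Context (phi : C -> C).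
Context (Hphi : forall z, on_contour Gam z -> continuous (T := C_UniformSpace) (U := C_UniformSpace) phi z).

Lemma cont_along_scal (f : C -> C) (v : C -> H) :
  (forall z, on_contour Gam z -> continuous (T := C_UniformSpace) (U := C_UniformSpace) f z) ->
  cont_along Gam v -> cont_along Gam (fun z => scal (f z) (v z)).
Proof.
  intros hf hv g hg t. apply (continuous_R_scal (V := H) (fun s => f (jc_pos g s))).
  - exact (cont_along_of_continuous Gam f hf g hg t).
  - exact (hv g hg t).
Qed.

(** The common form of both derivatives: [deriv1] and [deriv2] unfold to [contour_op] of [res1 T G]
    and [res2 T G G]. *)
Definition contour_op (A : C -> H -> H) (x : H) : H :=
  scal (/ two_pi_i)%C (contour_int (V := Hs) Gam (fun z => scal (phi z) (A z x))).

Lemma contour_op_bound :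
  exists K, 0 <= K /\ forall (A : C -> H -> H) (x : H) (M : R),
    cont_along Gam (fun z => A z x) ->
    (forall z, on_contour Gam z -> norm (A z x) <= M) -> norm (contour_op A x) <= K * M.
Proof.
  destruct (contour_int_bound (V := Hs) Gam) as [Kg [hKg hb]].
  destruct (contour_bounded Gam phi Hphi) as [F [hF0 hF]].
  exists (Cmod (/ two_pi_i) * (Kg * F)). split.
  { apply Rmult_le_pos; [apply Cmod_ge_0|]. apply Rmult_le_pos; assumption. }
  intros A x M hA hM. apply Rle_trans with (1 := norm_scal (V := H) _ _).
  rewrite !Rmult_assoc. apply Rmult_le_compat_l; [apply Cmod_ge_0|].
  apply hb.
  - apply cont_along_scal; assumption.
  - intros z hz. apply Rle_trans with (1 := norm_scal (V := H) _ _).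
    apply Rmult_le_compat; [apply Cmod_ge_0|apply norm_ge_0|apply hF, hz|apply hM, hz].
Qed.

(** Families and vectors vary together, so that one statement yields additivity both in the family
    and in the vector. *)
Lemma contour_op_plus (A B C0 : C -> H -> H) (x y w : H) :
  cont_along Gam (fun z => A z x) -> cont_along Gam (fun z => B z y) ->
  (forall z, on_contour Gam z -> C0 z w = plus (A z x) (B z y)) ->
  contour_op C0 w = plus (contour_op A x) (contour_op B y).
Proof.
  intros hA hB hC. unfold contour_op.
  transitivity (scal (/ two_pi_i)%C (plus (contour_int (V := Hs) Gam (fun z => scal (phi z) (A z x)))
    (contour_int (V := Hs) Gam (fun z => scal (phi z) (B z y))))).
  - f_equal. rewrite -(contour_int_plus (V := Hs));
      [|apply cont_along_scal; assumption|apply cont_along_scal; assumption].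
    apply contour_int_ext. intros z hz. rewrite hC; [|exact hz]. exact (scal_distr_l (V := H) _ _ _).
  - exact (scal_distr_l (V := H) _ _ _).
Qed.

Lemma contour_op_linear (A : C -> H -> H) (l : H -> H) (x : H) :
  is_linear l -> cont_along Gam (fun z => A z x) ->
  l (contour_op A x) = contour_op (fun z y => l (A z y)) x.
Proof.
  intros hl hA. unfold contour_op.
  eapply eq_trans; [exact (linear_scal l hl _ _)|]. f_equal.
  eapply eq_trans; [exact (contour_int_linear (V := Hs) (W := Hs) Gam l _ hl (cont_along_scal _ _ Hphi hA))|].
  apply contour_int_ext. intros z hz. exact (linear_scal l hl _ _).
Qed.

Lemma contour_op_ext (A B : C -> H -> H) (x y : H) :
  (forall z, on_contour Gam z -> A z x = B z y) -> contour_op A x = contour_op B y.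
Proof.
  intros h. unfold contour_op. f_equal. apply contour_int_ext. intros z hz. rewrite h; [|exact hz].
  reflexivity.
Qed.

Lemma contour_op_zero (A : C -> H -> H) (x : H) :
  (forall z, on_contour Gam z -> A z x = zero) -> contour_op A x = zero.
Proof.
  intros h. transitivity (contour_op (fun _ y => y) zero).
  - apply contour_op_ext. exact h.
  - symmetry. exact (contour_op_linear (fun _ y => y) (fun _ => zero) x is_linear_zero (cont_along_const x)).
Qed.

Lemma contour_op_scalar (f : C -> C) (v : H) :
  (forall z, on_contour Gam z -> continuous (T := C_UniformSpace) (U := C_UniformSpace) f z) ->
  contour_op (fun z x => scal (f z) x) v = scal (/ two_pi_i * cint Gam (fun z => phi z * f z))%C v.
Proof.
  intros hf. unfold contour_op.
  assert (e : contour_int (V := Hs) Gam (fun z => scal (phi z) (scal (f z) v)) =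
    scal (cint Gam (fun z => phi z * f z)%C) v).
  { symmetry.
    eapply eq_trans.
    - apply (contour_int_linear (V := C_CompleteNormedModule) (W := Hs) Gam (fun c : C => scal c v)).
      + exact (is_linear_scal_vec (V := H) v).
      + apply (cont_along_of_continuous Gam). intros z hz. apply contC_mult; [apply Hphi, hz|apply hf, hz].
    - apply contour_int_ext. intros z hz. symmetry. exact (scal_assoc (V := H) (phi z) (f z) v). }
  rewrite e. exact (scal_assoc (V := H) _ _ v).
Qed.

Lemma contour_op_bounded_by :
  exists K, 0 <= K /\ forall (A : C -> H -> H) (c : R),
    0 <= c -> (forall x, cont_along Gam (fun z => A z x)) ->
    (forall z, on_contour Gam z -> bounded_by c (A z)) -> bounded_by (K * c) (contour_op A).
Proof.
  destruct contour_op_bound as [K [hK hb]]. exists K. split; [exact hK|].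
  intros A c hc hA hbA.
  assert (hn : forall x, norm (contour_op A x) <= K * c * norm x).
  { intros x. rewrite Rmult_assoc. apply hb; [apply hA|]. intros z hz. apply (hbA z hz). }
  split; [|split; [apply Rmult_le_pos; assumption|exact hn]].
  apply is_linear_of_bound with (K * c).
  - intros x y. apply contour_op_plus; [apply hA|apply hA|]. intros z hz.
    apply (linear_plus _ (proj1 (hbA z hz))).
  - intros k x. symmetry.
    eapply eq_trans; [exact (contour_op_linear A (fun y => scal k y) x
      (is_linear_scal_const k (fun y : H => y) is_linear_id) (hA x))|].
    apply contour_op_ext. intros z hz. symmetry. exact (linear_scal _ (proj1 (hbA z hz)) k x).
  - exact hn.
Qed.

Lemma bounded_by_comp (c1 c2 : R) (A B : H -> H) :
  bounded_by c1 A -> bounded_by c2 B -> bounded_by (c1 * c2) (fun x => A (B x)).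
Proof.
  intros [hA [h1 hA']] [hB [h2 hB']]. split; [exact (is_linear_comp B A hB hA)|].
  split; [apply Rmult_le_pos; assumption|]. intros x.
  apply Rle_trans with (1 := hA' _). rewrite Rmult_assoc. apply Rmult_le_compat_l; [exact h1|apply hB'].
Qed.

Lemma bounded_by_resolvent z : on_contour Gam z -> bounded_by (/ d) (resolvent T z).
Proof.
  intros hz. assert (h := Haway z hz). split; [apply resolvent_linear, h|].
  split; [left; apply Rinv_0_lt_compat, hd|]. intros x. apply norm_resolvent_le, h.
Qed.

Lemma bounded_by_trunc n : bounded_by 1 (trunc P n).
Proof.
  split; [exact (is_linear_trunc P HP n)|]. split; [lra|]. intros x. rewrite Rmult_1_l.
  apply (norm_trunc_le Hip P HP).
Qed.

Definition res1 (G : H -> H) (z : C) (x : H) : H := resolvent T z (G (resolvent T z x)).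

(** The two slots are kept apart because truncations and pinchings are inserted into one of them at
    a time. *)
Definition res2 (G1 G2 : H -> H) (z : C) (x : H) : H :=
  resolvent T z (G1 (resolvent T z (G2 (resolvent T z x)))).

Lemma cont_along_res1 G x : is_linear G -> cont_along Gam (fun z => res1 G z x).
Proof.
  intros hG. apply cont_along_resolvent. apply cont_along_linear; [exact hG|].
  apply cont_along_resolvent, cont_along_const.
Qed.

Lemma cont_along_res2 G1 G2 x :
  is_linear G1 -> is_linear G2 -> cont_along Gam (fun z => res2 G1 G2 z x).
Proof.
  intros h1 h2. apply cont_along_resolvent. apply cont_along_linear; [exact h1|].
  apply (cont_along_res1 G2 x h2).
Qed.

Lemma contour_res1_bounded :
  exists K, 0 <= K /\ forall G c, bounded_by c G -> bounded_by (K * c) (contour_op (res1 G)).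
Proof.
  destruct contour_op_bounded_by as [K [hK hb]].
  assert (hdi : 0 < / d) by (apply Rinv_0_lt_compat, hd).
  exists (K * (/ d * / d)). split; [apply Rmult_le_pos; [exact hK|]; nra|].
  intros G c hG. replace (K * (/ d * / d) * c) with (K * (/ d * (c * / d))) by ring.
  assert (hc := proj1 (proj2 hG)).
  apply hb.
  - apply Rmult_le_pos; [lra|]. apply Rmult_le_pos; lra.
  - intros x. apply cont_along_res1, hG.
  - intros z hz. assert (h := bounded_by_resolvent z hz).
    apply (bounded_by_comp _ _ _ _ h). apply (bounded_by_comp _ _ _ _ hG h).
Qed.

Lemma contour_res2_bounded :
  exists K, 0 <= K /\ forall G1 G2 c1 c2, bounded_by c1 G1 -> bounded_by c2 G2 ->
    bounded_by (K * (c1 * c2)) (contour_op (res2 G1 G2)).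
Proof.
  destruct contour_op_bounded_by as [K [hK hb]].
  assert (hdi : 0 < / d) by (apply Rinv_0_lt_compat, hd).
  assert (hdi2 : 0 < / d * / d) by (apply Rmult_lt_0_compat; exact hdi).
  exists (K * (/ d * / d * / d)). split; [apply Rmult_le_pos; [exact hK|]; nra|].
  intros G1 G2 c1 c2 hG1 hG2.
  replace (K * (/ d * / d * / d) * (c1 * c2)) with (K * (/ d * (c1 * (/ d * (c2 * / d))))) by ring.
  assert (hc1 := proj1 (proj2 hG1)). assert (hc2 := proj1 (proj2 hG2)).
  apply hb.
  - repeat (apply Rmult_le_pos; [lra|]). lra.
  - intros x. apply cont_along_res2; [apply hG1|apply hG2].
  - intros z hz. assert (h := bounded_by_resolvent z hz).
    apply (bounded_by_comp _ _ _ _ h). apply (bounded_by_comp _ _ _ _ hG1).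
    apply (bounded_by_comp _ _ _ _ h). apply (bounded_by_comp _ _ _ _ hG2 h).
Qed.

(** The truncation acts on the vectors [res1 G2 z x], which depend continuously on the parameter of
    the contour; its convergence is therefore uniform there and survives integration. *)
Lemma contour_res2_trunc_lim G1 G2 c1 x :
  bounded_by c1 G1 -> is_linear G2 ->
  tends (fun n => contour_op (res2 (fun y => G1 (trunc P n y)) G2) x) (contour_op (res2 G1 G2) x).
Proof.
  intros hG1 hG2. assert (hl1 := proj1 hG1). assert (hc1 := proj1 (proj2 hG1)).
  destruct contour_op_bound as [K [hK hb]].
  assert (hdi : 0 < / d) by (apply Rinv_0_lt_compat, hd).
  set (B := K * (/ d * c1) + 1).
  assert (hB0 : 0 <= K * (/ d * c1)) by (apply Rmult_le_pos; [exact hK|]; apply Rmult_le_pos; lra).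
  assert (hB : 0 < B) by (unfold B; lra).
  apply tends_of_norm. intros eps heps.
  assert (he : 0 < eps / B) by (apply Rdiv_lt_0_compat; lra).
  destruct (trunc_uniform_contour Hip P HP Hid Gam (fun z => res1 G2 z x) (eps / B)
    (cont_along_res1 G2 x hG2) he) as [N hN].
  exists N. intros n hn.
  assert (hlt := is_linear_trunc P HP n).
  set (A := fun z (y : H) => resolvent T z (G1 (minus (trunc P n (res1 G2 z y)) (res1 G2 z y)))).
  assert (hcA : cont_along Gam (fun z => A z x)).
  { apply cont_along_resolvent. apply cont_along_linear; [exact hl1|].
    apply (cont_along_linear (fun y => minus (trunc P n y) y)).
    - apply is_linear_minus; [exact hlt|apply is_linear_id].
    - apply cont_along_res1, hG2. }
  assert (e : contour_op (res2 (fun y => G1 (trunc P n y)) G2) x =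
    plus (contour_op (res2 G1 G2) x) (contour_op A x)).
  { apply contour_op_plus; [apply cont_along_res2; assumption|exact hcA|].
    intros z hz. unfold A, res2.
    rewrite -(linear_plus _ (resolvent_linear z (Haway z hz))) -(linear_plus _ hl1).
    unfold res1. rewrite plus_minus_cancel. reflexivity. }
  rewrite e.
  assert (e2 : forall a b : H, minus (plus a b) a = b).
  { intros a b. rewrite /minus (plus_comm a) -plus_assoc plus_opp_r plus_zero_r. reflexivity. }
  rewrite e2. apply Rle_lt_trans with (K * (/ d * (c1 * (eps / B)))).
  - apply hb; [exact hcA|]. intros z hz. unfold A.
    apply Rle_trans with (1 := norm_resolvent_le z _ (Haway z hz)).
    apply Rmult_le_compat_l; [lra|]. apply Rle_trans with (1 := proj2 (proj2 hG1) _).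
    apply Rmult_le_compat_l; [exact hc1|]. apply hN; assumption.
  - replace (K * (/ d * (c1 * (eps / B)))) with ((B - 1) * (eps / B)) by (unfold B; ring).
    replace eps with (B * (eps / B)) at 2 by (field; lra).
    apply Rmult_lt_compat_r; lra.
Qed.

End Resolvent.

(** * Divided differences as contour integrals *)

Section Coefficients.

Context (D : C -> Prop) (phi : C -> C).
Context (Dopen : open (T := C_UniformSpace) D) (Hphi : analytic_on D phi).
Context (Om : C -> Prop) (Gam : list jordan_curve).
Context (Om_open : open (T := C_UniformSpace) Om).
Context (Om_bounded : exists M : R, forall z, Om z -> Cmod z <= M).
Context (HGam : positive_boundary Om Gam).
Context (Om_D : forall z, closure_of Om z -> D z).

Lemma contour_sub_neq_0 z a : on_contour Gam z -> Om a -> (z - a)%C <> 0%C.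
Proof.
  intros hz ha e. destruct (inside_ball Om Om_open a ha) as [d [hd hb]].
  assert (h := ball_inside_contour Om Gam HGam a d hb z hz). rewrite e Cmod_0 in h. lra.
Qed.

Definition kern1 (a b : C) : C :=
  (/ two_pi_i * cint Gam (fun z => phi z * (/ (z - a) * / (z - b))))%C.

(** The nesting of the product is the one in which the three resolvents release their scalars. *)
Definition kern2 (a b c : C) : C :=
  (/ two_pi_i * cint Gam (fun z => phi z * (/ (z - a) * (/ (z - b) * / (z - c)))))%C.

(** Partial fractions under the integral sign; shorter decompositions take coefficient 0 in the
    remaining places. *)
Lemma cint_comb (F1 F2 F3 F : C -> C) (c1 c2 c3 : C) :
  (forall z, on_contour Gam z -> continuous (T := C_UniformSpace) (U := C_UniformSpace) F1 z) ->
  (forall z, on_contour Gam z -> continuous (T := C_UniformSpace) (U := C_UniformSpace) F2 z) ->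
  (forall z, on_contour Gam z -> continuous (T := C_UniformSpace) (U := C_UniformSpace) F3 z) ->
  (forall z, on_contour Gam z -> F z = (F1 z * c1 + F2 z * c2 + F3 z * c3)%C) ->
  cint Gam F = (cint Gam F1 * c1 + cint Gam F2 * c2 + cint Gam F3 * c3)%C.
Proof.
  intros h1 h2 h3 h.
  assert (g1 : forall z, on_contour Gam z -> continuous (T := C_UniformSpace) (U := C_UniformSpace) (fun z => F1 z * c1)%C z).
  { intros z hz. specialize (h1 z hz). contC. }
  assert (g2 : forall z, on_contour Gam z -> continuous (T := C_UniformSpace) (U := C_UniformSpace) (fun z => F2 z * c2)%C z).
  { intros z hz. specialize (h2 z hz). contC. }
  assert (g3 : forall z, on_contour Gam z -> continuous (T := C_UniformSpace) (U := C_UniformSpace) (fun z => F3 z * c3)%C z).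
  { intros z hz. specialize (h3 z hz). contC. }
  assert (g12 : forall z, on_contour Gam z -> continuous (T := C_UniformSpace) (U := C_UniformSpace) (fun z => F1 z * c1 + F2 z * c2)%C z).
  { intros z hz. specialize (g1 z hz). specialize (g2 z hz). contC. }
  transitivity (cint Gam (fun z => F1 z * c1 + F2 z * c2 + F3 z * c3)%C).
  - apply (contour_int_ext (V := C_CompleteNormedModule)). exact h.
  - rewrite cint_plus; [|exact g12|exact g3]. rewrite cint_plus; [|exact g1|exact g2].
    rewrite !cint_mult_r; [reflexivity|assumption ..].
Qed.

Lemma continuous_over_pole a : Om a ->
  forall z, on_contour Gam z ->
    continuous (T := C_UniformSpace) (U := C_UniformSpace) (fun z => phi z / (z - a))%C z.
Proof.
  intros ha z hz.
  assert (h := phi_continuous_on_contour D phi Dopen Hphi Om Gam HGam Om_D z hz).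
  assert (h1 := contour_sub_neq_0 z a hz ha). contC. exact h1.
Qed.

Lemma continuous_over_pole2 a : Om a ->
  forall z, on_contour Gam z ->
    continuous (T := C_UniformSpace) (U := C_UniformSpace) (fun z => phi z / ((z - a) * (z - a)))%C z.
Proof.
  intros ha z hz.
  assert (h := phi_continuous_on_contour D phi Dopen Hphi Om Gam HGam Om_D z hz).
  assert (h1 := contour_sub_neq_0 z a hz ha). contC. apply Cmult_neq_0; exact h1.
Qed.

Lemma cint_pole a : Om a -> cint Gam (fun z => phi z / (z - a))%C = (two_pi_i * phi a)%C.
Proof. apply (cauchy_formula D phi Dopen Hphi Om Gam Om_open Om_bounded HGam Om_D). Qed.

Lemma cint_pole2 a :
  Om a -> cint Gam (fun z => phi z / ((z - a) * (z - a)))%C = (two_pi_i * C_derive phi a)%C.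
Proof. apply (cauchy_formula_derivatives D phi Dopen Hphi Om Gam Om_open Om_bounded HGam Om_D). Qed.

Lemma cint_pole3 a :
  Om a -> cint Gam (fun z => phi z / ((z - a) * (z - a) * (z - a)))%C
    = (two_pi_i * (C_derive (C_derive phi) a / 2))%C.
Proof. apply (cauchy_formula_derivatives D phi Dopen Hphi Om Gam Om_open Om_bounded HGam Om_D). Qed.

Ltac nonzero :=
  repeat match goal with |- _ /\ _ => split end;
  first [assumption | apply contour_sub_neq_0; assumption | apply two_pi_i_neq_0].

Lemma kern1_diag a : Om a -> kern1 a a = C_derive phi a.
Proof.
  intros ha. unfold kern1.
  rewrite (cint_comb (fun z => phi z / ((z - a) * (z - a)))%C (fun z => phi z / ((z - a) * (z - a)))%C
    (fun z => phi z / ((z - a) * (z - a)))%C _ 1 0 0); try (apply continuous_over_pole2; exact ha).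
  - rewrite cint_pole2; [|exact ha]. field. apply two_pi_i_neq_0.
  - intros z hz. field. apply contour_sub_neq_0; assumption.
Qed.

Lemma kern1_neq a b : Om a -> Om b -> a <> b -> kern1 a b = ((phi b - phi a) / (b - a))%C.
Proof.
  intros ha hb hab. unfold kern1.
  assert (h1 := Cminus_neq_0 a b hab). assert (h2 := Cminus_neq_0 b a (not_eq_sym hab)).
  rewrite (cint_comb (fun z => phi z / (z - a))%C (fun z => phi z / (z - b))%C
    (fun z => phi z / (z - b))%C _ (/ (a - b))%C (/ (b - a))%C 0);
    try (apply continuous_over_pole; assumption).
  - rewrite !cint_pole; [|assumption ..]. field. nonzero.
  - intros z hz. field. nonzero.
Qed.

Lemma kern2_swap12 a b c : kern2 a b c = kern2 b a c.
Proof.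
  unfold kern2. f_equal. apply (contour_int_ext (V := C_CompleteNormedModule)). intros z _. eqC. ring.
Qed.

Lemma kern2_swap23 a b c : kern2 a b c = kern2 a c b.
Proof.
  unfold kern2. f_equal. apply (contour_int_ext (V := C_CompleteNormedModule)). intros z _. eqC. ring.
Qed.

Lemma kern2_triple a : Om a -> kern2 a a a = (C_derive (C_derive phi) a / 2)%C.
Proof.
  intros ha. unfold kern2.
  assert (e : cint Gam (fun z => phi z * (/ (z - a) * (/ (z - a) * / (z - a))))%C =
    cint Gam (fun z => phi z / ((z - a) * (z - a) * (z - a)))%C).
  { apply (contour_int_ext (V := C_CompleteNormedModule)). intros z hz. eqC. field.
    apply contour_sub_neq_0; assumption. }
  rewrite e cint_pole3; [|exact ha]. field. apply two_pi_i_neq_0.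
Qed.

Lemma kern2_double a b : Om a -> Om b -> a <> b ->
  kern2 a b b = (/ (b - a) * (C_derive phi b - (phi a - phi b) / (a - b)))%C.
Proof.
  intros ha hb hab. unfold kern2.
  assert (h1 := Cminus_neq_0 a b hab). assert (h2 := Cminus_neq_0 b a (not_eq_sym hab)).
  rewrite (cint_comb (fun z => phi z / (z - a))%C (fun z => phi z / (z - b))%C
    (fun z => phi z / ((z - b) * (z - b)))%C _ (/ ((a - b) * (a - b)))%C
    (- / ((a - b) * (a - b)))%C (/ (b - a))%C);
    [|apply continuous_over_pole, ha|apply continuous_over_pole, hb|apply continuous_over_pole2, hb|].
  - rewrite !cint_pole; [|assumption ..]. rewrite cint_pole2; [|assumption].
    field. nonzero.
  - intros z hz. field. nonzero.
Qed.

Lemma kern2_distinct a b c : Om a -> Om b -> Om c -> a <> b -> b <> c -> c <> a ->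
  kern2 a b c = (((b - c) * phi a + (c - a) * phi b + (a - b) * phi c)
   / (a ^ 2 * (b - c) + b ^ 2 * (c - a) + c ^ 2 * (a - b)))%C.
Proof.
  intros ha hb hc hab hbc hca. unfold kern2.
  assert (h1 := Cminus_neq_0 a b hab). assert (h1' := Cminus_neq_0 b a (not_eq_sym hab)).
  assert (h2 := Cminus_neq_0 b c hbc). assert (h2' := Cminus_neq_0 c b (not_eq_sym hbc)).
  assert (h3 := Cminus_neq_0 c a hca). assert (h3' := Cminus_neq_0 a c (not_eq_sym hca)).
  (* The denominator is a Vandermonde product, hence non-zero at distinct points. *)
  replace (a ^ 2 * (b - c) + b ^ 2 * (c - a) + c ^ 2 * (a - b))%C
    with ((a - b) * (a - c) * (b - c))%C by (simpl; ring).
  rewrite (cint_comb (fun z => phi z / (z - a))%C (fun z => phi z / (z - b))%C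
    (fun z => phi z / (z - c))%C _ (/ ((a - b) * (a - c)))%C
    (/ ((b - a) * (b - c)))%C (/ ((c - a) * (c - b)))%C);
    try (apply continuous_over_pole; assumption).
  - rewrite !cint_pole; [|assumption ..].
    field. nonzero.
  - intros z hz. field. nonzero.
Qed.

End Coefficients.

(** * Spectral sums *)

Section Sums.

Context {V : NormedModule C_AbsRing}.

Definition dsum (F : nat -> nat -> V) (N : nat) : V := sum_n (fun i => sum_n (F i) N) N.

Definition tsum (F : nat -> nat -> nat -> V) (N : nat) : V :=
  sum_n (fun i => sum_n (fun j => sum_n (F i j) N) N) N.

Lemma tsum_ext F F' N : (forall i j k, F i j k = F' i j k) -> tsum F N = tsum F' N.
Proof.
  intros h. apply sum_n_ext. intros i. apply sum_n_ext. intros j. apply sum_n_ext. intros k. apply h.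
Qed.

Lemma tsum_plus F F' N :
  tsum (fun i j k => plus (F i j k) (F' i j k)) N = plus (tsum F N) (tsum F' N).
Proof.
  unfold tsum. rewrite -sum_n_plus. apply sum_n_ext. intros i.
  rewrite -sum_n_plus. apply sum_n_ext. intros j. apply sum_n_plus.
Qed.

Lemma tsum_scal (c : C) F N : tsum (fun i j k => scal c (F i j k)) N = scal c (tsum F N).
Proof.
  unfold tsum. eapply eq_trans; [|exact (sum_n_scal_l (V := V) c _ N)]. apply sum_n_ext. intros i.
  eapply eq_trans; [|exact (sum_n_scal_l (V := V) c _ N)]. apply sum_n_ext. intros j.
  exact (sum_n_scal_l (V := V) c _ N).
Qed.

Lemma tsum_swap12 F N : tsum (fun i j k => F j i k) N = tsum F N.
Proof. unfold tsum. apply sum_n_switch. Qed.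

Lemma tsum_swap23 F N : tsum (fun i j k => F i k j) N = tsum F N.
Proof. unfold tsum. apply sum_n_ext. intros i. apply sum_n_switch. Qed.

Lemma tends_of_minus (u : nat -> V) (l : V) : tends (fun n => minus (u n) l) zero -> tends u l.
Proof.
  intros h. apply tends_of_norm. intros eps he.
  destruct (tends_to_norm _ _ h eps he) as [N hN]. exists N. intros n hn.
  specialize (hN n hn). rewrite minus_zero_r in hN. exact hN.
Qed.

Lemma tends_zero_of_le (u v : nat -> V) :
  (forall n, norm (u n) <= norm (v n)) -> tends v zero -> tends u zero.
Proof.
  intros hle h. apply tends_of_norm. intros eps he.
  destruct (tends_to_norm _ _ h eps he) as [N hN]. exists N. intros n hn.
  specialize (hN n hn). rewrite minus_zero_r in hN. rewrite minus_zero_r.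
  apply Rle_lt_trans with (2 := hN). apply hle.
Qed.

Lemma scal_minus_one (u : V) : scal (- (1))%C u = opp u.
Proof. exact (scal_opp_one (V := V) u). Qed.

Lemma opp_zero_V : opp zero = zero :> V.
Proof. exact (@opp_zero V). Qed.

End Sums.

Section StrongLimits.

Context {Hs : CompleteNormedModule C_AbsRing}.
Local Notation H := (CompleteNormedModule.NormedModule C_AbsRing Hs).
Context {ip : H -> H -> C} (Hip : is_inner_product ip).
Context (P : nat -> H -> H) (HP : orth_family ip P).
Context (Hid : forall x, is_series (fun i => P i x) x).

(** By [strong_lim_zero] only vectors [P k y] matter. There the pinching is a single block, and its
    norm is dominated by that of the operator which is pinched. *)
Lemma pinch_tends (cls : nat -> nat) (M : nat -> H -> H) (L : H -> H) (c c' : R) :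
  (forall n, bounded_by c (M n)) -> bounded_by c' L ->
  (forall x, tends (fun n => M n x) (L x)) ->
  forall x, tends (fun n => pinch P cls (M n) x) (pinch P cls L x).
Proof.
  intros hM hL h x. apply tends_of_minus.
  assert (hpL := bounded_by_pinch Hip P HP Hid cls c' L hL).
  apply (strong_lim_zero P Hid (fun n x => minus (pinch P cls (M n) x) (pinch P cls L x)) (c + c')).
  - assert (h1 := proj1 (proj2 (hM 0%nat))). assert (h2 := proj1 (proj2 hL)). lra.
  - intros n. apply is_linear_minus; [|apply hpL].
    apply (bounded_by_pinch Hip P HP Hid cls c (M n) (hM n)).
  - intros n y. assert (hpM := bounded_by_pinch Hip P HP Hid cls c (M n) (hM n)).
    apply Rle_trans with (1 := norm_triangle (V := H) _ _). rewrite norm_opp Rmult_plus_distr_r.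
    apply Rplus_le_compat; [apply hpM|apply hpL].
  - intros k y. apply tends_zero_of_le with (fun n => minus (M n (P k y)) (L (P k y))).
    + intros n. rewrite -(pinch_minus Hip P HP Hid cls c c'); [|apply hM|exact hL].
      apply (norm_pinch_proj Hip P HP Hid cls (c + c')).
      split; [|split].
      * apply is_linear_minus; [apply hM|apply hL].
      * assert (h1 := proj1 (proj2 (hM 0%nat))). assert (h2 := proj1 (proj2 hL)). lra.
      * intros z. apply Rle_trans with (1 := norm_triangle (V := H) _ _).
        rewrite norm_opp Rmult_plus_distr_r. apply Rplus_le_compat; [apply hM|apply hL].
    + apply tends_of_norm. intros eps he.
      destruct (tends_to_norm _ _ (h (P k y)) eps he) as [N hN]. exists N. intros n hn.
      rewrite minus_zero_r. apply hN, hn.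
Qed.

(** The outer indices of the partial sums are cut as well. The uniform bound absorbs the cut of the
    argument, and the cut of the value is compared with the one at the fixed vector [L x]. *)
Lemma trunc_sandwich (A : nat -> H -> H) (L : H -> H) (c : R) x :
  (forall n, bounded_by c (A n)) -> tends (fun n => A n x) (L x) ->
  tends (fun n => trunc P n (A n (trunc P n x))) (L x).
Proof.
  intros hA h. apply tends_of_norm. intros eps he.
  assert (hc := proj1 (proj2 (hA 0%nat))).
  assert (h3 : 0 < eps / 3) by lra.
  assert (h4 : 0 < eps / 3 / (c + 1)) by (apply Rdiv_lt_0_compat; lra).
  destruct (tends_to_norm _ _ h _ h3) as [N1 hN1].
  destruct (tends_to_norm _ _ (trunc_lim P Hid x) _ h4) as [N2 hN2].
  destruct (tends_to_norm _ _ (trunc_lim P Hid (L x)) _ h3) as [N3 hN3].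
  exists (Nat.max N1 (Nat.max N2 N3)). intros n hn.
  specialize (hN1 n ltac:(lia)). specialize (hN2 n ltac:(lia)). specialize (hN3 n ltac:(lia)).
  assert (hE := is_linear_trunc P HP n). destruct (hA n) as [hl [_ hb]].
  assert (e : minus (trunc P n (A n (trunc P n x))) (L x) =
    plus (plus (trunc P n (A n (minus (trunc P n x) x))) (trunc P n (minus (A n x) (L x))))
      (minus (trunc P n (L x)) (L x))).
  { rewrite (linear_minus _ _ _ hl) !(linear_minus _ _ _ hE).
    rewrite -(minus_trans (trunc P n (A n x))) -minus_trans. reflexivity. }
  rewrite e. apply Rle_lt_trans with (1 := norm_triangle (V := H) _ _).
  assert (g1 := norm_triangle (V := H) (trunc P n (A n (minus (trunc P n x) x))) (trunc P n (minus (A n x) (L x)))).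
  assert (g2 := norm_trunc_le Hip P HP n (A n (minus (trunc P n x) x))).
  assert (g3 := norm_trunc_le Hip P HP n (minus (A n x) (L x))).
  assert (g4 := hb (minus (trunc P n x) x)).
  assert (g5 : c * norm (minus (trunc P n x) x) < eps / 3).
  { apply Rle_lt_trans with ((c + 1) * norm (minus (trunc P n x) x)).
    - apply Rmult_le_compat_r; [apply norm_ge_0|lra].
    - apply (Rmult_lt_compat_l (c + 1)) in hN2; [|lra].
      replace ((c + 1) * (eps / 3 / (c + 1))) with (eps / 3) in hN2 by (field; lra). exact hN2. }
  lra.
Qed.

Lemma dsum_proj (L : H -> H) N x :
  is_linear L -> dsum (fun i k => P i (L (P k x))) N = trunc P N (L (trunc P N x)).
Proof.
  intros hL. unfold dsum, trunc. apply sum_n_ext. intros i.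
  rewrite (linear_sum_n L _ _ hL) (linear_sum_n _ _ _ (orth_family_linear P HP i)). reflexivity.
Qed.

End StrongLimits.

Section SpectralSums.

Context {Hs : CompleteNormedModule C_AbsRing}.
Local Notation H := (CompleteNormedModule.NormedModule C_AbsRing Hs).
Context {ip : H -> H -> C} (Hip : is_inner_product ip).
Context (T : H -> H) (HT : is_linear T) (lam : nat -> R) (P : nat -> H -> H).
Context (Hexp : eigen_expansion ip T lam P).
Context (D : C -> Prop) (phi : C -> C).
Context (Dopen : open (T := C_UniformSpace) D) (Hphi : analytic_on D phi).
Context (Om : C -> Prop) (Gam : list jordan_curve).
Context (Om_open : open (T := C_UniformSpace) Om).
Context (Om_bounded : exists M : R, forall z, Om z -> Cmod z <= M).
Context (HGam : positive_boundary Om Gam).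
Context (spec_Om : forall z, spectrum T z -> Om z).
Context (Om_D : forall z, closure_of Om z -> D z).
Context (d : R) (hd : 0 < d).
Context (Haway : forall z, on_contour Gam z -> away T lam d z).

Let HP := expansion_orth_family T lam P Hexp.
Let Hid := ee_id _ _ _ _ Hexp.
Let Hphic := phi_continuous_on_contour D phi Dopen Hphi Om Gam HGam Om_D.
Local Notation Q1 G := (contour_op Gam phi (res1 T G)).
Local Notation Q2 G1 G2 := (contour_op Gam phi (res2 T G1 G2)).
Local Notation K1 i k := (kern1 phi Gam (RtoC (lam i)) (RtoC (lam k))).
Local Notation K2 i j k := (kern2 phi Gam (RtoC (lam i)) (RtoC (lam j)) (RtoC (lam k))).

Lemma spectral_in_Om i : (forall x, P i x = zero) \/ Om (RtoC (lam i)).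
Proof.
  destruct (spectrum_or_zero T lam P Hexp i) as [h|h]; [right; apply spec_Om, h|left; exact h].
Qed.

Lemma linear_at_zero (l : H -> H) : is_linear l -> l zero = zero.
Proof. exact (linear_zero l). Qed.

(** Next to a projection a resolvent is a scalar, which leaves the scalar integral [kern1]. For a
    padding projection that integral may be meaningless, but then both sides are zero. *)
Lemma proj_contour_res1 G i k x :
  is_linear G -> P i (Q1 G (P k x)) = scal (K1 i k) (P i (G (P k x))).
Proof.
  intros hG. assert (hpi := orth_family_linear P HP i).
  rewrite (contour_op_linear Gam phi Hphic _ (P i));
    [|exact hpi|exact (cont_along_res1 Hip T lam P Hexp d hd Gam Haway G _ hG)].
  destruct (spectral_in_Om i) as [h0|hi].
  { rewrite h0 (contour_op_zero Gam phi Hphic); [|intros z _; apply h0].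
    symmetry. exact (scal_zero_r (V := H) _). }
  destruct (spectral_in_Om k) as [h0|hk].
  { rewrite h0 (linear_at_zero G hG) (orth_family_zero P HP) (contour_op_zero Gam phi Hphic).
    - symmetry. exact (scal_zero_r (V := H) _).
    - intros z hz. assert (hR := resolvent_linear T lam d z (Haway z hz)).
      unfold res1. rewrite (linear_at_zero _ hR) (linear_at_zero G hG) (linear_at_zero _ hR).
      apply (orth_family_zero P HP). }
  unfold kern1. rewrite -(contour_op_scalar Gam phi Hphic).
  - apply contour_op_ext. intros z hz. unfold res1.
    rewrite (proj_resolvent T lam P Hexp d hd z); [|apply Haway, hz].
    rewrite (resolvent_proj T HT lam P Hexp d hd z); [|apply Haway, hz].
    set (a := (/ (z - RtoC (lam i)))%C). set (b := (/ (z - RtoC (lam k)))%C).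
    assert (e : P i (G (scal b (P k x))) = scal b (P i (G (P k x)))).
    { rewrite (linear_scal _ hG b). exact (linear_scal _ hpi b _). }
    rewrite e. exact (scal_assoc (V := H) a b _).
  - intros z hz. apply contC_mult; (apply contC_inv;
      [apply (contour_sub_neq_0 Om Gam Om_open HGam); assumption|contC]).
Qed.

Lemma proj_contour_res2 G1 G2 i j k x :
  is_linear G1 -> is_linear G2 ->
  P i (Q2 (fun y => G1 (P j y)) G2 (P k x)) = scal (K2 i j k) (P i (G1 (P j (G2 (P k x))))).
Proof.
  intros hG1 hG2. assert (hpi := orth_family_linear P HP i). assert (hpj := orth_family_linear P HP j).
  assert (hG1j : is_linear (fun y => G1 (P j y))) by exact (is_linear_comp _ _ hpj hG1).
  rewrite (contour_op_linear Gam phi Hphic _ (P i));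
    [|exact hpi|exact (cont_along_res2 Hip T lam P Hexp d hd Gam Haway _ _ _ hG1j hG2)].
  destruct (spectral_in_Om i) as [h0|hi].
  { rewrite h0 (contour_op_zero Gam phi Hphic); [|intros z _; apply h0].
    symmetry. exact (scal_zero_r (V := H) _). }
  destruct (spectral_in_Om j) as [h0|hj].
  { rewrite h0 (linear_at_zero G1 hG1) (orth_family_zero P HP) (contour_op_zero Gam phi Hphic).
    - symmetry. exact (scal_zero_r (V := H) _).
    - intros z hz. assert (hR := resolvent_linear T lam d z (Haway z hz)).
      unfold res2. rewrite h0 (linear_at_zero G1 hG1) (linear_at_zero _ hR).
      apply (orth_family_zero P HP). }
  destruct (spectral_in_Om k) as [h0|hk].
  { rewrite h0 (linear_at_zero G2 hG2) (orth_family_zero P HP) (linear_at_zero G1 hG1)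
      (orth_family_zero P HP) (contour_op_zero Gam phi Hphic).
    - symmetry. exact (scal_zero_r (V := H) _).
    - intros z hz. assert (hR := resolvent_linear T lam d z (Haway z hz)).
      unfold res2. rewrite (linear_at_zero _ hR) (linear_at_zero G2 hG2) (linear_at_zero _ hR)
        (linear_at_zero _ hG1j) (linear_at_zero _ hR).
      apply (orth_family_zero P HP). }
  unfold kern2. rewrite -(contour_op_scalar Gam phi Hphic).
  - apply contour_op_ext. intros z hz. unfold res2.
    rewrite !(proj_resolvent T lam P Hexp d hd z); [|apply Haway, hz ..].
    rewrite (resolvent_proj T HT lam P Hexp d hd z); [|apply Haway, hz].
    set (a := (/ (z - RtoC (lam i)))%C). set (b := (/ (z - RtoC (lam j)))%C).
    set (c := (/ (z - RtoC (lam k)))%C).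
    assert (e : P i (G1 (scal b (P j (G2 (scal c (P k x)))))) =
      scal (b * c)%C (P i (G1 (P j (G2 (P k x)))))).
    { rewrite (linear_scal _ hG2 c).
      assert (e1 : P j (scal c (G2 (P k x))) = scal c (P j (G2 (P k x)))) by exact (linear_scal _ hpj c _).
      rewrite e1. assert (e2 : forall y : H, scal b (scal c y) = scal (b * c)%C y)
        by exact (fun y => scal_assoc (V := H) b c y).
      rewrite e2 (linear_scal _ hG1 (b * c)%C). exact (linear_scal _ hpi _ _). }
    rewrite e. exact (scal_assoc (V := H) a (b * c)%C _).
  - intros z hz. apply contC_mult; [|apply contC_mult]; (apply contC_inv;
      [apply (contour_sub_neq_0 Om Gam Om_open HGam); assumption|contC]).
Qed.

Lemma contour_res2_sum G1 G2 N y :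
  is_linear G1 -> is_linear G2 ->
  Q2 (fun v => G1 (trunc P N v)) G2 y = sum_n (fun j => Q2 (fun v => G1 (P j v)) G2 y) N.
Proof.
  intros hG1 hG2.
  assert (hGP : forall j, is_linear (fun v => G1 (P j v)))
    by (intros j; exact (is_linear_comp _ _ (orth_family_linear P HP j) hG1)).
  assert (hGE : forall n, is_linear (fun v => G1 (trunc P n v)))
    by (intros n; exact (is_linear_comp _ _ (is_linear_trunc P HP n) hG1)).
  induction N as [|N IH].
  - rewrite sum_O. apply contour_op_ext. intros z _. unfold res2, trunc. rewrite sum_O. reflexivity.
  - rewrite sum_Sn -IH.
    apply (contour_op_plus Gam phi Hphic).
    + exact (cont_along_res2 Hip T lam P Hexp d hd Gam Haway _ _ _ (hGE N) hG2).
    + exact (cont_along_res2 Hip T lam P Hexp d hd Gam Haway _ _ _ (hGP (S N)) hG2).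
    + intros z hz. assert (hR := resolvent_linear T lam d z (Haway z hz)).
      unfold res2. rewrite -(linear_plus _ hR) -(linear_plus _ hG1). unfold trunc.
      rewrite sum_Sn. reflexivity.
Qed.

(** A representative index in each class of equal eigenvalues; the choice depends on the value
    [lam i] alone, so equal eigenvalues get the same label. *)
Definition cls (i : nat) : nat := epsilon (inhabits 0%nat) (fun j => lam j = lam i).

Lemma cls_eq i k : cls i = cls k <-> lam i = lam k.
Proof.
  assert (hs : forall n, lam (cls n) = lam n).
  { intros n. exact (epsilon_spec (inhabits 0%nat) (fun j => lam j = lam n) (ex_intro _ n eq_refl)). }
  split; intros h.
  - rewrite -(hs i) -(hs k) h. reflexivity.
  - unfold cls. rewrite h. reflexivity.
Qed.

(** * Second-order sums for a fixed operator [G] *)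

Context (G : H -> H) (HG : is_linear G).

Local Notation eqc i k := (Nat.eqb (cls i) (cls k)).
Local Notation KV i j k x := (scal (K2 i j k) (P i (G (P j (G (P k x)))))).
Local Notation dG := (pinch P cls G).

Lemma bounded_G : exists c, bounded_by c G.
Proof.
  destruct (linear_bound G HG) as [c [h1 h2]]. exists c. split; [exact HG|]. split; assumption.
Qed.

Lemma bounded_dG : exists c, bounded_by c dG.
Proof.
  destruct bounded_G as [c hc]. exists c. exact (bounded_by_pinch Hip P HP Hid cls c G hc).
Qed.

(** Two operators are allowed because restricted sums for [G] are total sums for pinched
    operators. *)
Lemma tends_total G1 G2 c1 c2 x :
  bounded_by c1 G1 -> bounded_by c2 G2 ->
  tends (tsum (fun i j k => scal (K2 i j k) (P i (G1 (P j (G2 (P k x))))))) (Q2 G1 G2 x).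
Proof.
  intros h1 h2. destruct (contour_res2_bounded Hip T lam P Hexp d hd Gam Haway phi Hphic) as [K [hK hb]].
  assert (hbN : forall N, bounded_by (K * ((c1 * 1) * c2)) (Q2 (fun v => G1 (trunc P N v)) G2)).
  { intros N. apply hb; [|exact h2]. apply bounded_by_comp; [exact h1|].
    exact (bounded_by_trunc Hip T lam P Hexp N). }
  assert (hlim := trunc_sandwich Hip P HP Hid _ (Q2 G1 G2) _ x hbN
    (contour_res2_trunc_lim Hip T lam P Hexp d hd Gam Haway phi Hphic G1 G2 c1 x h1 (proj1 h2))).
  apply tends_ext with (2 := hlim). intros N.
  rewrite -(dsum_proj P HP); [|apply hbN].
  (* The middle index is moved innermost: the outer two come from [dsum_proj], the middle one from
     the truncation inside the integral. *)
  rewrite -tsum_swap23. unfold dsum, tsum. apply sum_n_ext. intros i. apply sum_n_ext. intros k.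
  rewrite (contour_res2_sum G1 G2 N _ (proj1 h1) (proj1 h2)).
  rewrite (linear_sum_n _ _ _ (orth_family_linear P HP i)). apply sum_n_ext. intros j.
  apply proj_contour_res2; [apply h1|apply h2].
Qed.

Lemma tends_first_equal x :
  tends (tsum (fun i j k => if eqc i j then KV i j k x else zero)) (Q2 dG G x).
Proof.
  destruct bounded_G as [c hc]. destruct bounded_dG as [c' hc'].
  apply tends_ext with (2 := tends_total dG G c' c x hc' hc). intros N. apply tsum_ext. intros i j k.
  rewrite (proj_pinch_proj Hip P HP Hid cls c); [|exact hc].
  destruct (eqc i j); [reflexivity|]. exact (scal_zero_r (V := H) _).
Qed.

Lemma tends_last_equal x :
  tends (tsum (fun i j k => if eqc j k then KV i j k x else zero)) (Q2 G dG x).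
Proof.
  destruct bounded_G as [c hc]. destruct bounded_dG as [c' hc'].
  apply tends_ext with (2 := tends_total G dG c c' x hc hc'). intros N. apply tsum_ext. intros i j k.
  rewrite (proj_pinch_proj Hip P HP Hid cls c); [|exact hc].
  destruct (eqc j k); [reflexivity|].
  rewrite (linear_at_zero G HG) (orth_family_zero P HP). exact (scal_zero_r (V := H) _).
Qed.

Lemma tends_all_equal x :
  tends (tsum (fun i j k => if eqc i j && eqc j k then KV i j k x else zero)) (Q2 dG dG x).
Proof.
  destruct bounded_G as [c hc]. destruct bounded_dG as [c' hc'].
  apply tends_ext with (2 := tends_total dG dG c' c' x hc' hc'). intros N. apply tsum_ext. intros i j k.
  rewrite !(proj_pinch_proj Hip P HP Hid cls c); [|exact hc ..].
  destruct (eqc i j); destruct (eqc j k); simpl;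
    rewrite ?(linear_at_zero G HG) ?(orth_family_zero P HP); try reflexivity;
    exact (scal_zero_r (V := H) _).
Qed.

(** The condition couples the two outer projections, so it cannot be imposed on [G] in either slot.
    It is imposed on the whole operator while the middle index is still truncated; [pinch_tends]
    then allows the passage to the limit. *)
Lemma tends_outer_equal x :
  tends (tsum (fun i j k => if eqc i k then KV i j k x else zero)) (pinch P cls (Q2 G G) x).
Proof.
  destruct bounded_G as [c hc].
  destruct (contour_res2_bounded Hip T lam P Hexp d hd Gam Haway phi Hphic) as [K [hK hb]].
  assert (hbN : forall N, bounded_by (K * ((c * 1) * c)) (Q2 (fun v => G (trunc P N v)) G)).
  { intros N. apply hb; [|exact hc]. apply bounded_by_comp; [exact hc|].
    exact (bounded_by_trunc Hip T lam P Hexp N). }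
  assert (hb0 := hb G G c c hc hc).
  assert (hpN : forall N, bounded_by (K * ((c * 1) * c)) (pinch P cls (Q2 (fun v => G (trunc P N v)) G))).
  { intros N. apply (bounded_by_pinch Hip P HP Hid cls), hbN. }
  assert (hlim := trunc_sandwich Hip P HP Hid _ (pinch P cls (Q2 G G)) _ x hpN
    (pinch_tends Hip P HP Hid cls _ _ _ _ hbN hb0
      (fun y => contour_res2_trunc_lim Hip T lam P Hexp d hd Gam Haway phi Hphic G G c y hc HG) x)).
  apply tends_ext with (2 := hlim). intros N.
  rewrite -(dsum_proj P HP); [|apply hpN].
  rewrite -tsum_swap23. unfold dsum, tsum. apply sum_n_ext. intros i. apply sum_n_ext. intros k.
  rewrite (proj_pinch_proj Hip P HP Hid cls _ _ _ _ _ (hbN N)).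
  destruct (eqc i k).
  - rewrite (contour_res2_sum G G N _ HG HG).
    rewrite (linear_sum_n _ _ _ (orth_family_linear P HP i)). apply sum_n_ext. intros j.
    apply proj_contour_res2; exact HG.
  - symmetry. unfold sum_n. apply sum_n_m_const_zero.
Qed.


Local Notation V3 i j k x := (P i (G (P j (G (P k x))))).

Lemma V3_zero_or_in_Om i j k x :
  V3 i j k x = zero \/ (Om (RtoC (lam i)) /\ Om (RtoC (lam j)) /\ Om (RtoC (lam k))).
Proof.
  destruct (spectral_in_Om i) as [h|hi]; [left; apply h|].
  destruct (spectral_in_Om j) as [h|hj].
  { left. rewrite h (linear_at_zero G HG). apply (orth_family_zero P HP). }
  destruct (spectral_in_Om k) as [h|hk].
  { left. rewrite h (linear_at_zero G HG) (orth_family_zero P HP) (linear_at_zero G HG).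
    apply (orth_family_zero P HP). }
  right. repeat split; assumption.
Qed.

(** Coefficients need to be compared only at points of [Om]; otherwise the term itself vanishes. *)
Lemma scal_V3 (c c' : C) i j k x :
  (Om (RtoC (lam i)) -> Om (RtoC (lam j)) -> Om (RtoC (lam k)) -> c = c') ->
  scal c (V3 i j k x) = scal c' (V3 i j k x).
Proof.
  intros h. destruct (V3_zero_or_in_Om i j k x) as [h0|[hi [hj hk]]].
  - rewrite h0. transitivity (zero : H); [exact (scal_zero_r (V := H) c)|].
    symmetry. exact (scal_zero_r (V := H) c').
  - rewrite (h hi hj hk). reflexivity.
Qed.

Lemma indic_true (Q : Prop) (c : C) : Q -> (indic Q * c)%C = c.
Proof.
  intros h. unfold indic. destruct (excluded_middle_informative Q); [ring|contradiction].
Qed.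

Lemma indic_false (Q : Prop) (c : C) : ~ Q -> (indic Q * c)%C = 0%C.
Proof.
  intros h. unfold indic. destruct (excluded_middle_informative Q); [contradiction|ring].
Qed.

Lemma scal_zero_C (v : H) : scal (RtoC 0) v = zero.
Proof. exact (scal_zero_l (V := H) v). Qed.

Lemma eqc_true i k : eqc i k = true <-> lam i = lam k.
Proof. rewrite Nat.eqb_eq. apply cls_eq. Qed.

Lemma eqc_false i k : eqc i k = false <-> lam i <> lam k.
Proof. rewrite Nat.eqb_neq. rewrite cls_eq. reflexivity. Qed.

Lemma all_equal_term i j k x :
  scal (indic (lam i = lam j /\ lam j = lam k) * (C_derive (C_derive phi) (lam i) / 2))%C (V3 i j k x)
  = if eqc i j && eqc j k then KV i j k x else zero.
Proof.
  destruct (eqc i j) eqn:e1; destruct (eqc j k) eqn:e2; simpl;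
    rewrite ?eqc_true ?eqc_false in e1, e2;
    try (rewrite indic_false; [apply scal_zero_C|tauto]).
  rewrite indic_true; [|tauto]. apply scal_V3. intros hi _ _. rewrite -e2 -e1.
  symmetry. apply (kern2_triple D phi Dopen Hphi Om Gam Om_open Om_bounded HGam Om_D _ hi).
Qed.

Lemma first_equal_term i j k x :
  scal (indic (lam i = lam j /\ lam i <> lam k) * coef_double phi (lam k) (lam i))%C (V3 i j k x)
  = if eqc i j && negb (eqc i k) then KV i j k x else zero.
Proof.
  destruct (eqc i j) eqn:e1; destruct (eqc i k) eqn:e2; simpl;
    rewrite ?eqc_true ?eqc_false in e1, e2;
    try (rewrite indic_false; [apply scal_zero_C|tauto]).
  rewrite indic_true; [|tauto]. apply scal_V3. intros hi _ hk. rewrite -e1.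
  (* Symmetry of the divided difference moves the repeated eigenvalue to the last two places, as in
     [kern2_double]. *)
  rewrite kern2_swap23 kern2_swap12.
  symmetry. apply (kern2_double D phi Dopen Hphi Om Gam Om_open Om_bounded HGam Om_D _ _ hk hi).
  intros e. apply RtoC_inj in e. congruence.
Qed.

Lemma last_equal_term i j k x :
  scal (indic (lam j = lam k /\ lam j <> lam i) * coef_double phi (lam i) (lam j))%C (V3 i j k x)
  = if eqc j k && negb (eqc i j) then KV i j k x else zero.
Proof.
  destruct (eqc j k) eqn:e1; destruct (eqc i j) eqn:e2; simpl;
    rewrite ?eqc_true ?eqc_false in e1, e2;
    try (rewrite indic_false; [apply scal_zero_C|intuition congruence]).
  rewrite indic_true; [|intuition congruence]. apply scal_V3. intros hi hj _. rewrite -e1.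
  symmetry. apply (kern2_double D phi Dopen Hphi Om Gam Om_open Om_bounded HGam Om_D _ _ hi hj).
  intros e. apply RtoC_inj in e. congruence.
Qed.

Lemma outer_equal_term i j k x :
  scal (indic (lam i = lam k /\ lam i <> lam j) * coef_double phi (lam j) (lam i))%C (V3 i j k x)
  = if eqc i k && negb (eqc i j) then KV i j k x else zero.
Proof.
  destruct (eqc i k) eqn:e1; destruct (eqc i j) eqn:e2; simpl;
    rewrite ?eqc_true ?eqc_false in e1, e2;
    try (rewrite indic_false; [apply scal_zero_C|tauto]).
  rewrite indic_true; [|tauto]. apply scal_V3. intros hi hj _. rewrite -e1.
  rewrite kern2_swap12.
  symmetry. apply (kern2_double D phi Dopen Hphi Om Gam Om_open Om_bounded HGam Om_D _ _ hj hi).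
  intros e. apply RtoC_inj in e. congruence.
Qed.

Lemma distinct_term i j k x :
  scal (indic (lam i <> lam j /\ lam j <> lam k /\ lam k <> lam i)
        * coef_distinct phi (lam i) (lam j) (lam k))%C (V3 i j k x)
  = if negb (eqc i j) && negb (eqc j k) && negb (eqc i k) then KV i j k x else zero.
Proof.
  destruct (eqc i j) eqn:e1; destruct (eqc j k) eqn:e2; destruct (eqc i k) eqn:e3; simpl;
    rewrite ?eqc_true ?eqc_false in e1, e2, e3;
    try (rewrite indic_false; [apply scal_zero_C|intuition congruence]).
  rewrite indic_true; [|intuition congruence]. apply scal_V3. intros hi hj hk.
  symmetry. apply (kern2_distinct D phi Dopen Hphi Om Gam Om_open Om_bounded HGam Om_D _ _ _ hi hj hk);
    intros e; apply RtoC_inj in e; congruence.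
Qed.

Lemma split_term (b b' : bool) (v : H) :
  (if b && negb b' then v else zero) = plus (if b then v else zero) (scal (- (1))%C (if b && b' then v else zero)).
Proof.
  rewrite scal_minus_one. destruct b, b'; simpl; symmetry.
  - exact (plus_opp_r (G := H) v).
  - rewrite opp_zero_V. exact (plus_zero_r (G := H) v).
  - rewrite opp_zero_V. exact (plus_zero_r (G := H) zero).
  - rewrite opp_zero_V. exact (plus_zero_r (G := H) zero).
Qed.

Lemma tends_tsum_split (b b' : nat -> nat -> nat -> bool) (F : nat -> nat -> nat -> H) (l m : H) :
  tends (tsum (fun i j k => if b i j k then F i j k else zero)) l ->
  tends (tsum (fun i j k => if b i j k && b' i j k then F i j k else zero)) m ->
  tends (tsum (fun i j k => if b i j k && negb (b' i j k) then F i j k else zero))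
    (plus l (scal (- (1))%C m)).
Proof.
  intros hl hm.
  apply tends_ext with (2 := tends_plus _ _ _ _ hl (tends_scal (- (1))%C _ _ hm)).
  intros N. rewrite -tsum_scal -tsum_plus. apply tsum_ext. intros i j k. symmetry. apply split_term.
Qed.

(* Each group of terms of [double_sum] is the sum over the triples for which one given pair of
   eigenvalues coincides, minus the sum over those for which all three do. *)
Definition double_sum (x : H) : H :=
  plus (plus (plus (Q2 dG G x) (scal (- (1))%C (Q2 dG dG x)))
             (plus (Q2 G dG x) (scal (- (1))%C (Q2 dG dG x))))
       (plus (pinch P cls (Q2 G G) x) (scal (- (1))%C (Q2 dG dG x))).

Lemma tends_double_internal x :
  tends (tsum (fun i j k =>
    plus (plus (if eqc i j && negb (eqc i k) then KV i j k x else zero)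
               (if eqc j k && negb (eqc i j) then KV i j k x else zero))
         (if eqc i k && negb (eqc i j) then KV i j k x else zero))) (double_sum x).
Proof.
  assert (h0 := tends_all_equal x).
  assert (h1 : tends (tsum (fun i j k => if eqc i j && negb (eqc i k) then KV i j k x else zero))
    (plus (Q2 dG G x) (scal (- (1))%C (Q2 dG dG x)))).
  { apply (tends_tsum_split (fun i j k => eqc i j) (fun i j k => eqc i k) (fun i j k => KV i j k x));
      [apply tends_first_equal|].
    apply tends_ext with (2 := h0). intros N. apply tsum_ext. intros i j k.
    (* Once [lam i = lam j], comparing [k] with [i] is the same as comparing it with [j]. *)
    destruct (Nat.eqb_spec (cls i) (cls j)) as [e|e]; simpl; [|reflexivity]. rewrite e. reflexivity. }
  assert (h2 : tends (tsum (fun i j k => if eqc j k && negb (eqc i j) then KV i j k x else zero))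
    (plus (Q2 G dG x) (scal (- (1))%C (Q2 dG dG x)))).
  { apply (tends_tsum_split (fun i j k => eqc j k) (fun i j k => eqc i j) (fun i j k => KV i j k x));
      [apply tends_last_equal|].
    apply tends_ext with (2 := h0). intros N. apply tsum_ext. intros i j k.
    rewrite Bool.andb_comm. reflexivity. }
  assert (h3 : tends (tsum (fun i j k => if eqc i k && negb (eqc i j) then KV i j k x else zero))
    (plus (pinch P cls (Q2 G G) x) (scal (- (1))%C (Q2 dG dG x)))).
  { apply (tends_tsum_split (fun i j k => eqc i k) (fun i j k => eqc i j) (fun i j k => KV i j k x));
      [apply tends_outer_equal|].
    apply tends_ext with (2 := h0). intros N. apply tsum_ext. intros i j k.
    rewrite (Bool.andb_comm (eqc i k)).
    destruct (Nat.eqb_spec (cls i) (cls j)) as [e|e]; simpl; [|reflexivity]. rewrite e. reflexivity. }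
  apply tends_ext with (2 := tends_plus _ _ _ _ (tends_plus _ _ _ _ h1 h2) h3).
  intros N. rewrite -!tsum_plus. reflexivity.
Qed.

Lemma tends_double x :
  tends (tsum (fun i j k =>
       scal (indic (lam j = lam k /\ lam j <> lam i)
             * coef_double phi (lam i) (lam j))%C
         (plus (plus (V3 j k i x) (V3 i j k x)) (V3 j i k x)))) (double_sum x).
Proof.
  set (w1 := fun i j k => (if eqc i j && negb (eqc i k) then KV i j k x else zero) : H).
  set (w2 := fun i j k => (if eqc j k && negb (eqc i j) then KV i j k x else zero) : H).
  set (w3 := fun i j k => (if eqc i k && negb (eqc i j) then KV i j k x else zero) : H).
  apply tends_ext with (2 := tends_double_internal x). intros N.
  transitivity (plus (plus (tsum w1 N) (tsum w2 N)) (tsum w3 N)).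
  { rewrite -!tsum_plus. reflexivity. }
  (* The groups are relabelled so that [i] carries the single eigenvalue and [j], [k] the repeated
     one; cubic partial sums are invariant under permutations of the indices. *)
  transitivity (plus (plus (tsum (fun i j k => w1 j k i) N) (tsum w2 N)) (tsum (fun i j k => w3 j i k) N)).
  { rewrite (tsum_swap12 w3). f_equal. f_equal.
    rewrite (tsum_swap12 (fun j i k => w1 j k i)) (tsum_swap23 w1). reflexivity. }
  rewrite -!tsum_plus. apply tsum_ext. intros i j k. symmetry.
  set (c := (indic (lam j = lam k /\ lam j <> lam i) * coef_double phi (lam i) (lam j))%C).
  transitivity (plus (plus (scal c (V3 j k i x)) (scal c (V3 i j k x))) (scal c (V3 j i k x))).
  { transitivity (plus (scal c (plus (V3 j k i x) (V3 i j k x))) (scal c (V3 j i k x))).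
    - exact (scal_distr_l (V := H) c _ _).
    - apply (f_equal (fun u : H => plus u _)). exact (scal_distr_l (V := H) c _ _). }
  unfold w1, w2, w3. rewrite -first_equal_term -last_equal_term -outer_equal_term. reflexivity.
Qed.

Lemma tends_triple x :
  tends (tsum (fun i j k =>
       scal (indic (lam i = lam j /\ lam j = lam k)
             * (C_derive (C_derive phi) (lam i) / 2))%C (V3 i j k x))) (Q2 dG dG x).
Proof.
  apply tends_ext with (2 := tends_all_equal x). intros N. apply tsum_ext. intros i j k.
  symmetry. apply all_equal_term.
Qed.

Definition distinct_sum (x : H) : H :=
  plus (Q2 G G x) (scal (- (1))%C (plus (double_sum x) (Q2 dG dG x))).

Lemma tends_distinct x :
  tends (tsum (fun i j k =>
       scal (indic (lam i <> lam j /\ lam j <> lam k /\ lam k <> lam i)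
             * coef_distinct phi (lam i) (lam j) (lam k))%C (V3 i j k x))) (distinct_sum x).
Proof.
  destruct bounded_G as [c hc].
  apply tends_ext with (2 := tends_plus _ _ _ _ (tends_total G G c c x hc hc)
    (tends_scal (- (1))%C _ _ (tends_plus _ _ _ _ (tends_double_internal x) (tends_all_equal x)))).
  intros N. rewrite -!tsum_plus -tsum_scal -tsum_plus. apply tsum_ext. intros i j k.
  rewrite distinct_term scal_minus_one.
  assert (z1 : forall v : H, plus v zero = v) by exact (plus_zero_r (G := H)).
  assert (z2 : forall v : H, plus zero v = v) by exact (plus_zero_l (G := H)).
  assert (z3 : forall v : H, plus v (opp v) = zero) by exact (plus_opp_r (G := H)).
  (* Of the eight patterns of coincidence three violate transitivity; each of the other five
     contributes to exactly one of the distinct, double and triple sums. *)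
  destruct (Nat.eqb_spec (cls i) (cls j)) as [e1|e1];
    destruct (Nat.eqb_spec (cls j) (cls k)) as [e2|e2];
    destruct (Nat.eqb_spec (cls i) (cls k)) as [e3|e3]; simpl; try congruence;
    rewrite ?z1 ?z2 ?opp_zero_V ?z1 ?z3; reflexivity.
Qed.

Lemma total_decomposition x :
  Q2 G G x = plus (plus (distinct_sum x) (double_sum x)) (Q2 dG dG x).
Proof.
  unfold distinct_sum. rewrite scal_minus_one -!plus_assoc plus_opp_l plus_zero_r. reflexivity.
Qed.

(** * First-order sums *)

Lemma id_blk m x : blk P (fun i => i) m x = P m x.
Proof.
  apply ssum_eq. set (u := fun i => _).
  assert (e : P m x = u m) by (unfold u; rewrite Nat.eqb_refl; reflexivity).
  rewrite e. apply (is_series_single (V := H)). intros j hj. unfold u.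
  destruct (Nat.eqb_spec j m); [congruence|reflexivity].
Qed.

Lemma bounded_Q1 : exists c, bounded_by c (Q1 G).
Proof.
  destruct bounded_G as [c hc].
  destruct (contour_res1_bounded Hip T lam P Hexp d hd Gam Haway phi Hphic) as [K [_ hb]].
  exists (K * c). apply hb, hc.
Qed.

Lemma scal_V2 (c : C) i k x :
  (Om (RtoC (lam i)) -> Om (RtoC (lam k)) -> c = K1 i k) ->
  scal c (P i (G (P k x))) = P i (Q1 G (P k x)).
Proof.
  intros h. rewrite (proj_contour_res1 G i k x HG).
  destruct (spectral_in_Om i) as [h0|hi].
  { rewrite h0. transitivity (zero : H); [exact (scal_zero_r (V := H) c)|].
    symmetry. exact (scal_zero_r (V := H) _). }
  destruct (spectral_in_Om k) as [h0|hk].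
  { rewrite h0 (linear_at_zero G HG) (orth_family_zero P HP).
    transitivity (zero : H); [exact (scal_zero_r (V := H) c)|].
    symmetry. exact (scal_zero_r (V := H) _). }
  rewrite (h hi hk). reflexivity.
Qed.

(** Under the identity labelling the blocks are the single projections, so the diagonal sum is the
    pinching of the whole operator [Q1 G], and its convergence comes with that of the pinching. *)
Lemma tends_diag x :
  is_series (fun i => scal (C_derive phi (lam i)) (P i (G (P i x)))) (pinch P (fun i => i) (Q1 G) x).
Proof.
  destruct bounded_Q1 as [c hc].
  apply is_series_ext with (2 := proj1 (pinch_spec Hip P HP Hid (fun i => i) c _ x hc)).
  intros i. rewrite !id_blk. symmetry. apply scal_V2. intros hi _.
  symmetry. apply (kern1_diag D phi Dopen Hphi Om Gam Om_open Om_bounded HGam Om_D _ hi).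
Qed.

(** The diagonal is subtracted from the square partial sums of all entries. Pairs [i <> k] with
    equal eigenvalues stay in the sum; for them [kern1_diag] supplies the limit value of the
    quotient. *)
Lemma tends_offdiag x :
  tends (dsum (fun i k => scal (indic (i <> k) * diff_quot phi (lam i) (lam k))%C (P i (G (P k x)))))
    (plus (Q1 G x) (scal (- (1))%C (pinch P (fun i => i) (Q1 G) x))).
Proof.
  destruct bounded_Q1 as [c hc].
  assert (h1 := trunc_sandwich Hip P HP Hid (fun _ => Q1 G) (Q1 G) c x (fun _ => hc)
    (filterlim_const (T := nat) (F := eventually) (Q1 G x))).
  apply tends_ext with (2 := tends_plus _ _ _ _ h1 (tends_scal (- (1))%C _ _ (tends_diag x))).
  intros N. rewrite -(dsum_proj P HP); [|apply hc].
  rewrite scal_minus_one.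
  assert (e : sum_n (fun i => scal (C_derive phi (lam i)) (P i (G (P i x)))) N =
    dsum (fun i k => if Nat.eqb i k then P i (Q1 G (P k x)) else zero) N).
  { unfold dsum. apply sum_n_ext_loc. intros i hi.
    rewrite (sum_n_single _ i); [|exact hi|].
    - rewrite Nat.eqb_refl. apply scal_V2. intros hO _.
      symmetry. apply (kern1_diag D phi Dopen Hphi Om Gam Om_open Om_bounded HGam Om_D _ hO).
    - intros k hk. destruct (Nat.eqb_spec i k); [congruence|reflexivity]. }
  rewrite e.
  assert (e2 : opp (dsum (fun i k => if Nat.eqb i k then P i (Q1 G (P k x)) else zero) N) =
    dsum (fun i k => opp (if Nat.eqb i k then P i (Q1 G (P k x)) else zero) : H) N).
  { unfold dsum. rewrite (linear_sum_n (U := H) (V := H) opp _ _ is_linear_opp).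
    apply sum_n_ext. intros i. apply (linear_sum_n (U := H) (V := H) opp _ _ is_linear_opp). }
  rewrite e2. unfold dsum. rewrite -sum_n_plus. apply sum_n_ext. intros i.
  rewrite -sum_n_plus. apply sum_n_ext. intros k.
  destruct (Nat.eqb_spec i k) as [e3|e3].
  - rewrite indic_false; [|tauto]. rewrite scal_zero_C. exact (plus_opp_r (G := H) _).
  - rewrite indic_true; [|exact e3]. rewrite opp_zero_V.
    eapply eq_trans; [exact (plus_zero_r (G := H) _)|]. symmetry. apply scal_V2. intros hi hk.
    unfold diff_quot. destruct (Req_EM_T (lam i) (lam k)) as [e4|e4].
    + rewrite -e4. symmetry. apply (kern1_diag D phi Dopen Hphi Om Gam Om_open Om_bounded HGam Om_D _ hi).
    + symmetry. apply (kern1_neq D phi Dopen Hphi Om Gam Om_open Om_bounded HGam Om_D _ _ hi hk).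
      intros e5. apply RtoC_inj in e5. contradiction.
Qed.

(** For injective [lam] only [k = j] survives in the inner sum, so each cubic partial sum equals the
    square one. *)
Lemma tends_double_simple x :
  (forall i j, lam i = lam j -> i = j) ->
  tends (dsum (fun i j => scal (indic (lam j <> lam i) * coef_double phi (lam i) (lam j))%C
         (plus (plus (V3 j j i x) (V3 i j j x)) (V3 j i j x)))) (double_sum x).
Proof.
  intros hinj. apply tends_ext with (2 := tends_double x). intros N. unfold tsum, dsum.
  apply sum_n_ext. intros i. apply sum_n_ext_loc. intros j hj.
  rewrite (sum_n_single _ j); [|exact hj|].
  - apply (f_equal (fun c : C => scal (c * _)%C _)). unfold indic.
    destruct (excluded_middle_informative (lam j = lam j /\ lam j <> lam i));
      destruct (excluded_middle_informative (lam j <> lam i)); tauto.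
  - intros k hk. rewrite indic_false; [apply scal_zero_C|].
    intros [e _]. apply hk. symmetry. apply hinj, e.
Qed.

Lemma tends_triple_simple x :
  (forall i j, lam i = lam j -> i = j) ->
  is_series (fun i => scal (C_derive (C_derive phi) (lam i) / 2)%C (V3 i i i x)) (Q2 dG dG x).
Proof.
  intros hinj. apply tends_ext with (2 := tends_triple x). intros N. unfold tsum.
  apply sum_n_ext_loc. intros i hi.
  assert (hz : forall j k, j <> i \/ k <> j ->
    scal (indic (lam i = lam j /\ lam j = lam k) * (C_derive (C_derive phi) (lam i) / 2))%C (V3 i j k x) = zero).
  { intros j k h. rewrite indic_false; [apply scal_zero_C|].
    intros [e1 e2]. apply hinj in e1, e2. subst. tauto. }
  rewrite (sum_n_single _ i); [|exact hi|].
  - rewrite (sum_n_single _ i); [|exact hi|].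
    + rewrite indic_true; [reflexivity|tauto].
    + intros k hk. apply hz. right. exact hk.
  - intros j hj. transitivity (sum_n (fun _ => zero : H) N).
    + apply sum_n_ext. intros k. apply hz. left. exact hj.
    + exact (sum_n_m_const_zero (G := H) 0 N).
Qed.

End SpectralSums.

(** With multiplicities, the two occurrences of a repeated eigenvalue range over its whole
    eigenspace; hence the sums over [j], [k] with [lam j = lam k], which collapse to single indices
    when [lam] is injective. The factor 1/2 of the second derivative is that of the divided
    difference at a triple point. *)
Theorem corollaryB2
  (H : CompleteNormedModule C_AbsRing) (ip : H -> H -> C)
  (Hip : is_inner_product ip) (Hsep : separable H)
  (T : H -> H) (HT : is_linear T)
  (Tcompact : compact_operator T) (Thermitian : hermitian ip T)
  (lam : nat -> R) (P : nat -> H -> H) (Hexp : eigen_expansion ip T lam P)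
  (D : C -> Prop) (phi : C -> C)
  (Dopen : open (T := C_UniformSpace) D) (Hphi : analytic_on D phi)
  (Om : C -> Prop) (Gam : list jordan_curve)
  (Om_open : open (T := C_UniformSpace) Om)
  (Om_bounded : exists M : R, forall z, Om z -> Cmod z <= M)
  (HGam : positive_boundary Om Gam)
  (spec_Om : forall z, spectrum T z -> Om z)
  (Om_D : forall z, closure_of Om z -> D z)
  (dist_pos : exists d : R, 0 < d /\
     forall z w, boundary_of Om z -> spectrum T w -> d <= Cmod (z - w))
  (G : H -> H) (HG : is_linear G) :
  (exists S1 S2 : H -> H,
     strong_sum1 (fun i x => scal (C_derive phi (lam i)) (P i (G (P i x)))) S1 /\
     strong_sum2 (fun i k x =>
       scal (indic (i <> k) * diff_quot phi (lam i) (lam k))%C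
         (P i (G (P k x)))) S2 /\
     forall x, deriv1 Gam T phi G x = plus (S1 x) (S2 x)) /\
  (exists S1 S2 S3 : H -> H,
     strong_sum3 (fun i j k x =>
       scal (indic (lam i <> lam j /\ lam j <> lam k /\ lam k <> lam i)
             * coef_distinct phi (lam i) (lam j) (lam k))%C
         (P i (G (P j (G (P k x)))))) S1 /\
     strong_sum3 (fun i j k x =>
       scal (indic (lam j = lam k /\ lam j <> lam i)
             * coef_double phi (lam i) (lam j))%C
         (plus (plus (P j (G (P k (G (P i x)))))
                     (P i (G (P j (G (P k x))))))
               (P j (G (P i (G (P k x))))))) S2 /\
     strong_sum3 (fun i j k x =>
       scal (indic (lam i = lam j /\ lam j = lam k)
             * (C_derive (C_derive phi) (lam i) / 2))%C
         (P i (G (P j (G (P k x)))))) S3 /\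
     forall x, deriv2 Gam T phi G x = plus (plus (S1 x) (S2 x)) (S3 x)) /\
  ((forall i j, lam i = lam j -> i = j) ->
   exists S1 S2 S3 : H -> H,
     strong_sum3 (fun i j k x =>
       scal (indic (lam i <> lam j /\ lam j <> lam k /\ lam k <> lam i)
             * coef_distinct phi (lam i) (lam j) (lam k))%C
         (P i (G (P j (G (P k x)))))) S1 /\
     strong_sum2 (fun i j x =>
       scal (indic (lam j <> lam i) * coef_double phi (lam i) (lam j))%C
         (plus (plus (P j (G (P j (G (P i x)))))
                     (P i (G (P j (G (P j x))))))
               (P j (G (P i (G (P j x))))))) S2 /\
     strong_sum1 (fun i x =>
       scal (C_derive (C_derive phi) (lam i) / 2)%C
         (P i (G (P i (G (P i x)))))) S3 /\
     forall x, deriv2 Gam T phi G x = plus (plus (S1 x) (S2 x)) (S3 x)).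
Proof.
  destruct dist_pos as [d [hd hdist]].
  assert (Haway : forall z, on_contour Gam z -> away T lam d z).
  { intros z hz. apply (on_contour_boundary Om Gam HGam) in hz. split.
    - intros hs. specialize (hdist z z hz hs).
      replace (z - z)%C with (RtoC 0) in hdist by ring. rewrite Cmod_0 in hdist. lra.
    - intros i hs. exact (hdist z _ hz hs). }
  split; [|split].
  - exists (pinch P (fun i => i) (deriv1 Gam T phi G)).
    exists (fun x => plus (deriv1 Gam T phi G x)
      (scal (- (1))%C (pinch P (fun i => i) (deriv1 Gam T phi G) x))).
    split; [|split].
    + intros x. exact (tends_diag Hip T HT lam P Hexp D phi Dopen Hphi Om Gam Om_open
        Om_bounded HGam spec_Om Om_D d hd Haway G HG x).
    + intros x. exact (tends_offdiag Hip T HT lam P Hexp D phi Dopen Hphi Om Gam Om_open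
        Om_bounded HGam spec_Om Om_D d hd Haway G HG x).
    + intros x. rewrite scal_minus_one plus_minus_cancel. reflexivity.
  - exists (distinct_sum T lam P phi Gam G), (double_sum T lam P phi Gam G),
      (contour_op Gam phi (res2 T (pinch P (cls lam) G) (pinch P (cls lam) G))).
    split; [|split; [|split]]; intros x.
    + exact (tends_distinct Hip T HT lam P Hexp D phi Dopen Hphi Om Gam Om_open
        Om_bounded HGam spec_Om Om_D d hd Haway G HG x).
    + exact (tends_double Hip T HT lam P Hexp D phi Dopen Hphi Om Gam Om_open
        Om_bounded HGam spec_Om Om_D d hd Haway G HG x).
    + exact (tends_triple Hip T HT lam P Hexp D phi Dopen Hphi Om Gam Om_open
        Om_bounded HGam spec_Om Om_D d hd Haway G HG x).
    + exact (total_decomposition T lam P phi Gam G x).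
  - intros hinj. exists (distinct_sum T lam P phi Gam G), (double_sum T lam P phi Gam G),
      (contour_op Gam phi (res2 T (pinch P (cls lam) G) (pinch P (cls lam) G))).
    split; [|split; [|split]]; intros x.
    + exact (tends_distinct Hip T HT lam P Hexp D phi Dopen Hphi Om Gam Om_open
        Om_bounded HGam spec_Om Om_D d hd Haway G HG x).
    + exact (tends_double_simple Hip T HT lam P Hexp D phi Dopen Hphi Om Gam Om_open
        Om_bounded HGam spec_Om Om_D d hd Haway G HG x hinj).
    + exact (tends_triple_simple Hip T HT lam P Hexp D phi Dopen Hphi Om Gam Om_open
        Om_bounded HGam spec_Om Om_D d hd Haway G HG x hinj).
    + exact (total_decomposition T lam P phi Gam G x).
Qed.
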